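(* Let $\mathfrak{g}$ be a simple Lie algebra with $w_0=-\mathrm{id}$. Then the field of invariants of the coadjoint representation of $B$ is trivial: $K(\mathfrak{b}^* )^B=K$.
   Context: Let $K$ be a field of characteristic zero, $\mathfrak{g}$ a split simple Lie algebra over $K$, $\mathfrak{h}$ the standard Cartan subalgebra, $\mathfrak{n}$ the span of the root vectors $e_\alpha$ with $\alpha>0$, and $\mathfrak{b}=\mathfrak{h}\oplus\mathfrak{n}$ the Borel subalgebra. $w_0$ is the longest element of the Weyl group of $\mathfrak{g}$, acting on the span of the roots. Let $G$ be a (connected) linear algebraic group with Lie algebra $\mathfrak{g}$ and $B\subset G$ the Borel subgroup with Lie algebra $\mathfrak{b}$. $B$ acts on $\mathfrak{b}^*$ by the coadjoint representation $(\mathrm{Ad}^*_gf)(x)=f(\mathrm{Ad}_g^{-1}x)$, hence on the field $K(\mathfrak{b}^* )$ of rational functions on $\mathfrak{b}^*$. *)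

(* Defs.v *)
From HB Require Import structures.
From mathcomp Require Import all_boot all_order all_algebra all_field.
From mathcomp Require Import mpoly.

Set Implicit Arguments.
Unset Strict Implicit.
Unset Printing Implicit Defensive.

Import GRing.Theory.
Local Open Scope ring_scope.

HB.mixin Record Vector_isLie (K : fieldType) L of Vector K L := {
  lie : L -> L -> L;
  lie_linearr : forall x : L, linear (lie x);
  lie_linearl : forall y : L, linear (lie^~ y);
  liexx : forall x : L, lie x x = 0;
  lie_jacobi : forall x y z : L,
    lie x (lie y z) + lie y (lie z x) + lie z (lie x y) = 0
}.

#[short(type="lieAlgType")]
HB.structure Definition LieAlg (K : fieldType) :=
  {L of Vector_isLie K L & Vector K L}.

(* The subspace U is the linear span of the (possibly infinite) set P. *)
Definition is_span (K : fieldType) (V : vectType K)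
    (P : V -> Prop) (U : {vspace V}) : Prop :=
  forall W : {vspace V}, (U <= W)%VS <-> (forall x, P x -> x \in W).

Section LieAlgebras.
Variables (K : fieldType) (g : lieAlgType K).
Implicit Types (U V h : {vspace g}) (x : g).

Definition lie_prod U V : {vspace g} :=
  <<[seq lie x y | x <- vbasis U, y <- vbasis V]>>%VS.

Definition lie_simple : Prop :=
  lie_prod fullv fullv <> 0%VS /\
  (forall U, (lie_prod fullv U <= U)%VS -> U = 0%VS \/ U = fullv).

Definition lie_subalgebra h : Prop := (lie_prod h h <= h)%VS.

Definition lie_nilpotent h : Prop := exists n, iter n (lie_prod h) h = 0%VS.

Definition self_normalizing h : Prop :=
  forall x, (forall y, y \in h -> lie x y \in h) -> x \in h.

Definition cartan_subalgebra h : Prop :=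
  [/\ lie_subalgebra h, lie_nilpotent h & self_normalizing h].

(* ad x is upper triangular over K in some basis of the Lie algebra. *)
Definition ad_triangularizable x : Prop :=
  exists2 e : seq g, basis_of fullv e
  & forall i, (i < size e)%N -> lie x e`_i \in <<take i.+1 e>>%VS.

Definition splitting_cartan h : Prop :=
  cartan_subalgebra h /\ (forall x, x \in h -> ad_triangularizable x).

End LieAlgebras.

Arguments lie_simple {K} g.

Notation dual K V := 'Hom(V, K^o).

Section Roots.
Variables (K : fieldType) (g : lieAlgType K) (h : {vspace g}).

Local Notation "'h^*'" := (dual K (subvs_of h)).

Definition weight_vector (alpha : h^*) (x : g) : Prop :=
  forall t : subvs_of h, lie (vsval t) x = (alpha t : K) *: x.

Definition is_root (alpha : h^*) : Prop :=
  alpha <> 0 /\ (exists2 x, x <> 0 & weight_vector alpha x).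

Definition nat_comb (Delta : seq h^*) (alpha : h^*) : Prop :=
  exists c : nat -> nat, alpha = \sum_(i < size Delta) Delta`_i *+ c i.

(* Delta is a base (a system of simple roots) of the root system. *)
Definition root_base (Delta : seq h^*) : Prop :=
  [/\ free Delta, (forall alpha, alpha \in Delta -> is_root alpha)
    & forall alpha, is_root alpha ->
        nat_comb Delta alpha \/ nat_comb Delta (- alpha)].

Definition pos_root (Delta : seq h^*) (alpha : h^*) : Prop :=
  is_root alpha /\ nat_comb Delta alpha.

(* The coroot of alpha is the element H of [g_alpha, g_(-alpha)] such that   *)
(* alpha(H) = 2.                                                             *)
Definition is_coroot (alpha : h^*) (H : subvs_of h) : Prop :=
  (exists e f : g, [/\ weight_vector alpha e, weight_vector (- alpha) f
                     & vsval H = lie e f]) /\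
  alpha H = 2%:R :> K.

Definition is_reflection (alpha : h^*) (s : 'End(h^*)) : Prop :=
  exists2 H, is_coroot alpha H
  & forall lambda : h^*, s lambda = lambda - (lambda H : K) *: alpha.

Definition reflection_word (R : h^* -> Prop) (n : nat) (w : 'End(h^*)) : Prop :=
  exists ss : seq 'End(h^*),
    [/\ size ss = n,
        (forall s, s \in ss -> exists2 alpha, R alpha & is_reflection alpha s)
      & w = foldr (fun s u => (s \o u)%VF) \1%VF ss].

Definition weyl_group (w : 'End(h^*)) : Prop :=
  exists n, reflection_word is_root n w.

Definition has_length (Delta : seq h^*) (w : 'End(h^*)) (n : nat) : Prop :=
  reflection_word (fun alpha => alpha \in Delta) n w /\
  (forall m, reflection_word (fun alpha => alpha \in Delta) m w -> (n <= m)%N).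

Definition longest_element (Delta : seq h^*) (w0 : 'End(h^*)) : Prop :=
  weyl_group w0 /\
  (exists2 n0, has_length Delta w0 n0
   & forall w n, weyl_group w -> has_length Delta w n -> (n <= n0)%N).

Definition minus_id_on_roots (w : 'End(h^*)) : Prop :=
  forall E : {vspace h^*}, is_span is_root E ->
  forall lambda, lambda \in E -> w lambda = - lambda.

Definition pos_root_span (Delta : seq h^*) (n : {vspace g}) : Prop :=
  is_span (fun x => exists2 alpha, pos_root Delta alpha & weight_vector alpha x)
          n.

End Roots.

(* A connected linear algebraic group over a field K of characteristic zero  *)
(* is given by its group of K-points, a Zariski closed subgroup of GL_N(K):  *)
(* the K-points are Zariski dense.                                           *)
Section AlgebraicGroups.
Variables (K : fieldType) (N : nat).
Implicit Types (S Z : 'M[K]_N -> Prop) (A X : 'M[K]_N).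
Implicit Type p : {mpoly K[N * N]}.

Definition mx_eval p A : K := p.@[fun k => mxvec A 0 k].

Definition zariski_closed Z : Prop :=
  exists I : {mpoly K[N * N]} -> Prop,
    forall A, Z A <-> A \in unitmx /\ (forall p, I p -> mx_eval p A = 0).

Definition zariski_connected S : Prop :=
  forall Z1 Z2, zariski_closed Z1 -> zariski_closed Z2 ->
    (forall A, S A -> Z1 A \/ Z2 A) -> (forall A, S A -> ~ (Z1 A /\ Z2 A)) ->
    (forall A, S A -> Z1 A) \/ (forall A, S A -> Z2 A).

Definition matrix_group S : Prop :=
  [/\ (forall A, S A -> A \in unitmx), S 1%:M,
      (forall A C, S A -> S C -> S (A *m C))
    & (forall A, S A -> S (invmx A))].

Definition connected_alg_group S : Prop :=
  [/\ matrix_group S, zariski_closed S & zariski_connected S].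

(* The tangent space of S at the identity: the X killed by the differential  *)
(* at 1 of every polynomial vanishing on S.                                  *)
Definition alg_lie S X : Prop :=
  forall p, (forall A, S A -> mx_eval p A = 0) ->
    \sum_(k < N * N) mx_eval (mderiv k p) 1%:M * mxvec X 0 k = 0.

Definition derived_group S A : Prop :=
  forall L : 'M[K]_N -> Prop, matrix_group L ->
    (forall C D, S C -> S D -> L (C *m D *m invmx C *m invmx D)) -> L A.

Definition solvable_group S : Prop :=
  exists n, forall A, iter n derived_group S A -> A = 1%:M.

Definition borel_subgroup (G B : 'M[K]_N -> Prop) : Prop :=
  [/\ connected_alg_group B, (forall A, B A -> G A), solvable_group B
    & forall H, connected_alg_group H -> solvable_group H ->
        (forall A, H A -> G A) -> (forall A, B A -> H A) ->
        forall A, H A -> B A].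

End AlgebraicGroups.

(* iota identifies the Lie algebra g with the Lie algebra of G.              *)
Definition lie_algebra_of (K : fieldType) (g : lieAlgType K) (N : nat)
    (G : 'M[K]_N -> Prop) (iota : 'Hom(g, 'M[K]_N)) : Prop :=
  [/\ lker iota = 0%VS,
      (forall x y : g, iota (lie x y) = iota x *m iota y - iota y *m iota x)
    & forall X, X \in limg iota <-> alg_lie G X].

Section RationalFunctions.
Variables (K : fieldType) (V : vectType K).

(* K(V); the variable 'X_i is the i-th coordinate on V in the basis          *)
(* vbasis fullv.                                                             *)
Definition ratfun := {fraction {mpoly K[\dim {:V}]}}.

Definition poly_comp (T : V -> V) (p : {mpoly K[\dim {:V}]}) :
    {mpoly K[\dim {:V}]} :=
  p \mPo [tuple \sum_(j < \dim {:V})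
            coord (vbasis {:V}) i (T (vbasis {:V})`_j) *: 'X_j
         | i < \dim {:V}].

(* F \o T for an invertible linear map T; the result does not depend on the  *)
(* representative p / q of F.                                                *)
Definition ratfun_comp (T : V -> V) (F : ratfun) : ratfun :=
  tofrac (poly_comp T \n_(repr F)) / tofrac (poly_comp T \d_(repr F)).

Definition ratfun_const (c : K) : ratfun := tofrac c%:MP.

End RationalFunctions.

Section Coadjoint.
Variables (K : fieldType) (g : lieAlgType K) (N : nat).
Variables (iota : 'Hom(g, 'M[K]_N)) (b : {vspace g}).

Definition Ad (A : 'M[K]_N) (x : g) : g :=
  (iota^-1)%VF (A *m iota x *m invmx A).

Definition coAd (A : 'M[K]_N) (f : dual K (subvs_of b)) : dual K (subvs_of b) :=
  linfun (fun x : subvs_of b => f (vsproj b (Ad (invmx A) (vsval x)))).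

(* (A . F)(f) = F(Ad^*_(A^-1) f). *)
Definition ratfun_act (A : 'M[K]_N) (F : ratfun (dual K (subvs_of b))) :
    ratfun (dual K (subvs_of b)) :=
  ratfun_comp (coAd (invmx A)) F.

End Coadjoint.

(* Main.v *)
Require Import Defs.
From HB Require Import structures.
From mathcomp Require Import all_boot all_order all_algebra all_field ring zify.
From mathcomp Require Import mpoly.
From Stdlib Require Import Classical ClassicalEpsilon.

Set Implicit Arguments.
Unset Strict Implicit.
Unset Printing Implicit Defensive.

Import Order.TTheory GRing.Theory Num.Theory.
Local Open Scope ring_scope.

(** Differentiating the invariance of F = p / q along x in b gives, at a point f of
    b^*, the linear relation sum_i G_i(f) (ad^*_x f)_i = 0, where
    G_i = q d_i p - p d_i q.  If the alternating form f([x, y]) on b is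
    nondegenerate for one f, its Gram determinant is a nonzero polynomial in f; off
    its zero set the vectors ad^*_x f span b^*, so that all G_i vanish and F is
    constant in characteristic 0.

    Such an f comes from Kostant's cascade: choose roots b_1, b_2, ... with b_k of
    maximal height among the roots orthogonal to b_1, ..., b_(k-1), until none is
    left.  The product w of the reflections in the b_k maps positive roots to
    negative roots, hence is w_0, and w_0 = -1 means that the b_k span the dual of
    the Cartan subalgebra.  For f = kappa(sum_k e_(- b_k), -) every positive root
    outside the cascade has a unique partner with which it sums to some b_k, while
    the b_k themselves pair with the Cartan subalgebra; this makes f([x, y])
    nondegenerate.

    The root space decomposition and the nondegeneracy of the Killing form kappa are
    derived from traces over root strings. *)

(** * Traces of endomorphisms *)

(** K is neither ordered nor algebraically closed, and this shapes the algebra. Every positivity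
    argument (sums of squares of weights, signs of pairings, heights) runs through witnesses in
    [nat] or [int], compared through their images in K; characteristic 0 makes that comparison
    faithful. Eigenvalues come only from the splitting hypothesis: weight spaces start as
    generalized eigenspaces of a nilpotent algebra, and become lines of true eigenvectors only after
    the sl2 trace count.

    On the group side there is no exponential map. A tangent vector is known only through the
    polynomials vanishing on B, so a relation that holds on B is first multiplied by a power of the
    determinant, which turns it into such a polynomial, and is then differentiated at 1.

    The condition on w_0 acts at one point: it makes an element of the Cartan subalgebra that is
    killed by the whole cascade vanish, which is what the Cartan part of the radical needs. *)

Lemma mxtrace_nilpotent (K : fieldType) m (A : 'M[K]_m) k :
  A ^+ k = 0 -> \tr A = 0.
Proof.
case: m A => [|m] A Ak0; first by rewrite /mxtrace big_ord0.
apply/eqP; rewrite -oppr_eq0 -(char_poly_trace A) //.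
(* Taking determinants in the factorization of X^k - A^k by X - A gives the divisibility. Hence
   [char_poly A] is a power of X, and its subleading coefficient, minus the trace, is 0. *)
have dvd : char_poly A %| ('X - 0%:P) ^+ (k * m.+1).
  have Ak : map_mx polyC A ^+ k = 0 :> 'M[{poly K}]_m.+1.
    have <- : map_mx polyC (A ^+ k) = map_mx polyC A ^+ k.
      elim: (k) => [|i IH]; first by rewrite !expr0 map_mx1.
      by rewrite !exprS map_mxM IH.
    by rewrite Ak0 map_mx0.
  have eqX : (char_poly_mx A *m \sum_(i < k) 'X%:M ^+ (k.-1 - i) *m map_mx polyC A ^+ i)
       = ('X ^+ k)%:M.
    have comm : GRing.comm ('X%:M : 'M_m.+1) (map_mx polyC A).
      exact/esym/scalar_mxC.
    have Xk : ('X ^+ k)%:M = 'X%:M ^+ k :> 'M[{poly K}]_m.+1.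
      by elim: (k) => [|i IH] //; rewrite !exprS scalar_mxM IH.
    have := subrXX_comm k comm; rewrite Ak subr0 Xk => e.
    exact: esym e.
  have := congr1 determinant eqX.
  rewrite det_mulmx det_scalar -exprM subr0 => <-.
  exact: dvdp_mulIl.
case/dvdp_exp_XsubCP: dvd => n [_].
rewrite subr0 eqp_monic ?char_poly_monic ?monicXn // => /eqP e.
have := size_char_poly A; rewrite e size_polyXn => -[->].
by rewrite coefXn /= eqn_leq ltnn andbF.
Qed.

Section EndTrace.
Import passmx.
Variable K : fieldType.
Implicit Types (V W : vectType K).

Definition lftr V (f : 'End(V)) : K := \tr (mxof (vbasis {:V}) (vbasis {:V}) f).

Lemma lftr_is_linear V : linear_for *%R (@lftr V).
Proof. by move=> a f1 f2; rewrite /lftr mxof_linear mxtraceD mxtraceZ. Qed.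
HB.instance Definition _ V :=
  GRing.isLinear.Build K 'End(V) K *%R (@lftr V) (@lftr_is_linear V).

Lemma lftrC V W (f : 'Hom(V, W)) (g : 'Hom(W, V)) :
  lftr (f \o g)%VF = lftr (g \o f)%VF.
Proof.
by rewrite /lftr !(mxof_comp _ _ (vbasisP _)) mxtrace_mulC.
Qed.

Lemma lftr1 V : lftr (\1%VF : 'End(V)) = (\dim {:V})%:R.
Proof. by rewrite /lftr mxof1 ?mxtrace1 ?(basis_free (vbasisP _)). Qed.

Lemma lftr_nilpotent V (f : 'End(V)) k : (forall y, iter k f y = 0) -> lftr f = 0.
Proof.
move=> fk0; apply: (@mxtrace_nilpotent _ _ _ k).
have e0 := mxof1 (basis_free (vbasisP {:V})).
have -> : mxof (vbasis {:V}) (vbasis {:V}) f ^+ k =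
    mxof (vbasis {:V}) (vbasis {:V}) (iter k (comp_lfun f) \1%VF).
  elim: k {fk0} => [|k IH]; first by rewrite expr0 e0.
  by rewrite exprSr IH iterS (mxof_comp _ _ (vbasisP _)).
have -> : iter k (comp_lfun f) \1%VF = 0 :> 'End(V).
  apply/lfunP => y; rewrite zero_lfunE -(fk0 y).
  by elim: k {fk0} => [|k IH]; rewrite /= ?id_lfunE // comp_lfunE IH.
exact: linear0.
Qed.

Definition lfstable V (U : {vspace V}) (f : 'End(V)) := forall y, y \in U -> f y \in U.

(** For an f-stable U this is the trace of the restriction of f to U. Composing with a projector
    keeps everything in ['End(V)], whatever U is. *)
Definition trv V (U : {vspace V}) (f : 'End(V)) : K := lftr (f \o projv U)%VF.

Lemma trv_is_linear V (U : {vspace V}) : linear_for *%R (trv U).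
Proof.
move=> a f1 f2; rewrite /trv -(linearP (@lftr V)); congr lftr.
by rewrite comp_lfunDl -comp_lfunZl.
Qed.
HB.instance Definition _ V U :=
  GRing.isLinear.Build K 'End(V) K *%R (trv U) (@trv_is_linear V U).

Lemma lfstable_comp V (U : {vspace V}) f g : lfstable U f -> lfstable U g ->
  lfstable U (f \o g)%VF.
Proof. by move=> sf sg y Uy; rewrite comp_lfunE; exact/sf/sg. Qed.

(** All projectors onto U give the same trace: [f \o p] has its image in U, so [projv U] may be put
    in front, and cyclicity moves it behind, where p acts as the identity. *)
Lemma trv_proj V (U : {vspace V}) (p f : 'End(V)) :
  (forall y, p y \in U) -> (forall y, y \in U -> p y = y) -> lfstable U f ->
  lftr (f \o p)%VF = trv U f.
Proof.
move=> pU pid sf; rewrite /trv.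
have -> : (f \o p = projv U \o (f \o p))%VF.
  by apply/lfunP => y; rewrite !comp_lfunE projv_id ?sf.
rewrite (lftrC (projv U)); congr lftr; apply/lfunP => y; rewrite !comp_lfunE.
by rewrite pid ?memv_proj.
Qed.

Lemma trv_id V (U : {vspace V}) : trv U \1%VF = (\dim U)%:R.
Proof.
have -> : \dim U = \dim {:subvs_of U} by rewrite dimvf.
rewrite -lftr1 -[LHS](@trv_proj _ U
   (linfun (@vsval _ _ U) \o linfun (vsproj U))%VF) => //.
- rewrite comp_lfun1l lftrC; congr lftr; apply/lfunP => y.
  by rewrite comp_lfunE !lfunE /= vsvalK.
- by move=> y; rewrite comp_lfunE !lfunE /= subvsP.
- by move=> y Uy; rewrite comp_lfunE !lfunE /= vsprojK.
- by move=> y Uy; rewrite id_lfunE.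
Qed.

Lemma trv_comm V (U : {vspace V}) f g : lfstable U f -> lfstable U g ->
  trv U (f \o g)%VF = trv U (g \o f)%VF.
Proof.
move=> sf sg; rewrite /trv.
have e h1 h2 : lfstable U h1 -> lfstable U h2 ->
    ((h1 \o h2) \o projv U = (h1 \o projv U) \o (h2 \o projv U))%VF.
  move=> s1 s2; apply/lfunP=> y; rewrite !comp_lfunE.
  by rewrite [projv U (h2 _)]projv_id // s2 ?memv_proj.
by rewrite !e // lftrC.
Qed.

(** On U, f is a scalar plus a nilpotent map, and only the scalar contributes to the trace. *)
Lemma trv_geigen V (U : {vspace V}) f a k : lfstable U f ->
  (forall y, y \in U -> iter k (f - a *: \1)%VF y = 0) ->
  trv U f = a * (\dim U)%:R.
Proof.
move=> sf fk; have -> : a * (\dim U)%:R = trv U (a *: \1%VF) by rewrite linearZ /= trv_id.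
rewrite -[f in LHS](subrK (a *: \1%VF)) linearD /= -[RHS]add0r; congr (_ + _).
(* One extra power: the first application only brings y into U. *)
apply: (@lftr_nilpotent _ _ k.+1) => y.
have sg : lfstable U (f - a *: \1)%VF.
  move=> z Uz; rewrite add_lfunE opp_lfunE scale_lfunE id_lfunE.
  by rewrite memvB ?sf ?memvZ.
rewrite iterSr comp_lfunE.
have: (f - a *: \1)%VF (projv U y) \in U by rewrite sg ?memv_proj.
move: (_ (projv U y)) => z Uz; rewrite -[RHS](fk z Uz).
suff [] : iter k ((f - a *: \1) \o projv U)%VF z = iter k (f - a *: \1)%VF z
  /\ iter k (f - a *: \1)%VF z \in U by [].
elim: k {fk} => [|k [IH IHU]] //=.
by rewrite comp_lfunE IH (projv_id IHU); split => //; apply: sg.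
Qed.

Lemma trv_add V (U W : {vspace V}) f : lfstable U f -> lfstable W f ->
  (U :&: W = 0)%VS -> trv (U + W) f = trv U f + trv W f.
Proof.
move=> sU sW UW0.
have WU0 : (W :&: U = 0)%VS by rewrite capvC.
(* The two projectors p and q of the direct sum add up to [projv (U + W)]. *)
pose p := (daddv_pi U W \o projv (U + W))%VF.
pose q := (daddv_pi W U \o projv (U + W))%VF.
have -> : trv U f = lftr (f \o p)%VF.
  rewrite (@trv_proj _ U) // => y; rewrite comp_lfunE ?memv_pi // => Uy.
  have e : projv (U + W)%VS y = y.
    by apply: projv_id; move: Uy; apply/subvP; exact: addvSl.
  by rewrite e; exact: daddv_pi_id.
have -> : trv W f = lftr (f \o q)%VF.
  rewrite (@trv_proj _ W) // => y; rewrite comp_lfunE ?memv_pi // => Uy.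
  have e : projv (U + W)%VS y = y.
    by apply: projv_id; move: Uy; apply/subvP; exact: addvSr.
  by rewrite e; exact: daddv_pi_id.
rewrite -linearD -comp_lfunDr /trv; congr (lftr (_ \o _)%VF).
by apply/lfunP=> y; rewrite add_lfunE !comp_lfunE daddv_pi_add ?memv_proj.
Qed.

Lemma trv0 V f : trv (0%VS : {vspace V}) f = 0.
Proof.
rewrite /trv (_ : (_ \o _)%VF = 0) ?linear0 //; apply/lfunP => y.
rewrite comp_lfunE zero_lfunE.
by have := memv_proj 0%VS y; rewrite memv0 => /eqP->; rewrite linear0.
Qed.

Definition indep V (I : eqType) (r : seq I) (U : I -> {vspace V}) :=
  forall u, (forall i, i \in r -> u i \in U i) -> \sum_(i <- r) u i = 0 ->
  forall i, i \in r -> u i = 0.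

Lemma indep_cons V (I : eqType) i (r : seq I) (U : I -> {vspace V}) :
  i \notin r -> indep (i :: r) U -> indep r U.
Proof.
move=> ir ind u uU u0 j jr.
have := ind (fun k => if k == i then 0 else u k).
have ji : (j == i) = false by apply/eqP => e; rewrite -e jr in ir.
move=> /(_ _ _ j); rewrite inE jr orbT ji; apply => //.
- by move=> k; rewrite inE; case: eqP => [_ _|_ /= /uU //]; rewrite mem0v.
- rewrite big_cons eqxx add0r -[RHS]u0; apply: eq_big_seq => k kr.
  by case: eqP => // e; rewrite -e kr in ir.
Qed.

Lemma memv_sum_seq V (I : eqType) (r : seq I) (U : I -> {vspace V}) v :
  uniq r -> v \in (\sum_(i <- r) U i)%VS ->
  exists u, (forall i, i \in r -> u i \in U i) /\ v = \sum_(i <- r) u i.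
Proof.
move=> ur vU.
exists (fun i => sumv_pi (\sum_(i <- r) U i)%VS i v); split=> [i _|].
  exact: memv_sum_pi.
by rewrite sumv_pi_uniq_sum // filter_predT.
Qed.

Lemma memv_sum_seqI V (I : eqType) (r : seq I) (U : I -> {vspace V}) i v :
  i \in r -> v \in U i -> v \in (\sum_(j <- r) U j)%VS.
Proof.
move=> ir vU; rewrite (big_rem i) //= -[v]addr0.
by rewrite memv_add ?mem0v.
Qed.

Lemma lfstable_sum V (I : eqType) (r : seq I) (U : I -> {vspace V}) (f : 'End(V)) :
  (forall i y, i \in r -> y \in U i -> f y \in (\sum_(j <- r) U j)%VS) ->
  lfstable (\sum_(i <- r) U i)%VS f.
Proof.
move=> st y yU; have := limgS f (subvv (\sum_(i <- r) U i)%VS).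
have : f y \in (f @: \sum_(i <- r) U i)%VS by rewrite memv_img.
rewrite limg_sum => fy _; move: fy; apply/subvP.
rewrite big_seq_cond; apply: (big_ind (fun A => (A <= \sum_(i <- r) U i)%VS)).
- exact: sub0v.
- by move=> A B A1 B1; rewrite subv_add A1 B1.
- move=> i /andP[ir _]; apply/subvP => z /memv_imgP[w wU ->]; exact: st wU.
Qed.

Lemma trv_sum V (I : eqType) (r : seq I) (U : I -> {vspace V}) f :
  uniq r -> indep r U -> (forall i, i \in r -> lfstable (U i) f) ->
  trv (\sum_(i <- r) U i)%VS f = \sum_(i <- r) trv (U i) f.
Proof.
elim: r => [|i r IH]; first by rewrite !big_nil trv0.
rewrite cons_uniq => /andP[ir ur] ind st; rewrite !big_cons trv_add.
- rewrite IH //; first exact: indep_cons ind.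
  by move=> j jr; apply: st; rewrite inE jr orbT.
- by apply: st; rewrite mem_head.
- apply: lfstable_sum => j y jr yU; apply: (memv_sum_seqI jr).
  by apply: st yU; rewrite inE jr orbT.
- apply/eqP; rewrite -subv0; apply/subvP => v /memv_capP[vi].
  case/(memv_sum_seq ur) => u [uU ev].
  have := ind (fun k => if k == i then - v else u k).
  move=> /(_ _ _ i); rewrite mem_head eqxx memv0 => h.
  rewrite -oppr_eq0; apply/eqP/h => //.
  + by move=> k; rewrite inE; case: eqP => [->|_ /= /uU]; rewrite ?memvN.
  + rewrite big_cons eqxx ev addrC; apply/eqP; rewrite subr_eq0; apply/eqP.
    apply: eq_big_seq => k kr; by case: eqP => // e; rewrite -e kr in ir.
Qed.

End EndTrace.

(** * Generalized eigenspaces *)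

Section GenEigen.
Variables (K : fieldType) (V : vectType K).
Implicit Types (f : 'End(V)) (a b : K) (U M : {vspace V}).

Lemma shiftE f a y : (f - a *: \1)%VF y = f y - a *: y.
Proof. by rewrite add_lfunE opp_lfunE scale_lfunE id_lfunE. Qed.

Lemma lfstable_shift M f a : lfstable M f -> lfstable M (f - a *: \1)%VF.
Proof. by move=> sf y My; rewrite shiftE memvB ?sf ?memvZ. Qed.

Lemma iter_lfun_linear f k : linear (iter k f).
Proof. by elim: k => [|k IH] // a u v; rewrite !iterS IH linearP. Qed.
HB.instance Definition _ f k :=
  GRing.isLinear.Build K V V *:%R (iter k f) (@iter_lfun_linear f k).

(** A strictly increasing chain of kernels of powers of f would outgrow the dimension, and once two
    consecutive kernels agree the chain is constant. This lets [gsp] be the kernel of one fixed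
    power. *)
Lemma iter_ker_dim f k y : iter k f y = 0 -> iter (\dim {:V}) f y = 0.
Proof.
pose L j := lker (linfun (iter j f)).
have memL j z : (z \in L j) = (iter j f z == 0) by rewrite memv_ker lfunE.
have [j lej stab] : exists2 j, (j <= \dim {:V})%N & (L j.+1 <= L j)%VS.
  case: (boolP [exists j : 'I_(\dim {:V}).+1, (L j.+1 <= L j)%VS]).
    by case/existsP => j stab; exists (j : nat); rewrite // -ltnS.
  rewrite negb_exists => /forallP h.
  suff H j : (j <= (\dim {:V}).+1)%N -> (j <= \dim (L j))%N.
    have := leq_trans (H _ (leqnn _)) (dimvS (subvf _)).
    by rewrite ltnn.
  elim: j => // j IH lej; apply: leq_ltn_trans (IH (ltnW lej)) _.
  have sub : (L j <= L j.+1)%VS.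
    by apply/subvP => z; rewrite !memL iterS => /eqP->; rewrite linear0.
  rewrite ltn_neqAle dimvS // andbT; apply/eqP => e.
  have := h (Ordinal lej); rewrite /= => /negP[].
  by have [_] := dimv_leqif_sup sub; rewrite e eqxx => <-.
have desc i : iter (i + j) f y = 0 -> iter j f y = 0.
  elim: i => // i IH; rewrite addSn -addnS addnC iterD => h; apply: IH.
  rewrite addnC iterD; apply/eqP; rewrite -memL; apply: (subvP stab).
  by rewrite memL h.
move=> fk; rewrite -(subnK lej) iterD.
have -> : iter j f y = 0 by apply: (desc k); rewrite addnC iterD fk linear0.
exact: linear0.
Qed.

Definition gsp f a := lker (linfun (iter (\dim {:V}) (f - a *: \1)%VF)).

Lemma gspP f a y :
  reflect (exists k, iter k (f - a *: \1)%VF y = 0) (y \in gsp f a).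
Proof.
rewrite memv_ker lfunE; apply: (iffP eqP) => [|[k]]; last exact: iter_ker_dim.
by exists (\dim {:V}).
Qed.

Lemma shift_comm f a b k y :
  iter k (f - a *: \1)%VF ((f - b *: \1)%VF y) = (f - b *: \1)%VF (iter k (f - a *: \1)%VF y).
Proof.
have fB u v : f (u - v) = f u - f v by rewrite linearB.
have fZ c u : f (c *: u) = c *: f u by rewrite linearZ.
elim: k => // k IH; rewrite !iterS IH; move: (iter k _ y) => z.
rewrite !shiftE !fB !fZ !scalerBr !opprB addrACA [RHS]addrACA.
by rewrite !scalerA [b * a]mulrC; congr (_ + _); rewrite addrC.
Qed.

(** Induction on the order of y at a: the image of y under f - a lies in both spaces, hence is 0. So
    y is a true eigenvector, which powers of f - b multiply by powers of a - b. *)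
Lemma gsp_neq f a b y : a != b -> y \in gsp f a -> y \in gsp f b -> y = 0.
Proof.
move=> ab /gspP[k]; elim: k y => // k IH y; rewrite iterSr => ya yb.
have fy : f y = a *: y.
  apply/eqP; rewrite -subr_eq0 -shiftE; apply/eqP/IH => //.
  by case/gspP: yb => l yb; apply/gspP; exists l; rewrite shift_comm yb linear0.
case/gspP: yb => l; have -> : iter l (f - b *: \1)%VF y = (a - b) ^+ l *: y.
  elim: l => [|l IHl]; first by rewrite scale1r.
  by rewrite iterS IHl linearZ /= shiftE fy -scalerBl scalerA exprSr.
move/eqP; rewrite scaler_eq0 expf_eq0 subr_eq0 (negbTE ab) andbF /=.
by move/eqP.
Qed.

Lemma shift_sqr f a :
  ((f \o f) - a ^+ 2 *: \1 = (f - a *: \1) \o (f - (- a) *: \1))%VF.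
Proof.
have fD u v : f (u + v) = f u + f v by rewrite linearD.
have fZ c u : f (c *: u) = c *: f u by rewrite linearZ.
apply/lfunP => y; rewrite shiftE !comp_lfunE !shiftE scaleNr opprK fD fZ.
by rewrite scalerDr scalerA -expr2 opprD addrA addrK.
Qed.

(** Here f - a is the nonzero scalar b - a plus the locally nilpotent f - b. If w1 is a preimage of
    (f - b) z, found by induction on the order of z, then (z - w1) / (b - a) is a preimage of z. *)
Lemma gsp_div M f a b z : lfstable M f -> a != b -> z \in (M :&: gsp f b)%VS ->
  exists2 w, w \in (M :&: gsp f b)%VS & (f - a *: \1)%VF w = z.
Proof.
move=> sM ab /memv_capP[Mz /gspP[k]]; have ba : b - a != 0 by rewrite subr_eq0 eq_sym.
elim: k z Mz => [|k IH] z Mz.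
  by move=> /= ->; exists 0; rewrite ?linear0 ?mem0v.
rewrite iterSr => zk.
have [||w1 /memv_capP[Mw1 w1b] e1] := IH ((f - b *: \1)%VF z);
  [exact: lfstable_shift | by [] |].
have zb : z \in gsp f b by apply/gspP; exists k.+1; rewrite iterSr.
exists ((b - a)^-1 *: (z - w1)).
  by rewrite memv_cap !memvZ ?memvB.
rewrite linearZ linearB /= e1 !shiftE.
have -> : f z - a *: z - (f z - b *: z) = (b - a) *: z.
  by rewrite opprB addrC addrA subrK scalerBl.
by rewrite scalerA mulVf ?scale1r.
Qed.

Fixpoint shifts f (s : seq K) y := if s is a :: s' then shifts f s' ((f - a *: \1)%VF y) else y.

(** A component of (f - a) y at b different from a is divisible by f - a; subtracting the quotient
    from y removes it. When only the component at a is left, a power of f - a kills y. *)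
Lemma gsp_split_step M f a s y : lfstable M f -> y \in M ->
  (f - a *: \1)%VF y \in (M :&: gsp f a + \sum_(b <- s) (M :&: gsp f b))%VS ->
  y \in (M :&: gsp f a + \sum_(b <- s) (M :&: gsp f b))%VS.
Proof.
move=> sM; elim: s y => [|b s IH] y My.
  rewrite big_nil addv0 => /memv_capP[_ /gspP[k h]].
  by apply/memv_capP; split=> //; apply/gspP; exists k.+1; rewrite iterSr.
rewrite big_cons addvA [(_ + (M :&: gsp f b))%VS]addvC -addvA.
case/memv_addP => z zb [u uU e].
have [ab|ab] := eqVneq a b.
  rewrite -ab in zb *; rewrite addvA addvv; apply: IH => //.
  rewrite e; apply: memvD uU; move: zb; apply/subvP; exact: addvSl.
have [w wb ew] := gsp_div sM ab zb.
rewrite -[y](subrK w) addrC memv_add //; apply: IH.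
  by rewrite memvB //; case/memv_capP: wb.
by rewrite linearB /= ew e addrAC subrr add0r.
Qed.

Lemma gsp_split M f s y : lfstable M f -> y \in M -> shifts f s y = 0 ->
  y \in (\sum_(b <- s) (M :&: gsp f b))%VS.
Proof.
move=> sM; elim: s y => [|a s IH] y My /=; first by move=> ->; rewrite mem0v.
move=> h; rewrite big_cons; apply: gsp_split_step => //.
have := IH _ (lfstable_shift a sM My) h; apply/subvP; exact: addvSr.
Qed.

Definition lftriang f := exists2 e : seq V, basis_of fullv e
  & forall i, (i < size e)%N -> f e`_i \in <<take i.+1 e>>%VS.

(** The scalars are the diagonal entries, the last one applied first: f minus the last entry maps
    each step of the flag into the preceding one. *)
Lemma lftriang_shifts f : lftriang f -> exists s, forall y, shifts f s y = 0.
Proof.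
case=> e be fe.
have st i : (i <= size e)%N -> lfstable <<take i e>>%VS f.
  move=> le y /(memv_img f); apply/subvP; rewrite limg_span; apply/span_subvP.
  move=> _ /mapP[x xe ->]; case/(nthP 0): xe => j.
  rewrite size_take_min (minn_idPl le) => lj <-.
  rewrite nth_take //; have := fe j (leq_trans lj le); apply/subvP.
  apply: sub_span => z; rewrite -(take_takel _ lj); exact: mem_take.
suff H i : (i <= size e)%N -> exists s, forall y, y \in <<take i e>>%VS -> shifts f s y = 0.
  have [s hs] := H _ (leqnn _); exists s => y; apply: hs.
  by rewrite take_size (span_basis be) memvf.
elim: i => [|i IH] lt.
  by exists [::] => y; rewrite take0 span_nil memv0 => /eqP.
have [s hs] := IH (ltnW lt).
have tE : <<take i.+1 e>>%VS = (<<take i e>> + <[e`_i]>)%VS.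
  by rewrite (take_nth 0 lt) -cats1 span_cat span_seq1.
have := fe _ lt; rewrite tE => /memv_addP[u uU [_ /vlineP[a ->] ea]].
exists (a :: s) => y /memv_addP[v vU [_ /vlineP[c ->] ->]] /=; apply: hs.
rewrite shiftE linearD linearZ /= ea.
have -> : f v + c *: (u + a *: e`_i) - a *: (v + c *: e`_i) = f v - a *: v + c *: u.
  by rewrite !scalerDr !scalerA [c * a]mulrC opprD addrACA addrK.
by rewrite memvD ?memvB ?memvZ ?(st _ (ltnW lt)).
Qed.

End GenEigen.

(** * Weight spaces of a nilpotent subalgebra *)

Section LieBasics.
Variables (K : fieldType) (g : lieAlgType K).
Implicit Types (x y z : g) (U V W h : {vspace g}).

HB.instance Definition _ x :=
  GRing.isLinear.Build K g g *:%R (lie x) (@lie_linearr K g x).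

Definition ad x : 'End(g) := linfun (lie x).

Lemma adE x y : ad x y = lie x y. Proof. exact: lfunE. Qed.

Lemma lieDr x y z : lie x (y + z) = lie x y + lie x z.
Proof. exact: linearD. Qed.
Lemma lieBr x y z : lie x (y - z) = lie x y - lie x z.
Proof. exact: linearB. Qed.
Lemma lieZr x a y : lie x (a *: y) = a *: lie x y.
Proof. by rewrite linearZ. Qed.
Lemma lie0r x : lie x 0 = 0. Proof. exact: linear0. Qed.
Lemma lieDl x y z : lie (x + y) z = lie x z + lie y z.
Proof. by have := lie_linearl z 1 x y; rewrite !scale1r. Qed.
Lemma lie0l x : lie 0 x = 0.
Proof. by apply: (addrI (lie 0 x)); rewrite -lieDl !addr0. Qed.
Lemma lieZl a x y : lie (a *: x) y = a *: lie x y.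
Proof. by have := lie_linearl y a x 0; rewrite lie0l !addr0. Qed.
Lemma lieNl x y : lie (- x) y = - lie x y.
Proof. by rewrite -scaleN1r lieZl scaleN1r. Qed.
Lemma lieC x y : lie x y = - lie y x.
Proof.
have := liexx (x + y); rewrite lieDl !lieDr !liexx addr0 add0r => /eqP.
by rewrite addr_eq0 => /eqP.
Qed.
Lemma lie_leibniz x y z : lie x (lie y z) = lie (lie x y) z + lie y (lie x z).
Proof.
have := lie_jacobi x y z; rewrite (lieC z (lie x y)) (lieC z x) linearN /=.
by rewrite -addrA -opprD => /eqP; rewrite subr_eq0 => /eqP ->; rewrite addrC.
Qed.

Lemma ad_is_linear : linear ad.
Proof.
have lf (X : vectType K) a (f1 f2 : 'End(X)) (z : X) : (a *: f1 + f2) z = a *: f1 z + f2 z.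
  by rewrite add_lfunE scale_lfunE.
move=> a x y; apply/lfunP => z; apply: etrans (esym (lf _ _ _ _ _)).
by rewrite !adE lieDl lieZl.
Qed.
HB.instance Definition _ := GRing.isLinear.Build K g 'End(g) *:%R ad ad_is_linear.

Lemma ad_lie x y : ad (lie x y) = ((ad x \o ad y) - (ad y \o ad x))%VF.
Proof.
apply/lfunP => z; rewrite adE add_lfunE opp_lfunE !comp_lfunE !adE.
by rewrite (lie_leibniz x y z) addrK.
Qed.

Lemma lie_prodP U V W :
  (lie_prod U V <= W)%VS <-> (forall x y, x \in U -> y \in V -> lie x y \in W).
Proof.
split=> [/subvP sub x y xU yV|h].
  have inP i j : lie (vbasis U)`_i (vbasis V)`_j \in W.
    have [li|li] := ltnP i (size (vbasis U)); last first.
      by rewrite nth_default // lie0l mem0v.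
    have [lj|lj] := ltnP j (size (vbasis V)); last first.
      by rewrite (nth_default _ lj) lie0r mem0v.
    by apply: sub; apply: memv_span; apply: allpairs_f; exact: mem_nth.
  rewrite (coord_vbasis xU) (coord_vbasis yV) linear_sum memv_suml // => j _.
  rewrite linearZ memvZ //= lieC memvN linear_sum memv_suml // => i _.
  by rewrite linearZ memvZ //= lieC memvN.
apply/span_subvP => _ /allpairsP[[x y] /= [xU yV ->]].
by apply: h; exact: vbasis_mem.
Qed.

Lemma memv_lie_prod U V x y : x \in U -> y \in V -> lie x y \in lie_prod U V.
Proof. by move: x y; apply/lie_prodP. Qed.

(** By the Leibniz rule, ad x - (a + b) acts on a bracket through ad x - a on the first factor and
    ad x - b on the second, so the orders of nilpotency add. *)
Lemma gsp_lie x a b y z :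
  y \in gsp (ad x) a -> z \in gsp (ad x) b -> lie y z \in gsp (ad x) (a + b).
Proof.
case/gspP => k yk /gspP[l zl]; apply/gspP; exists (k + l)%N.
have step u v : (ad x - (a + b) *: \1)%VF (lie u v) =
    lie ((ad x - a *: \1)%VF u) v + lie u ((ad x - b *: \1)%VF v).
  rewrite !shiftE !adE lieBr lieDl lieNl lieZl lieZr lie_leibniz scalerDl opprD.
  by rewrite addrACA.
have iter0 i c : iter i (ad x - c *: \1)%VF 0 = 0 by exact: linear0.
(* Only k + l <= n is kept, so that the induction on n may lower either order. *)
move: {2 3}(k + l)%N (leqnn (k + l)) => n.
elim: n k l y z yk zl => [|n IH] k l y z yk zl.
  by rewrite leqn0 addn_eq0 => /andP[/eqP k0 _]; move: yk; rewrite k0 /= => ->; rewrite lie0l.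
move=> len; rewrite iterSr step linearD /=.
have -> : iter n (ad x - (a + b) *: \1)%VF (lie ((ad x - a *: \1)%VF y) z) = 0.
  case: k yk len => [/= -> _|k yk len]; first by rewrite linear0 lie0l iter0.
  by apply: (IH k l) => //; rewrite -iterSr.
case: l zl len => [/= -> _|l zl len]; first by rewrite linear0 lie0r iter0 addr0.
by rewrite add0r (IH k l) // -?iterSr // -ltnS -addnS.
Qed.

End LieBasics.

Section Weights.
Variables (K : fieldType) (charK : [pchar K] =i pred0).
Variables (g : lieAlgType K) (h : {vspace g}).
Hypothesis h_sub : lie_subalgebra h.
Hypothesis h_nil : lie_nilpotent h.
Hypothesis h_triang : forall x, x \in h -> ad_triangularizable x.
Implicit Types (x y z : g) (U V W M : {vspace g}).
Local Notation "'h^*'" := (dual K (subvs_of h)).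
Implicit Types (alpha beta gamma : h^*) (t : subvs_of h).

Lemma natr_neq0 n : n != 0%N -> n%:R != 0 :> K.
Proof. by rewrite ((pcharf0P K).1 charK). Qed.

Lemma h_lie x y : x \in h -> y \in h -> lie x y \in h.
Proof. by move: x y; apply/lie_prodP. Qed.

Lemma h_gsp0 x y : x \in h -> y \in h -> y \in gsp (ad x) 0.
Proof.
move=> xh yh; case: h_nil => n hn; apply/gspP; exists n.
rewrite scale0r subr0.
have : iter n (ad x) y \in iter n (lie_prod h) h.
  by elim: n {hn} => //= n IH; rewrite adE memv_lie_prod.
by rewrite hn memv0 => /eqP.
Qed.

Definition hstable M := forall x, x \in h -> lfstable M (ad x).
Definition primary M := forall x, x \in h -> exists a, (M <= gsp (ad x) a)%VS.

Lemma hstable_gsp x a : x \in h -> hstable (gsp (ad x) a).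
Proof.
move=> xh y yh z za; rewrite adE -[a]add0r.
by apply: gsp_lie za; exact: h_gsp0.
Qed.

Lemma hstable_cap M1 M2 : hstable M1 -> hstable M2 -> hstable (M1 :&: M2)%VS.
Proof.
by move=> s1 s2 x xh y /memv_capP[y1 y2]; rewrite memv_cap s1 ?s2.
Qed.

(** If some x in h has no single generalized eigenvalue on M, the generalized eigenspaces of x cut M
    into smaller parts, h-stable because h is nilpotent. Only the covering is recorded; independence
    comes from [isw_indep]. *)
Lemma primary_dec M : hstable M -> exists s : seq {vspace g},
  (forall V, V \in s -> hstable V /\ primary V) /\ (M <= \sum_(V <- s) V)%VS.
Proof.
move: {2}(\dim M).+1 (ltnSn (\dim M)) => n.
elim: n M => // n IH M leM sM.
have [pM|] := classic (primary M).
  exists [:: M]; rewrite big_seq1 subvv; split=> // V.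
  by rewrite inE => /eqP->.
move/not_all_ex_not => [x /(imply_to_and (x \in h))[xh nprim]].
have tx : lftriang (ad x).
  by case: (h_triang xh) => e be fe; exists e => // i li; rewrite adE; exact: fe.
have [s hs] := lftriang_shifts tx.
have sub : (M <= \sum_(b <- s) (M :&: gsp (ad x) b))%VS.
  by apply/subvP => y My; apply: gsp_split => //; exact: sM.
have [s' [s'P /(subv_trans sub) ?]] : exists s' : seq {vspace g},
    (forall V, V \in s' -> hstable V /\ primary V) /\
    (\sum_(b <- s) (M :&: gsp (ad x) b) <= \sum_(V <- s') V)%VS; last by exists s'.
elim: s {hs sub} => [|b s [s1 [s1P sub1]]].
  by exists [::]; rewrite big_nil sub0v.
have [||s2 [s2P sub2]] := IH (M :&: gsp (ad x) b)%VS.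
- rewrite -ltnS; apply: leq_trans leM; rewrite ltnS ltn_neqAle dimvS ?capvSl // andbT.
  have [_ ->] := dimv_leqif_sup (capvSl M (gsp (ad x) b)).
  rewrite subv_cap subvv /=; apply/negP => Mb; apply: nprim; by exists b.
- exact/hstable_cap/hstable_gsp.
exists (s2 ++ s1); rewrite big_cat big_cons /= addvS //; split=> // V.
by rewrite mem_cat => /orP[/s2P|/s1P].
Qed.

(** A generalized weight vector; [weight_gw] later shows that it is a true one. *)
Definition isw alpha y := forall t, y \in gsp (ad (vsval t)) (alpha t).

(** The eigenvalue of t on V is the trace of [ad t] on V divided by the dimension, an expression
    visibly linear in t. *)
Lemma primary_weight V : V != 0%VS -> hstable V -> primary V ->
  exists alpha, forall y, y \in V -> isw alpha y.
Proof.
rewrite -dimv_eq0 => /natr_neq0 dV sV pV.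
have lin : linear (fun t => trv V (ad (vsval t)) / (\dim V)%:R : K^o).
  move=> a t1 t2.
  have -> : ad (vsval (a *: t1 + t2)) = a *: ad (vsval t1) + ad (vsval t2).
    by rewrite !linearP.
  rewrite linearD /= mulrDl; congr (_ + _).
  by rewrite linearZ /= -mulrA.
pose L := GRing.isLinear.Build K (subvs_of h) K^o *:%R _ lin.
pose F : {linear subvs_of h -> K^o} := HB.pack (fun t => trv V (ad (vsval t)) / (\dim V)%:R : K^o) L.
exists (linfun F) => y Vy t; rewrite lfunE /=.
have [a sub] := pV _ (subvsP t).
rewrite (@trv_geigen _ _ _ _ a (\dim {:g})) ?mulfK //.
- exact: (subvP sub).
- exact/sV/subvsP.
- by move=> z /(subvP sub); rewrite memv_ker lfunE => /eqP.
Qed.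

Lemma isw_lin alpha c y z : isw alpha y -> isw alpha z -> isw alpha (c *: y + z).
Proof. by move=> ya za t; rewrite memvD ?memvZ. Qed.

Lemma isw0 alpha : isw alpha 0. Proof. by move=> t; rewrite mem0v. Qed.

Lemma isw_lie alpha beta y z : isw alpha y -> isw beta z -> isw (alpha + beta) (lie y z).
Proof. by move=> ya zb t; rewrite add_lfunE; apply: gsp_lie. Qed.

Lemma isw_h y : y \in h -> isw 0 y.
Proof. by move=> yh t; rewrite zero_lfunE; apply: h_gsp0 => //; exact: subvsP. Qed.

Lemma isw_shift alpha t a k y :
  isw alpha y -> isw alpha (iter k (ad (vsval t) - a *: \1)%VF y).
Proof.
move=> yw; elim: k => // k; rewrite iterS; move: (iter k _ y) => z ya.
rewrite shiftE adE -scaleNr addrC; apply: isw_lin => //.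
have := isw_lie (isw_h (subvsP t)) ya; by rewrite add0r.
Qed.

Lemma isw_indep (r : seq h^*) (u : h^* -> g) : uniq r ->
  (forall alpha, alpha \in r -> isw alpha (u alpha)) ->
  \sum_(alpha <- r) u alpha = 0 -> forall alpha, alpha \in r -> u alpha = 0.
Proof.
elim: r u => // alpha r IH u /= /andP[ar ur] uw; rewrite big_cons => u0.
have z0 gamma : gamma \in r -> u gamma = 0.
  move=> gr; have : gamma != alpha by apply: contraNneq ar => <-.
  (* Some t separates gamma from alpha. A power of ad t - alpha(t) kills the alpha term, and by
     induction also the gamma term, which then lies in two generalized eigenspaces of [ad t]. *)
  case/lfunPn => t ne.
  have /gspP[k uk] : u alpha \in gsp (ad (vsval t)) (alpha t) by apply: uw; rewrite mem_head.
  pose v beta := iter k (ad (vsval t) - (alpha t : K) *: \1)%VF (u beta).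
  have vg : v gamma = 0.
    apply: IH gr => //.
    - by move=> beta br; apply: isw_shift; apply: uw; rewrite inE br orbT.
    - rewrite -linear_sum; have -> : \sum_(j <- r) u j = - u alpha.
        by apply/eqP; rewrite -addr_eq0 addrC u0.
      by rewrite linearN /= uk oppr0.
  apply: (@gsp_neq _ _ (ad (vsval t)) (gamma t) (alpha t) _ ne); first by apply: uw; rewrite inE gr orbT.
  by apply/gspP; exists k.
move=> beta; rewrite inE => /orP[/eqP->|/z0 //].
by move: u0; rewrite big_seq big1 ?addr0.
Qed.

End Weights.

(** * Engel's theorem for a nilpotent subalgebra *)

Section Engel.
Variables (K : fieldType) (g : lieAlgType K) (h : {vspace g}).
Hypothesis h_sub : lie_subalgebra h.
Hypothesis h_nil : lie_nilpotent h.
Implicit Types (x y z : g) (U V W M : {vspace g}).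

(** x is taken in the last term of the lower central series of h that is not contained in I. *)
Lemma nilpotent_ideal_step I : (I <= h)%VS -> I != h ->
  exists2 x, x \in h /\ x \notin I & forall t, t \in h -> lie t x \in I.
Proof.
move=> Ih nIh.
have ex : exists n, (iter n (lie_prod h) h <= I)%VS.
  by case: h_nil => n e; exists n; rewrite e sub0v.
case: (ex_minnP ex) => [[|n]] sub min.
  by case/eqP: nIh; apply/eqP; rewrite eqEsubv Ih.
have /subvPn[x xn xI] : ~~ (iter n (lie_prod h) h <= I)%VS.
  by apply/negP => /min; rewrite ltnn.
have nh : (iter n (lie_prod h) h <= h)%VS.
  elim: n {sub min xn} => [|n IH] /=; first exact: subvv.
  by apply/lie_prodP => t y th /(subvP IH) yh; apply: (lie_prodP _ _ _).1 h_sub _ _ th yh.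
exists x => [|t th]; first by split=> //; exact: (subvP nh).
by apply: (subvP sub); exact: memv_lie_prod.
Qed.

(* Engel's theorem for the action of h on M / W, twisted by the character a. *)
Lemma nilpotent_common_eigenvector M W (a : 'Hom(g, K^o)) :
  (forall t, t \in h -> lfstable M (ad t)) -> (forall t, t \in h -> lfstable W (ad t)) ->
  (forall s t, s \in h -> t \in h -> a (lie s t) = 0) ->
  (forall t y, t \in h -> y \in M ->
     exists k, iter k (ad t - (a t : K) *: \1)%VF y \in W) ->
  ~~ (M <= W)%VS ->
  exists2 y, y \in M /\ y \notin W &
    forall t, t \in h -> lie t y - (a t : K) *: y \in W.
Proof.
move=> sM sW a0 nilp /subvPn[y0 y0M y0W].
(* Induction on the codimension in h of an ideal I that already acts on some y through a modulo
   W. *)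
suff H n I : (\dim h - \dim I < n)%N -> (I <= h)%VS ->
    (forall t x, t \in h -> x \in I -> lie t x \in I) ->
    (exists2 y, y \in M /\ y \notin W & forall t, t \in I -> lie t y - (a t : K) *: y \in W) ->
    exists2 y, y \in M /\ y \notin W & forall t, t \in h -> lie t y - (a t : K) *: y \in W.
  apply: (H _ 0%VS (ltnSn _)); first exact: sub0v.
  - by move=> t x _; rewrite memv0 => /eqP->; rewrite lie0r mem0v.
  - exists y0 => // t; rewrite memv0 => /eqP->.
    by rewrite lie0l linear0 scale0r subr0 mem0v.
elim: n I => // n IH I ltn Ih idI [y [yM yW] yI].
have [<-|nIh] := eqVneq I h; first by exists y.
have [x [xh xI] xid] := nilpotent_ideal_step Ih nIh.
pose D := (ad x - (a x : K) *: \1)%VF.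
(* D preserves the vectors on which I acts through a modulo W: the commutator term comes from a
   bracket in I, where a vanishes. *)
have stD z : z \in M -> (forall t, t \in I -> lie t z - (a t : K) *: z \in W) ->
    forall t, t \in I -> lie t (D z) - (a t : K) *: D z \in W.
  move=> zM zI t tI; rewrite shiftE adE lieBr lieZr lie_leibniz scalerBr.
  have th := subvP Ih t tI.
  have -> : lie (lie t x) z + lie x (lie t z) - (a x : K) *: lie t z
      - ((a t : K) *: lie x z - (a t : K) *: ((a x : K) *: z)) =
      lie (lie t x) z + (lie x (lie t z - (a t : K) *: z) - (a x : K) *: (lie t z - (a t : K) *: z)).
    have perm (p q r s v : g) : p + q - r - (s - v) = p + (q - s - (r - v)).
      rewrite -!addrA; congr (_ + (_ + _)).
      by rewrite !opprB addrCA [RHS]addrCA [- r - s]addrC.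
    by rewrite lieBr lieZr scalerBr !scalerA [(a t : K) * _]mulrC perm.
  have xt : lie t x \in I by exact: xid.
  have := zI _ xt; rewrite a0 // scale0r subr0 => w1.
  by rewrite memvD // memvB ?memvZ ?zI // -adE sW // zI.
have [k kW] := nilp x y xh yM.
(* The last iterate of D on y outside W is an eigenvector modulo W for x as well, so the line of x
   can be added to I. *)
case: (ex_minnP (ex_intro (fun k => iter k D y \in W) k kW)) => [[|m]] mW min.
  by rewrite mW in yW.
have zW : iter m D y \notin W by apply/negP => /min; rewrite ltnn.
have [zM zI] : iter m D y \in M /\
    forall t, t \in I -> lie t (iter m D y) - (a t : K) *: iter m D y \in W.
  elim: m {mW min zW} => [|m [zM zI]] //; rewrite iterS; split; last exact: stD.
  by rewrite /D shiftE memvB ?memvZ ?sM.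
apply: (IH (I + <[x]>)%VS).
- rewrite -ltnS; apply: leq_trans ltn; rewrite ltnS.
  have lt : (\dim I < \dim (I + <[x]>))%N.
    rewrite ltn_neqAle dimvS ?addvSl // andbT; apply: contra xI => /eqP e.
    have [_] := dimv_leqif_sup (addvSl I <[x]>); rewrite e eqxx => /esym.
    by rewrite subv_add => /andP[_].
  have le : (\dim (I + <[x]>) <= \dim h)%N by rewrite dimvS // subv_add Ih.
  by apply: ltn_sub2l => //; exact: leq_trans le.
- by rewrite subv_add Ih.
- move=> t _ th /memv_addP[i iI [_ /vlineP[c ->] ->]].
  rewrite lieDr lieZr; apply: (subvP (addvSl _ _)).
  by apply: memvD; [exact: idI | exact/memvZ/xid].
- exists (iter m D y) => // _ /memv_addP[i iI [_ /vlineP[c ->] ->]].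
  have -> : a (i + c *: x) = (a i : K) + c * (a x : K) by rewrite linearD linearZ.
  rewrite lieDl lieZl scalerDl opprD addrACA.
  rewrite memvD ?zI //.
  by move: mW; rewrite iterS shiftE adE => /(memvZ c); rewrite scalerBr scalerA.
Qed.
End Engel.

Definition asb (P : Prop) : bool := if excluded_middle_informative P then true else false.
Lemma asbP P : reflect P (asb P).
Proof. by rewrite /asb; case: excluded_middle_informative => p; constructor. Qed.

(** * The weight space decomposition *)

Section WeightSystem.
Variables (K : fieldType) (charK : [pchar K] =i pred0).
Variables (g : lieAlgType K) (h : {vspace g}).
Local Notation "'h^*'" := (dual K (subvs_of h)).

(** [R0] lists the weights that occur, possibly 0 among them; [gw] is total, so that sums of weights
    can be formed freely, and it is the zero space off [R0]. *)
Record weight_system (R0 : seq h^*) (gw : h^* -> {vspace g}) : Prop := WeightSystem {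
  wts_uniq : uniq R0;
  gwP : forall alpha y, y \in gw alpha <-> isw alpha y;
  wtsP : forall alpha, (alpha \in R0) = (gw alpha != 0%VS);
  gw_full : (\sum_(alpha <- R0) gw alpha)%VS = fullv }.

Lemma weight_system_exists : splitting_cartan h -> exists R0 gw, weight_system R0 gw.
Proof.
case=> [[h_sub h_nil _] h_tri].
have [|s [sP sub]] := @primary_dec K g h h_nil h_tri fullv.
  by move=> x _ y _; rewrite memvf.
(* Each primary part is tagged with a weight; different parts may carry the same weight, and [gw]
   merges them. *)
have [L [LP subL]] : exists L : seq (h^* * {vspace g}),
    (forall p, p \in L -> forall y, y \in p.2 -> isw p.1 y) /\
    (fullv <= \sum_(p <- L) p.2)%VS.
  suff [L [LP subL]] : exists L : seq (h^* * {vspace g}),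
      (forall p, p \in L -> forall y, y \in p.2 -> isw p.1 y) /\
      (\sum_(V <- s) V <= \sum_(p <- L) p.2)%VS.
    by exists L; split=> //; exact: subv_trans subL.
  elim: s sP {sub} => [|V s IH] sP; first by exists [::]; rewrite !big_nil.
  have [V' V's|L [LP subL]] := IH; first by apply: sP; rewrite inE V's orbT.
  have [sV pV] := sP V (mem_head _ _).
  have [alpha aV] : exists alpha : h^*, forall y, y \in V -> isw alpha y.
    have [->|nV] := eqVneq V 0%VS; last exact: primary_weight.
    by exists 0 => y; rewrite memv0 => /eqP->; exact: isw0.
  exists ((alpha, V) :: L); rewrite !big_cons addvS //; split=> // p.
  by rewrite inE => /orP[/eqP->|/LP].
pose gw alpha := (\sum_(p <- L | p.1 == alpha) p.2)%VS.
pose R0 := [seq alpha <- undup [seq p.1 | p <- L] | gw alpha != 0%VS].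
have uR : uniq R0 by rewrite filter_uniq ?undup_uniq.
have gw_isw alpha y : y \in gw alpha -> isw alpha y.
  rewrite /gw => yg t; move: yg; apply/subvP.
  rewrite big_seq_cond; apply: (big_ind (fun A => (A <= _)%VS)).
  - exact: sub0v.
  - by move=> A B A1 B1; rewrite subv_add A1.
  - by move=> p /andP[pL /eqP <-]; apply/subvP => z /(LP _ pL).
have R0P alpha : (alpha \in R0) = (gw alpha != 0%VS).
  rewrite mem_filter mem_undup; apply/andP/idP => [[]//|n0]; split=> //.
  apply: contraR n0 => aL; apply/eqP; rewrite /gw big_seq_cond big1 // => p /andP[pL /eqP e].
  by case/mapP: aL; exists p.
have full : (\sum_(alpha <- R0) gw alpha)%VS = fullv.
  apply/eqP; rewrite eqEsubv subvf; apply: subv_trans subL _.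
  rewrite [X in (X <= _)%VS]big_seq; apply: (big_ind (fun A => (A <= _)%VS)).
  - exact: sub0v.
  - by move=> A B A1 B1; rewrite subv_add A1.
  move=> p pL; apply: (@subv_trans _ _ (gw p.1)).
    by rewrite /gw (big_rem p pL) /=; case: eqP => // _; exact: addvSl.
  have [->|n0] := eqVneq (gw p.1) 0%VS; first exact: sub0v.
  apply/subvP => y; apply: memv_sum_seqI; by rewrite R0P.
clearbody R0 gw; exists R0, gw; split=> // alpha y; split; first exact: gw_isw.
move=> ya.
have : y \in (\sum_(alpha <- R0) gw alpha)%VS by rewrite full memvf.
case/(memv_sum_seq uR) => u [uP ey].
(* The components of y, minus y itself placed at alpha, are weight vectors of sum 0. By independence
   they all vanish, so y is its own component at alpha. *)
pose u' beta := (if beta \in R0 then u beta else 0) - (if beta == alpha then y else 0).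
have u'w beta : isw beta (u' beta).
  rewrite /u' addrC; case: eqP => [->|_]; rewrite -?scaleN1r.
    apply: isw_lin => //; case: ifP => aR; [exact/gw_isw/uP | exact: isw0].
  rewrite scaler0 add0r; case: ifP => aR; [exact/gw_isw/uP | exact: isw0].
have [r ur rP] : exists2 r : seq h^*, uniq r & r =i alpha :: R0.
  by exists (undup (alpha :: R0)); [exact: undup_uniq | exact: mem_undup].
have H := isw_indep h_nil ur (fun b _ => u'w b).
have mem_r : alpha \in r by rewrite rP mem_head.
have sz : \sum_(beta <- r) u' beta = 0.
  rewrite big_split /= sumrN; apply/eqP; rewrite subr_eq0; apply/eqP.
  rewrite [RHS](bigD1_seq alpha) //=.
  case: (@eqP _ alpha alpha) => // _.
  rewrite [X in _ = _ + X]big1 => [|b ne]; last by rewrite (negbTE ne).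
  rewrite addr0 ey -big_mkcond /= -[LHS]big_filter.
  apply: perm_big; apply: uniq_perm; rewrite ?filter_uniq //.
  by move=> b; rewrite mem_filter rP inE; case: (b \in R0); rewrite ?orbT.
have := H sz alpha mem_r; rewrite /u'; case: (@eqP _ alpha alpha) => // _.
move/eqP; rewrite subr_eq0 => /eqP <-; case: ifP => [/uP //|_]; exact: mem0v.
Qed.

End WeightSystem.

(** * Root strings and the Killing form *)

Section SplitSimple.
Variables (K : fieldType) (charK : [pchar K] =i pred0).
Variables (g : lieAlgType K) (h : {vspace g}).
Local Notation "'h^*'" := (dual K (subvs_of h)).
Variables (R0 : seq h^*) (gw : h^* -> {vspace g}).
Hypothesis ws : weight_system R0 gw.
Hypothesis h_cartan : cartan_subalgebra h.
Implicit Types (x y z : g) (t : subvs_of h) (alpha beta gamma : h^*).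

Let h_sub : lie_subalgebra h. Proof. by case: h_cartan. Qed.
Let h_nil : lie_nilpotent h. Proof. by case: h_cartan. Qed.
Let R0_uniq := wts_uniq ws.

Lemma gw_lie alpha beta y z : y \in gw alpha -> z \in gw beta -> lie y z \in gw (alpha + beta).
Proof. by move=> /(gwP ws) ya /(gwP ws) zb; apply/(gwP ws)/isw_lie. Qed.

Lemma h_sub_gw0 x : x \in h -> x \in gw 0.
Proof. by move=> xh; apply/(gwP ws)/isw_h. Qed.

Lemma gw_indep : indep R0 gw.
Proof.
move=> u uP u0 alpha aR; apply: (isw_indep h_nil R0_uniq _ u0 aR) => beta bR.
exact/(gwP ws)/uP.
Qed.

(** If the zero weight space were larger than h, Engel's theorem modulo h would give y outside h
    with [h, y] inside h, against self-normalization. *)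
Lemma gw0E : gw 0 = h.
Proof.
apply/eqP; rewrite eqEsubv andbC; apply/andP; split.
  by apply/subvP => x; exact: h_sub_gw0.
apply/negPn/negP => nsub.
have z (x : g) : (0 : 'Hom(g, K^o)) x = 0 by rewrite lfunE.
have [||||y [y0 yh] yn] := nilpotent_common_eigenvector h_sub h_nil (a := 0) _ _ _ _ nsub.
- by move=> t th y y0; rewrite adE -[0]addr0; apply: gw_lie => //; exact: h_sub_gw0.
- by move=> t th y yh; rewrite adE h_lie.
- by move=> s t _ _; rewrite z.
- move=> t y th /(gwP ws)/(_ (Subvs th)); rewrite /= !zero_lfunE => /gspP[k e].
  by exists k; rewrite e mem0v.
case/negP: yh; case: h_cartan => _ _; apply => t th.
by have := yn t th; rewrite z scale0r subr0 lieC memvN.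
Qed.

Lemma gw_stable t alpha : lfstable (gw alpha) (ad (vsval t)).
Proof.
move=> y ya; rewrite adE -[alpha]add0r; apply: gw_lie => //.
by rewrite gw0E subvsP.
Qed.

Lemma gw_gsp t alpha y : y \in gw alpha -> y \in gsp (ad (vsval t)) (alpha t).
Proof. by move/(gwP ws). Qed.

Lemma trv_gw t alpha : trv (gw alpha) (ad (vsval t)) = (alpha t : K) * (\dim (gw alpha))%:R.
Proof.
apply: (@trv_geigen _ _ _ _ _ (\dim {:g})) => [|y /(gw_gsp t)]; first exact: gw_stable.
by rewrite memv_ker lfunE => /eqP.
Qed.

Lemma trv_string t (P : pred h^*) :
  trv (\sum_(gamma <- R0 | P gamma) gw gamma)%VS (ad (vsval t)) =
  \sum_(gamma <- R0 | P gamma) (gamma t : K) * (\dim (gw gamma))%:R.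
Proof.
pose gw' i := if P i then gw i else 0%VS.
have -> : (\sum_(gamma <- R0 | P gamma) gw gamma = \sum_(gamma <- R0) gw' gamma)%VS.
  by rewrite big_mkcond.
have ind : indep R0 gw'.
  move=> u uP; apply: gw_indep => i /uP; rewrite /gw'; case: ifP => // _.
  by rewrite memv0 => /eqP->; rewrite mem0v.
rewrite trv_sum // => [|i _]; rewrite /gw'; last first.
  case: ifP => _; first exact: gw_stable.
  by move=> y; rewrite memv0 => /eqP->; rewrite linear0 mem0v.
rewrite [RHS]big_mkcond; apply: eq_bigr => i _; case: ifP => _; last exact: trv0.
exact: trv_gw.
Qed.

Lemma gw_notin alpha y : alpha \notin R0 -> y \in gw alpha -> y = 0.
Proof.
by rewrite (wtsP ws) negbK => /eqP->; rewrite memv0 => /eqP.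
Qed.

Lemma mem_gw_sum (P : pred h^*) alpha y : y \in gw alpha -> (alpha \in R0 -> P alpha) ->
  y \in (\sum_(gamma <- R0 | P gamma) gw gamma)%VS.
Proof.
move=> ya Pa; have [aR|/gw_notin/(_ ya)->] := boolP (alpha \in R0); last exact: mem0v.
rewrite -big_filter; apply: memv_sum_seqI ya; by rewrite mem_filter Pa.
Qed.

Lemma lfstable_string (P : pred h^*) x alpha : x \in gw alpha ->
  (forall gamma, gamma \in R0 -> P gamma -> gamma + alpha \in R0 -> P (gamma + alpha)) ->
  lfstable (\sum_(gamma <- R0 | P gamma) gw gamma)%VS (ad x).
Proof.
move=> xa Pa; rewrite -big_filter; apply: lfstable_sum => gamma y.
rewrite mem_filter => /andP[Pg gR] yg; rewrite big_filter adE.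
apply: (@mem_gw_sum P (gamma + alpha)); last exact: Pa.
by rewrite addrC; exact: gw_lie.
Qed.

(* The trace of ad [x, y] vanishes on every subspace stable under x and y. *)
Lemma string_trace (P : pred h^*) alpha x y t :
  x \in gw alpha -> y \in gw (- alpha) -> vsval t = lie x y ->
  (forall gamma, gamma \in R0 -> P gamma ->
     (gamma + alpha \in R0 -> P (gamma + alpha)) /\ (gamma - alpha \in R0 -> P (gamma - alpha))) ->
  \sum_(gamma <- R0 | P gamma) (gamma t : K) * (\dim (gw gamma))%:R = 0.
Proof.
move=> xa ya e Ps; rewrite -trv_string e ad_lie linearB /=.
rewrite (@trv_comm _ _ _ (ad x)) ?subrr //; [apply: (lfstable_string xa)|apply: (lfstable_string ya)];
  by move=> gamma gR Pg; case: (Ps gamma gR Pg).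
Qed.

Definition gpi gamma : 'End(g) := sumv_pi_for (esym (gw_full ws)) gamma.

Lemma gpi_mem gamma y : gpi gamma y \in gw gamma.
Proof. exact: memv_sum_pi. Qed.

Lemma gpi_sum y : \sum_(gamma <- R0) gpi gamma y = y.
Proof. by apply: sumv_pi_uniq_sum; rewrite ?filter_predT ?memvf. Qed.

Lemma gpiE gamma beta y : gamma \in R0 -> y \in gw beta ->
  gpi gamma y = if gamma == beta then y else 0.
Proof.
move=> gR yb; apply/eqP; rewrite -subr_eq0; apply/eqP.
pose u i := gpi i y - if i == beta then y else 0.
apply: (@gw_indep u _ _ gamma gR).
  move=> i iR; rewrite memvB ?gpi_mem //; case: eqP => [->//|_]; exact: mem0v.
rewrite big_split /= gpi_sum sumrN; apply/eqP; rewrite subr_eq0; apply/eqP.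
have [bR|bR] := boolP (beta \in R0); last first.
  rewrite (gw_notin bR yb) big1 // => i _; by case: ifP.
rewrite (bigD1_seq beta) //=; case: (@eqP _ beta beta) => // _.
by rewrite big1 ?addr0 // => i /negbTE ->.
Qed.

Lemma lftr_gpi (f : 'End(g)) : lftr f = \sum_(gamma <- R0) lftr (f \o gpi gamma)%VF.
Proof.
rewrite -linear_sum /=; congr lftr; apply/lfunP => y.
rewrite sum_lfunE -[in LHS](gpi_sum y) linear_sum; apply: eq_bigr => i _.
by rewrite comp_lfunE.
Qed.

(** Such an f has no diagonal block in the weight decomposition. This makes weight spaces
    Killing-orthogonal unless their weights are opposite. *)
Lemma lftr_shift (f : 'End(g)) delta : delta != 0 ->
  (forall gamma y, y \in gw gamma -> f y \in gw (gamma + delta)) -> lftr f = 0.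
Proof.
move=> d0 fs; rewrite lftr_gpi big_seq big1 // => gamma gR.
have -> : (f \o gpi gamma = (f \o gpi gamma) \o gpi gamma)%VF.
  apply/lfunP => y; rewrite !comp_lfunE; congr (f _).
  by rewrite (gpiE gR (gpi_mem _ _)); case: eqP.
rewrite lftrC (_ : (_ \o _)%VF = 0) ?linear0 //; apply/lfunP => y.
rewrite !comp_lfunE zero_lfunE (gpiE gR (fs _ _ (gpi_mem _ _))).
rewrite -subr_eq0 opprD addrA subrr sub0r oppr_eq0 (negbTE d0) //.
Qed.

Lemma lftr_gpi_trv (f : 'End(g)) gamma : gamma \in R0 -> lfstable (gw gamma) f ->
  lftr (f \o gpi gamma)%VF = trv (gw gamma) f.
Proof.
move=> gR sf; apply: trv_proj => // y; first exact: gpi_mem.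
by move=> yg; rewrite (gpiE gR yg); case: eqP.
Qed.

Definition kil x y : K := lftr (ad x \o ad y)%VF.

Lemma kilC x y : kil x y = kil y x. Proof. exact: lftrC. Qed.

Lemma kil_linearr x : linear_for *%R (kil x).
Proof.
move=> a y z; rewrite /kil linearP /=.
by rewrite comp_lfunDr -comp_lfunZr linearP.
Qed.
HB.instance Definition _ x := GRing.isLinear.Build K g K *%R (kil x) (@kil_linearr x).

Lemma kil_inv x y z : kil (lie x y) z = kil x (lie y z).
Proof.
have lB (f1 f2 : 'End(g)) : lftr (f1 - f2) = lftr f1 - lftr f2 by exact: linearB.
rewrite /kil !ad_lie comp_lfunDl comp_lfunNl comp_lfunDr comp_lfunNr !lB.
by rewrite -(comp_lfunA (ad x)) -(comp_lfunA (ad y)) (lftrC (ad y)) -(comp_lfunA (ad x)).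
Qed.

Lemma kil_tt t : kil (vsval t) (vsval t) =
  \sum_(gamma <- R0) (gamma t : K) ^+ 2 * (\dim (gw gamma))%:R.
Proof.
rewrite /kil lftr_gpi [LHS]big_seq [RHS]big_seq; apply: eq_bigr => gamma gR.
have st := @gw_stable t gamma.
rewrite lftr_gpi_trv //; last exact: lfstable_comp.
apply: (@trv_geigen _ _ _ _ _ (\dim {:g})); first exact: lfstable_comp.
move=> y /(gw_gsp t); rewrite memv_ker lfunE => /eqP yk; rewrite shift_sqr.
have -> k : iter k ((ad (vsval t) - (gamma t : K) *: \1) \o (ad (vsval t) - (- gamma t : K) *: \1))%VF y
   = iter k (ad (vsval t) - (- gamma t : K) *: \1)%VF (iter k (ad (vsval t) - (gamma t : K) *: \1)%VF y).
  elim: k => // k IH; rewrite iterS IH comp_lfunE.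
  by rewrite -[in LHS](iterS k (ad (vsval t) - (- gamma t : K) *: \1)%VF) -shift_comm.
by rewrite yk linear0.
Qed.

End SplitSimple.

(** After clearing denominators the sum is the image of a natural number S, which is 0 only if every
    square is; this replaces an order on K. *)
Lemma rational_sumsq (K : fieldType) (charK : [pchar K] =i pred0)
    (I : eqType) (L : seq I) (d : I -> nat) (q : I -> K) :
  (forall i, i \in L -> exists N : nat, exists s : int, N != 0%N /\ N%:R * q i = s%:~R) ->
  \sum_(i <- L) (q i) ^+ 2 * (d i)%:R = 0 ->
  forall i, i \in L -> d i != 0%N -> q i = 0.
Proof.
move=> rat sum0 i iL di.
have n0 := (pcharf0P K).1 charK.
suff [D [S [D0 e pos]]] : exists D S : nat, [/\ D != 0%N,
    D%:R * \sum_(i <- L) (q i) ^+ 2 * (d i)%:R = S%:R &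
    S = 0%N -> forall i, i \in L -> d i != 0%N -> q i = 0].
  apply: (pos _ i iL di); apply/eqP; by rewrite -n0 -e sum0 mulr0.
elim: L rat {sum0 i iL di} => [|j L IH] rat.
  by exists 1%N, 0%N; rewrite big_nil mulr0.
have [i iL|D [S [D0 e pos]]] := IH; first by apply: rat; rewrite inE iL orbT.
have [N [s [N0 es]]] := rat j (mem_head _ _).
exists (N ^ 2 * D)%N, (N ^ 2 * S + D * d j * `|s| ^ 2)%N; split.
- by rewrite muln_eq0 expn_eq0 negb_or D0 andbT; case: (N) N0.
- have s2 : ((`|s| ^ 2)%N)%:R = (N%:R * q j) ^+ 2 :> K.
    rewrite es -rmorphXn /= (_ : s ^+ 2 = (`|s| ^ 2)%N) //.
    by case: (s) => n //; rewrite NegzE sqrrN PoszX.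
  rewrite big_cons !(natrD, natrM, s2, natrX) -e; ring.
- move=> /eqP; rewrite addn_eq0 !muln_eq0 (negbTE D0) (negbTE N0) /= orbb.
  case/andP=> /eqP S0 s0 i; rewrite inE => /orP[/eqP-> dj|]; last exact: pos.
  move: s0; rewrite (negbTE dj) /= absz_eq0 => /eqP s0.
  by move/eqP: es; rewrite s0 mulf_eq0 n0 (negbTE N0) => /eqP.
Qed.

(** * Nondegeneracy of the Killing form *)

Section KillingNondegenerate.
Variables (K : fieldType) (charK : [pchar K] =i pred0).
Variables (g : lieAlgType K) (h : {vspace g}).
Local Notation "'h^*'" := (dual K (subvs_of h)).
Variables (R0 : seq h^*) (gw : h^* -> {vspace g}).
Hypothesis ws : weight_system R0 gw.
Hypothesis h_cartan : cartan_subalgebra h.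
Hypothesis g_simple : lie_simple g.
Implicit Types (x y z : g) (t : subvs_of h) (alpha beta gamma : h^*).

Let h_nil : lie_nilpotent h. Proof. by case: h_cartan. Qed.

Lemma dim_gw_neq0 gamma : gamma \in R0 -> \dim (gw gamma) != 0%N.
Proof. by rewrite (wtsP ws) dimv_eq0. Qed.

(* The trace of ad [x, y] on the alpha-string through gamma vanishes. *)
Lemma string_ratio alpha x y t gamma :
  x \in gw alpha -> y \in gw (- alpha) -> vsval t = lie x y -> gamma \in R0 ->
  exists N : nat, exists s : int, N != 0%N /\ N%:R * (gamma t : K) = s%:~R * (alpha t : K).
Proof.
move=> xa ya e gR.
(* P cuts out the string and [kk] picks an index along it. For alpha = 0 the index is arbitrary, but
   [kkP] still holds. *)
pose P beta := asb (exists k : int, beta = gamma + alpha *~ k).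
pose kk beta := if excluded_middle_informative (exists k : int, beta = gamma + alpha *~ k) is left p
   then proj1_sig (constructive_indefinite_description _ p) else 0.
have kkP beta : P beta -> beta = gamma + alpha *~ kk beta.
  rewrite /kk => /asbP p; case: excluded_middle_informative => // q.
  by case: constructive_indefinite_description.
exists (\sum_(beta <- R0 | P beta) \dim (gw beta))%N.
exists (- \sum_(beta <- R0 | P beta) kk beta * (\dim (gw beta))%:Z).
split.
  rewrite sum_nat_seq_neq0; apply/hasP; exists gamma; rewrite //= dim_gw_neq0 // andbT.
  by apply/asbP; exists 0; rewrite mulr0z addr0.
have /(string_trace ws h_cartan xa ya e) : forall beta, beta \in R0 -> P beta ->
    (beta + alpha \in R0 -> P (beta + alpha)) /\ (beta - alpha \in R0 -> P (beta - alpha)).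
  move=> beta _ /asbP[k ->]; split=> _; apply/asbP.
    by exists (k + 1); rewrite mulrzDr mulr1z addrA.
  by exists (k - 1); rewrite mulrzBr mulr1z addrA.
move=> sum0; rewrite natr_sum mulr_suml rmorphN rmorph_sum mulNr mulr_suml.
apply/eqP; rewrite -addr_eq0 -big_split /= -[X in _ == X]sum0.
apply/eqP; apply: eq_bigr => beta /kkP eb.
rewrite {4}eb add_lfunE; have -> : (alpha *~ kk beta) t = (kk beta)%:~R * (alpha t : K).
  by rewrite -scaler_int scale_lfunE.
rewrite rmorphM /=; ring.
Qed.

Lemma gw_sum y : exists u, (forall alpha, u alpha \in gw alpha) /\ y = \sum_(alpha <- R0) u alpha.
Proof.
exists (fun alpha => gpi ws alpha y); split=> [alpha|]; first exact: gpi_mem.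
by rewrite gpi_sum.
Qed.

Definition wt gamma : 'Hom(g, K^o) := (gamma \o linfun (vsproj h))%VF.

Lemma wtE gamma y : wt gamma y = gamma (vsproj h y).
Proof. by rewrite comp_lfunE lfunE. Qed.

Lemma lie_perfect x : x \in lie_prod {:g} {:g}.
Proof.
have [n0 /(_ (lie_prod {:g} {:g}))[|/n0|->] //] := g_simple; last exact: memvf.
by apply/lie_prodP => y z _ _; apply: memv_lie_prod; exact: memvf.
Qed.

(** Suppose the form vanishes. For t = [x, y] with opposite weights alpha and - alpha, all weights
    at t are rational multiples of alpha(t), and the sum of their squares with multiplicities is
    [kil t t] = 0, so they vanish at t. As g is perfect, every zero-weight component is a sum of
    such t, so all weights are 0 and g = h is nilpotent, which a nonzero perfect algebra is not. *)
Lemma killing_nonzero : ~ (forall x y, kil x y = 0).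
Proof.
move=> kil0; have h0 := gw0E ws h_cartan.
have step_a alpha x y gamma : x \in gw alpha -> y \in gw (- alpha) -> gamma \in R0 ->
    wt gamma (lie x y) = 0.
  move=> xa ya gR.
  have uh : lie x y \in h by rewrite -h0 -(subrr alpha); exact: (gw_lie ws).
  rewrite wtE; set t := vsproj h _; have et : vsval t = lie x y by exact: vsprojK.
  have [x0|x0] := eqVneq x 0.
    by rewrite /t x0 lie0l !linear0.
  have aR : alpha \in R0.
    by apply/negPn/negP => aR; case/eqP: x0; exact: (gw_notin ws aR xa).
  have kt := kil_tt ws h_cartan t; rewrite kil0 in kt.
  have rat beta : beta \in R0 -> exists N : nat, exists s : int, N != 0%N /\
       N%:R * (beta t : K) = s%:~R * (alpha t : K) by exact: (string_ratio xa ya et).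
  have [at0|at0] := eqVneq (alpha t : K) 0.
    have [N [s [N0]]] := rat _ gR; rewrite at0 mulr0 => /eqP.
    by rewrite mulf_eq0 (negbTE (natr_neq0 charK N0)) => /eqP.
  have /eqP : (alpha t : K) / (alpha t : K) = 0.
    apply: (@rational_sumsq K charK _ R0 (fun beta => \dim (gw beta))
      (fun beta => (beta t : K) / (alpha t : K)) _ _ alpha aR (dim_gw_neq0 aR)).
    - move=> beta /rat[N [s [N0 e]]]; exists N, s; split=> //.
      by rewrite mulrA e -mulrA divff ?mulr1.
    - rewrite (eq_bigr (fun beta => (alpha t : K) ^- 2 * ((beta t : K) ^+ 2 * (\dim (gw beta))%:R))).
        by rewrite -mulr_sumr -kt mulr0.
      by move=> beta _; rewrite expr_div_n; ring.
  by rewrite divff // oner_eq0.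
have step_b gamma z : gamma \in R0 -> wt gamma (gpi ws 0 z) = 0.
  move=> gR; pose W := lker (wt gamma \o gpi ws 0)%VF.
  suff : z \in W by rewrite memv_ker comp_lfunE => /eqP.
  have := lie_perfect z; apply/subvP/lie_prodP => x y _ _.
  rewrite memv_ker comp_lfunE.
  have [u [uP ->]] := gw_sum x; have [v [vP ->]] := gw_sum y.
  rewrite linear_sum; have -> : \sum_(i <- R0) lie (\sum_(alpha <- R0) u alpha) (v i) =
     \sum_(i <- R0) \sum_(j <- R0) lie (u j) (v i).
    apply: eq_bigr => i _; rewrite lieC linear_sum /= -sumrN.
    by apply: eq_bigr => j _; rewrite -lieC.
  rewrite !linear_sum big1 // => i _; rewrite !linear_sum big1 // => j _ /=.
  have uv := gw_lie ws (uP j) (vP i).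
  have [R00|R00] := boolP (0 \in R0); last first.
    have -> : gpi ws 0 (lie (u j) (v i)) = 0 by apply: (gw_notin ws R00); exact: gpi_mem.
    by rewrite linear0.
  rewrite (gpiE ws h_cartan R00 uv); case: eqP => [e|_]; last by rewrite linear0.
  apply: (step_a j) => //.
  have -> : - j = i by apply/eqP; rewrite eq_sym -addr_eq0 addrC -e.
  exact: vP.
have R0_0 gamma : gamma \in R0 -> gamma = 0.
  move=> gR; apply/lfunP => t; rewrite zero_lfunE.
  have := step_b gamma (vsval t) gR.
  have [R00|R00] := boolP (0 \in R0); last first.
    move: R00; rewrite (wtsP ws) negbK h0 => /eqP h00 _.
    have sub : (h <= 0)%VS by rewrite h00 subvv.
    by have := subvP sub _ (subvsP t); rewrite memv0 => /eqP t0; rewrite (_ : t = 0) ?linear0 //; apply: val_inj.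
  have t0 : vsval t \in gw 0 by rewrite h0; exact: subvsP.
  by rewrite (gpiE ws h_cartan R00 t0); case: eqP => // _; rewrite wtE vsvalK.
have hf : h = fullv.
  have h0s : (gw 0%R <= h)%VS by rewrite h0 subvv.
  apply/eqP; rewrite eqEsubv subvf -(gw_full ws) /= big_seq.
  apply: (big_ind (fun A => (A <= h)%VS)); first exact: sub0v.
  - by move=> A B A1 B1; rewrite subv_add A1.
  - by move=> gamma /R0_0->.
case: h_nil => n hn; have : iter n (lie_prod fullv) fullv = 0%VS :> {vspace g} by rewrite -hf.
have -> : iter n (lie_prod fullv) fullv = fullv :> {vspace g}.
  elim: n {hn} => //= n ->; apply/eqP; rewrite eqEsubv subvf /=.
  by apply/subvP => x _; exact: lie_perfect.
move=> g0; case: g_simple => /(_ _)[]; apply/eqP; rewrite -subv0 -g0; exact: subvf.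
Qed.

(** Invariance makes the radical an ideal, and [killing_nonzero] excludes that it is everything. *)
Lemma kil_nondeg x : (forall y, kil x y = 0) -> x = 0.
Proof.
pose F x : 'Hom(g, K^o) := linfun (kil x : g -> K^o).
have FE y z : F y z = kil y z by rewrite lfunE.
have linF : linear F.
  move=> a y z; apply/lfunP => w; apply: etrans (FE _ _) _.
  have lf (V : vectType K) (f1 f2 : 'Hom(V, K^o)) (v : V) : (a *: f1 + f2) v = a * (f1 v : K) + f2 v.
    by rewrite add_lfunE scale_lfunE.
  by apply: etrans (esym (lf _ _ _ _)); rewrite !FE kilC linearP /= ![kil w _]kilC.
pose L := GRing.isLinear.Build K g 'Hom(g, K^o) *:%R F linF.
pose FL : {linear g -> 'Hom(g, K^o)} := HB.pack F L.
pose rad := lker (linfun FL).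
have radP y : y \in rad <-> forall z, kil y z = 0.
  rewrite memv_ker lfunE /=; split=> [/eqP e z|e]; first by rewrite -FE e zero_lfunE.
  by apply/eqP/lfunP => z; rewrite FE e zero_lfunE.
move/radP.
case: g_simple => _ /(_ rad)[||full].
- apply/lie_prodP => y z _ /radP zr; apply/radP => w.
  by rewrite lieC -scaleN1r kilC linearZ /= kilC kil_inv zr mulr0.
- by move=> ->; rewrite memv0 => /eqP.
- by case: killing_nonzero => y z; apply: (radP y).1; rewrite full memvf.
Qed.

End KillingNondegenerate.

(** * Roots and coroots *)

Section RootSpaces.
Variables (K : fieldType) (charK : [pchar K] =i pred0).
Variables (g : lieAlgType K) (h : {vspace g}).
Local Notation "'h^*'" := (dual K (subvs_of h)).
Variables (R0 : seq h^*) (gw : h^* -> {vspace g}).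
Hypothesis ws : weight_system R0 gw.
Hypothesis h_cartan : cartan_subalgebra h.
Hypothesis g_simple : lie_simple g.
Implicit Types (x y z : g) (t : subvs_of h) (alpha beta gamma : h^*).

Let h_sub : lie_subalgebra h. Proof. by case: h_cartan. Qed.
Let h_nil : lie_nilpotent h. Proof. by case: h_cartan. Qed.
Let h0 : gw 0 = h := gw0E ws h_cartan.
Let n0 := natr_neq0 charK.

Lemma mem_gw0 t : vsval t \in gw 0.
Proof. by rewrite h0; exact: subvsP. Qed.

Lemma kil_orth alpha beta y z :
  y \in gw alpha -> z \in gw beta -> alpha + beta != 0 -> kil y z = 0.
Proof.
move=> ya zb ab; apply: (lftr_shift ws h_cartan ab) => gamma w wg.
by rewrite comp_lfunE !adE addrC -addrA; do 2!apply: (gw_lie ws) => //.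
Qed.

Lemma kilDr x y z : kil x (y + z) = kil x y + kil x z.
Proof. exact: linearD. Qed.
Lemma kilZr a x y : kil x (a *: y) = a * kil x y.
Proof. by rewrite linearZ. Qed.
Lemma kilDl x y z : kil (x + y) z = kil x z + kil y z.
Proof. by rewrite kilC kilDr ![kil z _]kilC. Qed.
Lemma kilZl a x y : kil (a *: x) y = a * kil x y.
Proof. by rewrite kilC kilZr kilC. Qed.
Lemma kil0r x : kil x 0 = 0. Proof. exact: linear0. Qed.
Lemma kil_sumr x (I : Type) (r : seq I) (F : I -> g) :
  kil x (\sum_(i <- r) F i) = \sum_(i <- r) kil x (F i).
Proof. exact: linear_sum. Qed.

Lemma kil_hh s t : kil (vsval s) (vsval t) =
  \sum_(gamma <- R0) (gamma s : K) * (gamma t : K) * (\dim (gw gamma))%:R.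
Proof.
(* Polarization of [kil_tt]. *)
apply: (mulfI (n0 (isT : 2%N != 0%N))).
have := kil_tt ws h_cartan (s + t).
have -> : vsval (s + t) = vsval s + vsval t by [].
rewrite kilDl !kilDr !(kil_tt ws h_cartan).
rewrite (kilC (vsval t) (vsval s)) => e.
apply: (addrI (\sum_(gamma <- R0) (gamma s : K) ^+ 2 * (\dim (gw gamma))%:R)).
apply: (addIr (\sum_(gamma <- R0) (gamma t : K) ^+ 2 * (\dim (gw gamma))%:R)).
have -> : forall a b c : K, a + 2%:R * b + c = a + b + (b + c) by move=> a b c; ring.
rewrite e mulr_sumr -!big_split /=; apply: eq_bigr => gamma _.
have -> : gamma (s + t) = (gamma s : K) + (gamma t : K) by rewrite linearD.
ring.
Qed.

Lemma orth_h x : x \in h -> (forall t, kil x (vsval t) = 0) -> x = 0.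
Proof.
move=> xh xt; apply: (kil_nondeg charK ws h_cartan g_simple) => y.
have [u [uP ->]] := gw_sum ws y; rewrite kil_sumr big1 // => alpha _.
have [a0|a0] := eqVneq alpha 0.
  have : u alpha \in h by rewrite -h0 -a0.
  by move=> uh; have := xt (vsproj h (u alpha)); rewrite vsprojK.
apply: (@kil_orth 0 alpha); rewrite ?h0 ?add0r //.
Qed.

Lemma wts_separate t : (forall gamma, gamma \in R0 -> gamma t = 0) -> t = 0.
Proof.
move=> t0; apply: val_inj; apply: (orth_h (subvsP t)) => s.
rewrite kil_hh big_seq big1 // => gamma gR.
by rewrite (_ : (gamma t : K) = 0) ?mul0r // t0.
Qed.

(** For alpha = 0 a string can be gamma alone: the trace of ad [x, y] on a single weight space
    vanishes, so gamma([x, y]) = 0 for every weight. *)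
Lemma h_abelian x y : x \in h -> y \in h -> lie x y = 0.
Proof.
move=> xh yh; have xyh : lie x y \in h by exact: h_lie.
have e : vsval (vsproj h (lie x y)) = lie x y by exact: vsprojK.
rewrite -e (@wts_separate (vsproj h (lie x y))) ?linear0 // => gamma gR.
have x0 : x \in gw 0 by rewrite h0.
have y0 : y \in gw (- 0) by rewrite oppr0 h0.
have /(string_trace ws h_cartan x0 y0 e) : forall beta, beta \in R0 -> pred1 gamma beta ->
    (beta + 0 \in R0 -> pred1 gamma (beta + 0)) /\ (beta - 0 \in R0 -> pred1 gamma (beta - 0)).
  by move=> beta _ pb; rewrite addr0 subr0.
rewrite -big_filter filter_pred1_uniq ?(wts_uniq ws) // big_seq1 => /eqP.
by rewrite mulf_eq0 (negbTE (n0 (dim_gw_neq0 ws gR))) orbF => /eqP.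
Qed.

Lemma root_mulrn alpha k l : alpha != 0 -> alpha *+ k = alpha *+ l -> k = l.
Proof.
move=> a0 /eqP; rewrite -!scaler_nat -subr_eq0 -scalerBl scaler_eq0 (negbTE a0) orbF.
wlog le : k l / (k <= l)%N => [H|].
  by case/orP: (leq_total k l) => le; [exact: H | rewrite -opprB oppr_eq0 => /H->].
rewrite -opprB oppr_eq0 -natrB // => e; apply/eqP; rewrite eqn_leq le /= -subn_eq0.
by apply: contraTT e => /n0.
Qed.

Lemma sl2_triple alpha : alpha \in R0 -> alpha != 0 ->
  exists e f t, [/\ e \in gw alpha, f \in gw (- alpha), lie e f = vsval t,
    (alpha t : K) = 2%:R & (forall s, lie (vsval s) e = (alpha s : K) *: e)].
Proof.
move=> aR a0.
(* [gw alpha] is so far only a generalized weight space; Engel's theorem twisted by alpha provides a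
   true eigenvector in it. *)
have [|||||e [ea e0] es] := @nilpotent_common_eigenvector K g h h_sub h_nil (gw alpha) 0%VS (wt alpha).
- by move=> t th y ya; have := gw_stable ws h_cartan (Subvs th) ya.
- by move=> t th y; rewrite memv0 => /eqP->; rewrite linear0 mem0v.
- by move=> s t sh th; rewrite h_abelian // linear0.
- move=> t y th /(gw_gsp ws (Subvs th))/gspP[k ek]; exists k.
  by rewrite wtE -SubvsE ek mem0v.
- by rewrite subv0 -(wtsP ws).
rewrite memv0 in e0.
have {}es s : lie (vsval s) e = (alpha s : K) *: e.
  by have := es _ (subvsP s); rewrite memv0 subr_eq0 wtE vsvalK => /eqP.
have [y0 ey] : exists y, kil e y != 0.
  apply: NNPP => ne; case/eqP: e0; apply: (kil_nondeg charK ws h_cartan g_simple) => y.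
  by apply/eqP/negPn/negP => ey; apply: ne; exists y.
have [u [uP y0E]] := gw_sum ws y0.
have ef : kil e (u (- alpha)) != 0.
  apply: contraNneq ey => ef0; rewrite y0E kil_sumr big1 // => beta _.
  have [->//|ne] := eqVneq beta (- alpha).
  apply: (kil_orth ea (uP beta)); apply: contraNneq ne => /eqP.
  by rewrite addrC addr_eq0 => /eqP ->.
set f := u (- alpha) in ef.
have fa : f \in gw (- alpha) by exact: uP.
have uh : lie e f \in h by rewrite -h0 -(subrr alpha); exact: (gw_lie ws).
set t := vsproj h (lie e f); have et : vsval t = lie e f by exact: vsprojK.
(* If alpha(t) = 0, [string_ratio] makes every weight vanish at t, so t = 0. But pairing [e, f] with
   s in h gives alpha(s) times the nonzero [kil e f]. *)
have at0 : (alpha t : K) != 0.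
  apply/negP => /eqP at0.
  have t0 : t = 0.
    apply: wts_separate => gamma gR.
    have [N [s [N0]]] := string_ratio ws h_cartan ea fa et gR.
    by rewrite at0 mulr0 => /eqP; rewrite mulf_eq0 (negbTE (n0 N0)) => /eqP.
  case/lfunPn: a0 => s; rewrite zero_lfunE => /negP[].
  have : kil (vsval s) (lie e f) = 0 by rewrite -et t0 kil0r.
  by rewrite -kil_inv es kilZl => /eqP; rewrite mulf_eq0 (negbTE ef) orbF.
exists e, ((2%:R / (alpha t : K)) *: f), ((2%:R / (alpha t : K)) *: t); split=> //.
- exact: memvZ.
- by rewrite lieZr linearZ /= et.
- have -> : alpha ((2%:R / (alpha t : K)) *: t) = (2%:R / (alpha t : K)) * (alpha t : K).
    by rewrite linearZ.
  by rewrite divfK.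
Qed.

Lemma gpi_sum_filter (P : pred h^*) gamma v : gamma \in R0 -> ~~ P gamma ->
  v \in (\sum_(beta <- R0 | P beta) gw beta)%VS -> gpi ws gamma v = 0.
Proof.
move=> gR Pg; rewrite -big_filter => /memv_sum_seq[|u [uP ->]].
  by rewrite filter_uniq ?(wts_uniq ws).
rewrite linear_sum big_seq big1 // => beta bR.
rewrite /= (gpiE ws h_cartan gR (uP _ bR)); case: eqP => // e.
by move: bR; rewrite mem_filter -e (negbTE Pg).
Qed.

(* The trace of H on K e + h + sum_(k > 0) g_(- k alpha) is 0, where e and f act. *)
Lemma neg_root_space alpha : alpha \in R0 -> alpha != 0 ->
  [/\ - alpha \in R0, \dim (gw (- alpha)) = 1%N &
    forall k, (1 < k)%N -> - (alpha *+ k) \notin R0].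
Proof.
move=> aR a0.
have [e [f [t [ea fa ef at2 es]]]] := sl2_triple aR a0.
have t0 : t != 0 by apply/eqP => t0; have := n0 (isT : 2%N != 0%N); rewrite -at2 t0 linear0 eqxx.
have e0 : e != 0.
  apply: contraNneq t0 => e0; apply/eqP/val_inj; rewrite -[LHS]ef e0 lie0l; exact/esym/linear0.
have f0 : f != 0.
  apply: contraNneq t0 => e1; apply/eqP/val_inj; rewrite -[LHS]ef e1 lie0r; exact/esym/linear0.
have naR : - alpha \in R0.
  by apply/negPn/negP => aR'; case/eqP: f0; exact: (gw_notin ws aR').
(* k = 0 is allowed, so S contains h. Only the line of e is taken from the space of alpha, since e
   maps h into that line. *)
pose P beta := asb (exists k : nat, beta = - (alpha *+ k)).
pose kk beta := if excluded_middle_informative (exists k : nat, beta = - (alpha *+ k)) is left p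
   then proj1_sig (constructive_indefinite_description _ p) else 0%N.
have kkP beta : P beta -> beta = - (alpha *+ kk beta).
  rewrite /kk => /asbP p; case: excluded_middle_informative => // q.
  by case: constructive_indefinite_description.
pose S := (\sum_(beta <- R0 | P beta) gw beta)%VS.
pose U := (<[e]> + S)%VS.
have inS k y : y \in gw (- (alpha *+ k)) -> y \in S.
  by move=> yk; apply: (mem_gw_sum ws yk) => _; apply/asbP; exists k.
have capS : (<[e]> :&: S = 0)%VS.
  apply/eqP; rewrite -subv0; apply/subvP => _ /memv_capP[/vlineP[c ->]].
  have Pa : ~~ P alpha.
    apply/negP => /asbP[k] /eqP; rewrite -addr_eq0 -mulrS => /eqP /(@root_mulrn _ _ 0%N a0).
    by [].
  move/(gpi_sum_filter aR Pa); rewrite (gpiE ws h_cartan aR (memvZ _ ea)).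
  by case: (@eqP _ alpha alpha) => // _ ->; rewrite mem0v.
have stU x : lie x e \in U -> (forall k y, y \in gw (- (alpha *+ k)) -> lie x y \in U) ->
    lfstable U (ad x).
  move=> xe xk _ /memv_addP[_ /vlineP[c ->] [v vS ->]].
  rewrite adE lieDr lieZr memvD ?memvZ //.
  move: vS; rewrite /S -big_filter => /memv_sum_seq[|u [uP ->]].
    by rewrite filter_uniq ?(wts_uniq ws).
  rewrite linear_sum big_seq memv_suml // => beta bR /=.
  have := uP _ bR; move: bR; rewrite mem_filter => /andP[/kkP-> _]; exact: xk.
have SU y : y \in S -> y \in U by apply/subvP; exact: addvSr.
have ste : lfstable U (ad e).
  apply: stU => [|[|k] y]; first by rewrite liexx mem0v.
    rewrite mulr0n oppr0 h0 => yh; have := es (vsproj h y); rewrite vsprojK // => ey; rewrite lieC ey.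
    by rewrite memvN; apply: (subvP (addvSl _ _)); rewrite memvZ ?memv_line.
  move=> yk; apply/SU/(inS k).
  have -> : - (alpha *+ k) = alpha + - (alpha *+ k.+1) by rewrite mulrS opprD addrA subrr add0r.
  exact: (gw_lie ws).
have stf : lfstable U (ad f).
  apply: stU => [|k y yk].
    rewrite lieC ef memvN; apply/SU/(inS 0%N); rewrite mulr0n oppr0; exact: mem_gw0.
  apply/SU/(inS k.+1); rewrite mulrS opprD; exact: (gw_lie ws).
have tr0 : trv U (ad (vsval t)) = 0.
  by rewrite -ef ad_lie linearB /= (trv_comm ste stf) subrr.
have ste1 : lfstable <[e]> (ad (vsval t)).
  by move=> _ /vlineP[c ->]; rewrite adE lieZr es !memvZ ?memv_line.
have stS : lfstable S (ad (vsval t)).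
  rewrite /S -big_filter; apply: lfstable_sum => beta y bR yb.
  by apply: (memv_sum_seqI bR); apply: (gw_stable ws h_cartan).
have tre : trv <[e]> (ad (vsval t)) = 2%:R.
  rewrite (@trv_geigen _ _ _ _ 2%:R 1) //; first by rewrite dim_vline e0 mulr1.
  by move=> _ /vlineP[c ->] /=; rewrite shiftE adE lieZr es at2 !scalerA mulrC subrr.
(* The trace on U is 2 minus twice this sum. The term k = 1 is already positive, so it is 1 and all
   terms with larger k are absent. *)
have sum1 : (\sum_(beta <- R0 | P beta) kk beta * \dim (gw beta) = 1)%N.
  move: tr0; rewrite /U (trv_add ste1 stS capS) tre (trv_string ws h_cartan) => tr0.
  have e1 : \sum_(beta <- R0 | P beta) (beta t : K) * (\dim (gw beta))%:R =
      - (2%:R * (\sum_(beta <- R0 | P beta) kk beta * \dim (gw beta))%N%:R).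
    rewrite natr_sum mulr_sumr -sumrN; apply: eq_bigr => beta /kkP eb.
    have -> : (beta t : K) = - ((kk beta)%:R * (alpha t : K)).
      by rewrite [in LHS]eb opp_lfunE -scaler_nat scale_lfunE.
    rewrite at2 natrM; ring.
  have : 2%:R * ((\sum_(beta <- R0 | P beta) kk beta * \dim (gw beta))%N%:R - 1) = 0 :> K.
    rewrite e1 in tr0; rewrite mulrBr mulr1; apply/eqP.
    by rewrite subr_eq0 eq_sym -subr_eq0; exact/eqP.
  move/eqP; rewrite mulf_eq0 (negbTE (n0 (isT : 2%N != 0%N))) /=.
  case: (\sum_(beta <- R0 | P beta) _)%N => [|m].
    by rewrite sub0r oppr_eq0 oner_eq0.
  by rewrite -natr1 addrK ((pcharf0P K).1 charK) => /eqP->.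
have kk1 : kk (- alpha) = 1%N.
  have /kkP : P (- alpha) by apply/asbP; exists 1%N.
  by move/oppr_inj; rewrite -[X in X = _]mulr1n => /(root_mulrn a0).
have d1 : \dim (gw (- alpha)) = 1%N /\
    (forall beta, beta \in R0 -> P beta -> beta != - alpha -> kk beta = 0%N).
  move: sum1; rewrite -big_filter (bigD1_seq (- alpha)) /=; first last.
  - by rewrite filter_uniq ?(wts_uniq ws).
  - by rewrite mem_filter naR andbT; apply/asbP; exists 1%N.
  rewrite kk1 mul1n.
  have := dim_gw_neq0 ws naR; case: (\dim (gw (- alpha))) => // d _.
  rewrite addSn => -[] /eqP; rewrite addn_eq0 => /andP[/eqP-> /eqP s0]; split=> // beta bR Pb ba.
  move/eqP: s0; rewrite sum_nat_seq_eq0 => /allP/(_ beta).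
  rewrite mem_filter Pb bR => /(_ isT); rewrite ba /= muln_eq0.
  by rewrite (negbTE (dim_gw_neq0 ws bR)) orbF => /eqP.
split=> //; first by case: d1.
move=> k k1; apply/negP => kR; case: d1 => _ /(_ _ kR).
have Pk : P (- (alpha *+ k)) by apply/asbP; exists k.
have ekk : kk (- (alpha *+ k)) = k.
  by have /oppr_inj /(root_mulrn a0) <- := kkP _ Pk.
rewrite ekk => /(_ Pk) H; suff : k = 0%N by move=> k0; rewrite k0 in k1.
apply: H; apply/eqP => /oppr_inj; rewrite -[X in _ = X]mulr1n => /(root_mulrn a0) e1.
by rewrite e1 in k1.
Qed.

End RootSpaces.

Lemma string_shift (i p : nat) : i%:Z - p%:Z + 1 = i.+1%:Z - p%:Z :> int.
Proof. lia. Qed.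
Lemma string_shiftN (i p : nat) : i.+1%:Z - p%:Z - 1 = i%:Z - p%:Z :> int.
Proof. lia. Qed.
Lemma string_low (p : nat) : 0%:Z - p%:Z - 1 = - p.+1%:Z :> int.
Proof. lia. Qed.
Lemma string_high (i p q : nat) : i = (p + q)%N -> i%:Z - p%:Z + 1 = q.+1%:Z :> int.
Proof. lia. Qed.
Lemma string_range (i p q : nat) : (i < (p + q).+1)%N -> (- p%:Z <= i%:Z - p%:Z <= q%:Z)%R.
Proof. lia. Qed.
Lemma string_inj (i j p : nat) : i%:Z - p%:Z = j%:Z - p%:Z :> int -> i = j.
Proof. lia. Qed.

Section Roots.
Variables (K : fieldType) (charK : [pchar K] =i pred0).
Variables (g : lieAlgType K) (h : {vspace g}).
Local Notation "'h^*'" := (dual K (subvs_of h)).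
Variables (R0 : seq h^*) (gw : h^* -> {vspace g}).
Hypothesis ws : weight_system R0 gw.
Hypothesis h_cartan : cartan_subalgebra h.
Hypothesis g_simple : lie_simple g.
Implicit Types (x y z : g) (t : subvs_of h) (alpha beta gamma delta : h^*).

Let h0 : gw 0 = h := gw0E ws h_cartan.
Let n0 := natr_neq0 charK.

Definition Phi : seq h^* := [seq alpha <- R0 | alpha != 0].

Lemma mem_Phi alpha : (alpha \in Phi) = (alpha != 0) && (alpha \in R0).
Proof. by rewrite mem_filter. Qed.

Lemma Phi_neq0 alpha : alpha \in Phi -> alpha != 0.
Proof. by rewrite mem_Phi => /andP[]. Qed.

Lemma Phi_opp alpha : alpha \in Phi -> - alpha \in Phi.
Proof.
rewrite !mem_Phi oppr_eq0 => /andP[a0 aR]; rewrite a0 /=.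
by case: (neg_root_space charK ws h_cartan g_simple aR a0).
Qed.

Lemma dim_root alpha : alpha \in Phi -> \dim (gw alpha) = 1%N.
Proof.
move/Phi_opp; rewrite mem_Phi => /andP[a0 aR].
by case: (neg_root_space charK ws h_cartan g_simple aR a0); rewrite opprK.
Qed.

Lemma Phi_multiple alpha (k : int) : alpha \in Phi -> alpha *~ k \in Phi -> k = 1 \/ k = -1.
Proof.
have H beta n : beta \in Phi -> - (beta *+ n) \in Phi -> n = 1%N.
  rewrite !mem_Phi => /andP[b0 bR] /andP[bn0 bnR].
  have [_ _ no] := neg_root_space charK ws h_cartan g_simple bR b0.
  case: n bn0 bnR => [|[|n]] //; first by rewrite mulr0n oppr0 eqxx.
  by move=> _; apply: contraTeq; rewrite no.
move=> aP; case: k => n.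
  rewrite -pmulrn => nP; left; rewrite (H (- alpha) n) //; first exact: Phi_opp.
  by rewrite mulNrn opprK.
by rewrite NegzE mulrNz -pmulrn => /(H _ _ aP) ->; right.
Qed.

Definition rvec alpha : g := vpick (gw alpha).

Lemma rvec_mem alpha : rvec alpha \in gw alpha.
Proof. exact: memv_pick. Qed.

Lemma rvec_neq0 alpha : alpha \in Phi -> rvec alpha != 0.
Proof. by rewrite vpick0 -(wtsP ws) mem_Phi => /andP[]. Qed.

Lemma gw_line alpha : alpha \in Phi -> gw alpha = <[rvec alpha]>%VS.
Proof.
move=> aP; apply/esym/eqP; rewrite eqEdim dim_root // dim_vline rvec_neq0 // andbT.
exact: rvec_mem.
Qed.

Lemma gw_lineP alpha y : alpha \in Phi -> y \in gw alpha -> exists c, y = c *: rvec alpha.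
Proof. by move=> aP; rewrite gw_line // => /vlineP. Qed.

Lemma root_triple alpha : alpha \in Phi -> exists f t,
  [/\ f \in gw (- alpha), lie (rvec alpha) f = vsval t,
    (alpha t : K) = 2%:R & (forall s, lie (vsval s) (rvec alpha) = (alpha s : K) *: rvec alpha)].
Proof.
move=> aP; have := aP; rewrite mem_Phi => /andP[a0 aR].
have [e [f [t [ea fa ef at2 es]]]] := sl2_triple charK ws h_cartan g_simple aR a0.
have [c ec] := gw_lineP aP ea.
have c0 : c != 0.
  apply/eqP => c0; have : vsval t = 0 by rewrite -ef ec c0 scale0r lie0l.
  move=> t0; have {}t0 : t = 0 by exact: val_inj.
  by have := n0 (isT : 2%N != 0%N); rewrite -at2 t0 linear0 eqxx.
exists (c *: f), t; split=> //; first exact: memvZ.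
  by rewrite lieZr -lieZl -ec.
move=> s; apply: (scalerI c0); rewrite -lieZr -ec es ec !scalerA; congr (_ *: _); exact: mulrC.
Qed.

Lemma weight_gw alpha y : y \in gw alpha <-> weight_vector alpha y.
Proof.
split=> [ya t|yw].
  have [aP|] := boolP (alpha \in Phi).
    have [f [s [_ _ _ es]]] := root_triple aP; have [c ->] := gw_lineP aP ya.
    by rewrite lieZr es !scalerA mulrC.
  rewrite mem_Phi negb_and negbK => /orP[/eqP a0|/(gw_notin ws)/(_ ya)->].
    have yh : y \in h by rewrite -h0 -a0.
    by rewrite a0 zero_lfunE scale0r (h_abelian charK ws h_cartan g_simple) ?subvsP.
  by rewrite lie0r scaler0.
apply: (gwP ws alpha y).2 => t; apply/gspP; exists 1%N.
by rewrite /= shiftE adE yw subrr.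
Qed.

Lemma Phi_rootP alpha : alpha \in Phi <-> is_root alpha.
Proof.
split=> [aP|[a0 [x x0 /weight_gw xa]]].
  split; first exact/eqP/Phi_neq0.
  exists (rvec alpha); first exact/eqP/rvec_neq0.
  exact/weight_gw/rvec_mem.
rewrite mem_Phi; apply/andP; split; first exact/eqP.
by apply/negPn/negP => aR; case: x0; exact: (gw_notin ws aR).
Qed.

Lemma rvec_lie_h alpha t : alpha \in Phi -> lie (vsval t) (rvec alpha) = (alpha t : K) *: rvec alpha.
Proof. by move=> _; move: t; exact/weight_gw/rvec_mem. Qed.

Definition coroot alpha : subvs_of h :=
  if excluded_middle_informative (exists t, is_coroot alpha t) is left p
  then proj1_sig (constructive_indefinite_description _ p) else 0.

Lemma corootP alpha : alpha \in Phi -> exists f,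
  [/\ f \in gw (- alpha), lie (rvec alpha) f = vsval (coroot alpha)
    & (alpha (coroot alpha) : K) = 2%:R].
Proof.
move=> aP; have [f0 [t0 [f0a e0 at0 _]]] := root_triple aP.
have : is_coroot alpha (coroot alpha).
  rewrite /coroot; case: excluded_middle_informative => [p|[]].
    by case: constructive_indefinite_description.
  exists t0; split=> //; exists (rvec alpha), f0.
  by split=> //; apply/weight_gw => //; exact: rvec_mem.
case=> [[e [f [/weight_gw ea /weight_gw fa ef]]] a2]; have [c ec] := gw_lineP aP ea.
exists (c *: f); split=> //; first exact: memvZ.
by rewrite lieZr -lieZl -ec.
Qed.

Lemma coroot_uniq alpha t : alpha \in Phi -> is_coroot alpha t -> t = coroot alpha.
Proof.
move=> aP [[e [f [/weight_gw ea /weight_gw fa ef]]] a2].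
have [f0 [f0a e0 at0]] := corootP aP.
have naP := Phi_opp aP.
have f00 : f0 != 0.
  apply/eqP => f00; have /esym t0 := e0; rewrite f00 lie0r in t0.
  have {}t0 : coroot alpha = 0 by exact: val_inj.
  by have := n0 (isT : 2%N != 0%N); rewrite -at0 t0 linear0 eqxx.
have [c ec] := gw_lineP aP ea.
have [d ed] := gw_lineP naP fa; have [d0 ed0] := gw_lineP naP f0a.
have d00 : d0 != 0 by apply: contraNneq f00 => d00; rewrite ed0 d00 scale0r.
have tE : t = (c * d / d0) *: coroot alpha.
  apply: val_inj; rewrite /= ef -[vsval _]/(vsval (coroot alpha)) -e0 ec ed ed0.
  by rewrite lieZl !lieZr !scalerA divfK.
have : (alpha t : K) = 2%:R by [].
have -> : (alpha t : K) = (c * d / d0) * (alpha (coroot alpha) : K) by rewrite tE linearZ.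
rewrite at0 -[X in _ = X]mul1r => /(mulIf (n0 (isT : 2%N != 0%N))) e1.
by rewrite tE e1 scale1r.
Qed.

Definition cartan beta alpha : K := beta (coroot alpha).

Lemma cartan_linear alpha : linear_for *%R (cartan^~ alpha).
Proof. by move=> a x y; rewrite /cartan add_lfunE scale_lfunE. Qed.

Lemma cartan_id alpha : alpha \in Phi -> cartan alpha alpha = 2%:R.
Proof. by move=> /corootP[f []]. Qed.

Lemma coroot_trace alpha (P : pred h^*) : alpha \in Phi ->
  (forall gamma, gamma \in R0 -> P gamma ->
     (gamma + alpha \in R0 -> P (gamma + alpha)) /\ (gamma - alpha \in R0 -> P (gamma - alpha))) ->
  \sum_(gamma <- R0 | P gamma) cartan gamma alpha * (\dim (gw gamma))%:R = 0.
Proof.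
move=> aP; have [f [fa ef _]] := corootP aP.
exact: (string_trace ws h_cartan (rvec_mem alpha) fa (esym ef)).
Qed.

Lemma string_end alpha beta : alpha != 0 ->
  exists p : nat, beta + alpha *+ p.+1 \notin R0 /\
    (forall i, (i <= p)%N -> (0 < i)%N -> beta + alpha *+ i \in R0).
Proof.
move=> a0; have ex : exists n, beta + alpha *+ n.+1 \notin R0.
  apply: NNPP => ne.
  have H n : beta + alpha *+ n.+1 \in R0 by apply/negPn/negP => nR; apply: ne; exists n.
  pose s := [seq beta + alpha *+ n.+1 | n <- iota 0 (size R0).+1].
  have : (size s <= size R0)%N.
    apply: uniq_leq_size => [|_ /mapP[n _ ->]] //.
    rewrite map_inj_in_uniq ?iota_uniq // => i j _ _ /addrI /(root_mulrn charK a0) [].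
    by [].
  by rewrite size_map size_iota ltnn.
case: (ex_minnP ex) => p pR pmin; exists p; split=> // i ip i0.
apply/negPn/negP => iR; have := pmin i.-1; rewrite prednK // iR => /(_ isT).
by rewrite leqNgt prednK // ip.
Qed.

(** On the unbroken string from - p to q the coroot has trace 0, and it acts on the k-th space, a
    line, by c + 2k. Summing gives (p + q + 1)(c + q - p) = 0. The last hypothesis keeps the zero
    weight, whose space need not be a line, off the string. *)
Lemma root_string alpha beta : alpha \in Phi -> beta \in Phi ->
  (forall k : int, beta + alpha *~ k != 0) -> exists p q : nat,
  [/\ cartan beta alpha = p%:R - q%:R,
    (forall k : int, (- p%:Z <= k <= q%:Z)%R -> beta + alpha *~ k \in Phi),
    beta + alpha *+ q.+1 \notin Phi & beta - alpha *+ p.+1 \notin Phi].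
Proof.
move=> aP bP nz; have a0 := Phi_neq0 aP.
have bR : beta \in R0 by move: bP; rewrite mem_Phi => /andP[].
have [q [qR qi]] := string_end beta a0.
have na0 : - alpha != 0 by rewrite oppr_eq0.
have [p [pR pi]] := string_end beta na0.
have addz k : beta + alpha *~ k + alpha = beta + alpha *~ (k + 1).
  by rewrite mulrzDr mulr1z addrA.
have subz k : beta + alpha *~ k - alpha = beta + alpha *~ (k - 1).
  by rewrite mulrzBr mulr1z addrA.
pose s := [seq beta + alpha *~ (i%:Z - p%:Z) | i <- iota 0 (p + q).+1].
have inj : injective (fun k : int => beta + alpha *~ k).
  move=> k l /addrI /eqP; rewrite -subr_eq0 -mulrzBr => e.
  apply/eqP; rewrite -subr_eq0; move: e; case: (k - l) => n.
    by rewrite -pmulrn => /eqP; rewrite -(mulr0n alpha) => /(root_mulrn charK a0)->.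
  by rewrite NegzE mulrNz oppr_eq0 -pmulrn => /eqP; rewrite -(mulr0n alpha) => /(root_mulrn charK a0).
have sR k : (- p%:Z <= k <= q%:Z)%R -> beta + alpha *~ k \in R0.
  case: k => [[|n]|n] /andP[lo hi].
  - by rewrite mulr0z addr0.
  - by rewrite -pmulrn; apply: qi.
  - by rewrite NegzE mulrNz -pmulrn -mulNrn; apply: pi => //; move: lo; rewrite NegzE lerN2.
have sP : s =i [seq gamma <- R0 | gamma \in s].
  move=> gamma; rewrite mem_filter andbC; case: (boolP (gamma \in s)); rewrite ?andbF // andbT.
  by case/mapP => i; rewrite mem_iota => /andP[_ li] ->; apply/esym/sR/string_range.
have us : uniq s.
  by rewrite map_inj_in_uniq ?iota_uniq // => i j _ _ /inj/string_inj.
have /(@coroot_trace _ (mem s) aP) : forall gamma, gamma \in R0 -> gamma \in s ->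
    (gamma + alpha \in R0 -> gamma + alpha \in s) /\ (gamma - alpha \in R0 -> gamma - alpha \in s).
  move=> gamma _ /mapP[i]; rewrite mem_iota => /andP[_ li] ->; split=> gR.
    rewrite addz string_shift.
    apply/mapP; exists i.+1 => //.
    rewrite mem_iota /=; move: (li); rewrite ltnS leq_eqVlt => /orP[/eqP e|//].
    by case/negP: qR; rewrite pmulrn -(string_high e) -addz.
  case: i li gR => [|i] li gR.
    case/negP: pR; rewrite mulNrn pmulrn -mulrNz.
    by move: gR; rewrite subz string_low.
  apply/mapP; exists i; first by rewrite mem_iota /= (ltn_trans _ li).
  by rewrite subz string_shiftN.
have pe : perm_eq [seq gamma <- R0 | mem s gamma] s.
  by apply: uniq_perm; rewrite ?filter_uniq ?(wts_uniq ws) // => gamma; rewrite sP.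
rewrite -big_filter (perm_big _ pe) /=.
rewrite big_map.
have -> : \sum_(i <- iota 0 (p + q).+1) cartan (beta + alpha *~ (i%:Z - p%:Z)) alpha *
    (\dim (gw (beta + alpha *~ (i%:Z - p%:Z))))%:R =
    \sum_(0 <= i < (p + q).+1) (cartan beta alpha + 2%:R * (i%:R - p%:R)).
  rewrite /index_iota subn0; apply: eq_big_seq => i; rewrite mem_iota => /andP[_ li].
  rewrite dim_root ?mulr1; last by rewrite mem_Phi nz /= sR // string_range.
  rewrite /cartan add_lfunE; congr (_ + _).
  rewrite -scaler_int scale_lfunE; have := cartan_id aP; rewrite /cartan => a2.
  by rewrite -[_ *: _]/(_%:~R * (alpha (coroot alpha) : K)) a2 mulrC rmorphB.
rewrite big_split /= sumr_const_nat subn0 -mulr_sumr big_split /= sumrN -natr_sum.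
rewrite sumr_const_nat subn0 => e.
exists p, q; split.
- apply: (mulfI (n0 (isT : (p + q).+1 != 0%N))).
  have e2 : 2%:R * (\sum_(0 <= i < (p + q).+1) i)%N%:R = ((p + q).+1 * (p + q))%N%:R :> K.
    rewrite -natrM bin2_sum bin2 mul2n even_halfK //= .
    by rewrite mulSn oddD oddM; case: odd.
  move: e; rewrite mulrBr e2 -[_ *+ (p + q).+1]mulr_natr -[p%:R *+ _]mulr_natr natrM natrD => e.
  apply/eqP; rewrite -subr_eq0 -[X in _ == X]e; apply/eqP; ring.
- by move=> k kpq; rewrite mem_Phi nz sR.
- by rewrite mem_Phi negb_and qR orbT.
- by rewrite mem_Phi negb_and -mulNrn pR orbT.
Qed.

End Roots.

(** * Reflections, coroots and the Killing pairing *)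

Section RootsKilling.
Variables (K : fieldType) (charK : [pchar K] =i pred0).
Variables (g : lieAlgType K) (h : {vspace g}).
Local Notation "'h^*'" := (dual K (subvs_of h)).
Variables (R0 : seq h^*) (gw : h^* -> {vspace g}).
Hypothesis ws : weight_system R0 gw.
Hypothesis h_cartan : cartan_subalgebra h.
Hypothesis g_simple : lie_simple g.
Implicit Types (x y z : g) (t : subvs_of h) (alpha beta gamma delta : h^*).
Local Notation Phi := (Phi R0).
Local Notation rvec := (rvec gw).

Let h0 : gw 0 = h := gw0E ws h_cartan.
Let n0 := natr_neq0 charK.

Lemma kil_pairing alpha y z : alpha \in Phi -> y \in gw alpha -> y != 0 ->
  z \in gw (- alpha) -> z != 0 -> kil y z != 0.
Proof.
move=> aP ya y0 za z0; apply/negP => /eqP yz.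
have naP := Phi_opp charK ws h_cartan g_simple aP.
have [c ec] := gw_lineP charK ws h_cartan g_simple naP za.
have c0 : c != 0 by apply: contraNneq z0 => c0; rewrite ec c0 scale0r.
case/eqP: y0; apply: (kil_nondeg charK ws h_cartan g_simple) => w.
have [u [uP ->]] := gw_sum ws w; rewrite kil_sumr big1 // => beta _.
have [e|ne] := eqVneq beta (- alpha); last first.
  apply: (kil_orth ws h_cartan ya (uP beta)); apply: contraNneq ne => /eqP.
  by rewrite addrC addr_eq0 => /eqP->.
have [d ed] := gw_lineP charK ws h_cartan g_simple naP (uP (- alpha)).
move: yz; rewrite e ed ec !kilZr => /eqP; rewrite mulf_eq0 (negbTE c0) => /eqP->.
by rewrite mulr0.
Qed.

Lemma root_vec_neq0 alpha f : alpha \in Phi -> lie (rvec alpha) f = vsval (coroot alpha) -> f != 0.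
Proof.
move=> aP ef; apply/eqP => f0; rewrite f0 lie0r in ef.
have {}ef : coroot alpha = 0 by apply: val_inj; rewrite /= -ef.
have [_ [_ _ a2]] := corootP charK ws h_cartan g_simple aP.
by have := n0 (isT : 2%N != 0%N); rewrite -a2 ef linear0 eqxx.
Qed.

(** By invariance N is the Killing product of the two root vectors whose bracket is the coroot. *)
Lemma kil_coroot alpha : alpha \in Phi -> exists2 N : K, N != 0 &
  forall t, kil (vsval (coroot alpha)) (vsval t) = (alpha t : K) * N.
Proof.
move=> aP; have [f [fa ef a2]] := corootP charK ws h_cartan g_simple aP.
have f0 := root_vec_neq0 aP ef.
have e0 := rvec_neq0 ws aP.
exists (kil (rvec alpha) f); first exact: (kil_pairing aP (rvec_mem gw alpha)).
move=> t; rewrite -ef kil_inv lieC.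
have fw := (weight_gw charK ws h_cartan g_simple (- alpha) f).1 fa.
by rewrite fw opp_lfunE scaleNr opprK kilZr.
Qed.

Lemma Phi_nmultiple alpha beta : alpha \in Phi -> beta \in Phi ->
  beta != alpha -> beta != - alpha -> forall k : int, beta + alpha *~ k != 0.
Proof.
move=> aP bP ba bna k; apply/eqP => /eqP; rewrite addr_eq0 -mulrNz => /eqP e.
have := bP; rewrite e => /(Phi_multiple charK ws h_cartan g_simple aP) [ek|ek].
  by case/eqP: ba; rewrite e ek mulr1z.
by case/eqP: bna; rewrite e ek mulrNz mulr1z.
Qed.

Lemma cartan_string alpha beta : alpha \in Phi -> beta \in Phi ->
  beta != alpha -> beta != - alpha -> exists p q : nat,
  [/\ cartan beta alpha = p%:R - q%:R,
    (forall k : int, (- p%:Z <= k <= q%:Z)%R -> beta + alpha *~ k \in Phi),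
    beta + alpha *+ q.+1 \notin Phi & beta - alpha *+ p.+1 \notin Phi].
Proof.
by move=> aP bP ba bna; apply: (root_string charK ws) => //; exact: Phi_nmultiple.
Qed.

Definition root_refl alpha beta : h^* := beta - cartan beta alpha *: alpha.

Lemma cartanN alpha beta : cartan (- beta) alpha = - cartan beta alpha.
Proof. by rewrite /cartan opp_lfunE. Qed.

Lemma root_refl_root alpha beta : alpha \in Phi -> beta \in Phi -> root_refl alpha beta \in Phi.
Proof.
move=> aP bP; rewrite /root_refl.
have a2 := cartan_id charK ws h_cartan g_simple aP.
have [->|ba] := eqVneq beta alpha.
  rewrite a2 scaler_nat mulr2n opprD addrA subrr sub0r.
  exact: (Phi_opp charK ws).
have [->|bna] := eqVneq beta (- alpha).
  rewrite cartanN a2 scaleNr opprK scaler_nat mulr2n addrA addNr add0r //.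
have [p [q [-> H _ _]]] := cartan_string aP bP ba bna.
have -> : beta - (p%:R - q%:R) *: alpha = beta + alpha *~ (q%:Z - p%:Z).
  by rewrite -scaler_int rmorphB /= -scaleNr opprB.
by apply: H; lia.
Qed.

(** Under the Killing form the right-hand side represents a multiple of the reflected root, so it is
    a multiple of the wanted coroot; the reflected root takes the value 2 on it, which makes the
    factor 1. *)
Lemma coroot_root_refl alpha beta : alpha \in Phi -> beta \in Phi ->
  coroot (root_refl alpha beta) = coroot beta - cartan alpha beta *: coroot alpha.
Proof.
move=> aP bP; have dP := root_refl_root aP bP; set delta := root_refl alpha beta in dP *.
have a2 := cartan_id charK ws h_cartan g_simple aP.
have b2 := cartan_id charK ws h_cartan g_simple bP.
have d2 := cartan_id charK ws h_cartan g_simple dP.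
have [Na Na0 ea] := kil_coroot aP; have [Nb Nb0 eb] := kil_coroot bP.
have [Nd Nd0 ed] := kil_coroot dP.
set t := coroot beta - _.
have sym : cartan alpha beta * Na = cartan beta alpha * Nb.
  by rewrite -[LHS]ea kilC eb.
have kt s : kil (vsval t) (vsval s) = Nb * (delta s : K).
  have -> : vsval t = vsval (coroot beta) + (- cartan alpha beta) *: vsval (coroot alpha).
    by rewrite scaleNr.
  rewrite kilDl kilZl ea eb.
  have -> : (delta s : K) = (beta s : K) - cartan beta alpha * (alpha s : K).
    by rewrite /delta /root_refl add_lfunE opp_lfunE scale_lfunE.
  rewrite mulNr [(alpha s : K) * Na]mulrC mulrA sym; ring.
have tE : t = (Nb / Nd) *: coroot delta.
  apply/eqP; rewrite -subr_eq0; apply/eqP/val_inj/(orth_h charK ws h_cartan g_simple); first exact: subvsP.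
  move=> s; rewrite -[X in kil X _ = _]/(vsval t - (Nb / Nd) *: vsval (coroot delta)).
  by rewrite -scaleNr kilDl kilZl kt ed mulNr mulrCA divfK // mulrC subrr.
have dt : (delta t : K) = 2%:R.
  have -> : (delta t : K) = (delta (coroot beta) : K) - cartan alpha beta * (delta (coroot alpha) : K).
    by rewrite /t linearB linearZ.
  have D s : (delta s : K) = (beta s : K) - cartan beta alpha * (alpha s : K).
    by rewrite /delta /root_refl add_lfunE opp_lfunE scale_lfunE.
  rewrite !D -!/(cartan _ _) a2 b2; ring.
have : (Nb / Nd) = 1.
  apply: (mulIf (n0 (isT : 2%N != 0%N))); rewrite mul1r -[in RHS]dt tE -[in LHS]d2.
  by rewrite linearZ.
by move=> e; rewrite tE e scale1r.
Qed.

(* e_beta is a highest weight vector for the sl2 of alpha, of nonzero weight. *)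
Lemma lie_rvec_neq0 beta gamma gamma' : beta \in Phi -> gamma \in Phi -> gamma' \in Phi ->
  gamma + gamma' = beta -> beta + gamma \notin Phi -> cartan gamma beta != 0 ->
  lie (rvec gamma') (rvec gamma) != 0.
Proof.
move=> bP gP gP' e bg c0.
have [f [fb ef b2]] := corootP charK ws h_cartan g_simple bP.
have g0 := rvec_neq0 ws gP; have g'0 := rvec_neq0 ws gP'.
have bg0 : lie (rvec beta) (rvec gamma) = 0.
  have bgw := gw_lie ws (rvec_mem gw beta) (rvec_mem gw gamma).
  move: bg; rewrite mem_Phi negb_and negbK => /orP[/eqP b0|]; last by move/(gw_notin ws)/(_ bgw).
  (* If beta + gamma were 0, gamma' would be -2 gamma, which is not a root. *)
  have bE : beta = - gamma by apply/eqP; rewrite -addr_eq0 b0.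
  have g'E : gamma' = - (gamma *+ 2).
    by rewrite mulr2n opprD -bE -[X in _ = X + _]e addrAC bE subrr add0r.
  have := gP'; rewrite g'E => gP2.
  have := Phi_multiple charK ws h_cartan g_simple (alpha := gamma) (k := - 2) gP.
  by rewrite mulrNz => /(_ gP2) [].
(* As e_beta kills e_gamma, it maps [f, e_gamma] to the nonzero multiple [cartan gamma beta] of
   e_gamma. *)
have fg : lie f (rvec gamma) != 0.
  apply: contraNneq c0 => fg0.
  have := lie_leibniz (rvec beta) f (rvec gamma).
  rewrite fg0 bg0 !lie0r addr0 ef (rvec_lie_h charK ws h_cartan g_simple) // => /esym/eqP.
  by rewrite scaler_eq0 (negbTE g0) orbF.
have fgw : lie f (rvec gamma) \in gw (- gamma').
  rewrite (_ : - gamma' = - beta + gamma); first exact: (gw_lie ws fb (rvec_mem gw gamma)).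
  by rewrite -e opprD addrAC addNr add0r.
(* [f, e_gamma] has weight - gamma', so it pairs nontrivially with e_gamma'; by invariance this is,
   up to sign, the pairing of [e_gamma', e_gamma] with f. *)
have := kil_pairing gP' (rvec_mem gw gamma') g'0 fgw fg.
apply: contraNneq => e0; rewrite lieC -scaleN1r kilZr -kil_inv e0 kilC kil0r mulr0 //.
Qed.

End RootsKilling.

(** * Kostant's cascade in an abstract root system *)

Section IntChar0.
Variables (K : fieldType) (charK : [pchar K] =i pred0).

Lemma intr_eq0_char0 (z : int) : (z%:~R == 0 :> K) = (z == 0).
Proof.
have n0 := (pcharf0P K).1 charK.
case: z => n; first exact: n0.
by rewrite NegzE mulrNz oppr_eq0 n0 oppr_eq0.
Qed.

Lemma intr_inj_char0 : injective (fun z : int => z%:~R : K).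
Proof.
move=> z1 z2 /eqP; rewrite -subr_eq0 -rmorphB /= intr_eq0_char0 subr_eq0.
by move/eqP.
Qed.
End IntChar0.

Lemma mem_cat_split (T : eqType) (x : T) s : x \in s -> exists l1 l2, s = l1 ++ x :: l2.
Proof. by case/splitPr => l1 l2; exists l1, l2. Qed.

Lemma string_bound1 (p q : nat) : (- p%:Z <= 1 <= q.+1%:Z)%R.
Proof. lia. Qed.
Lemma string_boundN1 (p q : nat) : (- p.+1%:Z <= - 1 <= q%:Z)%R.
Proof. lia. Qed.
Lemma string_boundN2 (p q : nat) : (- p.+2%:Z <= - 2 <= q%:Z)%R.
Proof. lia. Qed.

Section RootSystem.
Variables (K : fieldType) (charK : [pchar K] =i pred0) (V : lmodType K).
Variables (Phi : seq V) (c : V -> V -> K) (n : V -> nat) (ht : V -> int).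
Hypothesis c_lin : forall a, linear_for *%R (c^~ a).
Hypothesis Phi0 : forall a, a \in Phi -> a != 0.
Hypothesis PhiN : forall a, a \in Phi -> - a \in Phi.
Hypothesis c2 : forall a, a \in Phi -> c a a = 2%:R.
Hypothesis string : forall a b, a \in Phi -> b \in Phi -> b != a -> b != - a ->
  exists p q : nat, [/\ c b a = p%:R - q%:R,
    (forall k : int, (- p%:Z <= k <= q%:Z)%R -> b + a *~ k \in Phi),
    b + a *+ q.+1 \notin Phi & b - a *+ p.+1 \notin Phi].
Hypothesis n_neq0 : forall a, a \in Phi -> n a != 0%N.
Hypothesis c_sym : forall a b, a \in Phi -> b \in Phi -> c a b * (n a)%:R = c b a * (n b)%:R.
Hypothesis ht_lin : forall a b (k : int), a \in Phi -> b \in Phi -> a + b *~ k \in Phi ->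
  ht (a + b *~ k) = ht a + k * ht b.
Hypothesis ht0 : forall a, a \in Phi -> ht a != 0.

Lemma htD a b : a \in Phi -> b \in Phi -> a + b \in Phi -> ht (a + b) = ht a + ht b.
Proof. by move=> aP bP abP; have := @ht_lin a b 1; rewrite mulr1z mul1r; apply. Qed.

Lemma htN a : a \in Phi -> ht (- a) = - ht a.
Proof.
move=> aP; have e : - a = a + a *~ (- 2).
  by rewrite mulrNz -[a *~ 2]/(a + a) opprD addrA subrr add0r.
by rewrite e ht_lin // -?e ?PhiN //; ring.
Qed.

Definition orth (s : seq V) a := all (fun b => c a b == 0) s.
Definition pos a := (0 < ht a)%R.

Lemma pairingD a b d : c (a + b) d = c a d + c b d.
Proof. by have := c_lin d 1 a b; rewrite scale1r mul1r. Qed.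
Lemma pairing0 d : c 0 d = 0.
Proof. by apply: (addrI (c 0 d)); rewrite -pairingD !addr0. Qed.
Lemma pairingZ k a d : c (k *: a) d = k * c a d.
Proof. by have := c_lin d k a 0; rewrite !addr0 pairing0 addr0. Qed.
Lemma pairingN a d : c (- a) d = - c a d.
Proof. by rewrite -scaleN1r pairingZ mulN1r. Qed.
Lemma pairing_sum (I : Type) (r : seq I) (F : I -> V) d :
  c (\sum_(i <- r) F i) d = \sum_(i <- r) c (F i) d.
Proof. by apply: (big_morph (c^~ d)) => [x y|]; [exact: pairingD | exact: pairing0]. Qed.

Lemma orthD s a b : orth s a -> orth s b -> orth s (a + b).
Proof.
by move=> /allP sa /allP sb; apply/allP => d ds; rewrite pairingD (eqP (sa d ds)) (eqP (sb d ds)) addr0.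
Qed.

Lemma orthN s a : orth s a -> orth s (- a).
Proof. by move=> /allP sa; apply/allP => d ds; rewrite pairingN (eqP (sa d ds)) oppr0. Qed.

Lemma posN a : a \in Phi -> ~~ pos a -> pos (- a).
Proof. by move=> aP; rewrite /pos htN // oppr_gt0 -leNgt le_eqVlt (negbTE (ht0 aP)). Qed.

Definition maximal s b := forall a, a \in Phi -> orth s a -> (ht a <= ht b)%R.

(** Maximality bounds the b-string through a at both ends: a + b would be a root higher than b, and
    if a - 2b were a root, so would be 2b - a, again higher than b. Both would be orthogonal to
    s. *)
Lemma maximal_cases s b a : b \in Phi -> orth s b -> maximal s b ->
  a \in Phi -> orth s a -> pos a ->
  [\/ c a b = 0, a = b | [/\ c a b = 1, b - a \in Phi, pos (b - a) & b + a \notin Phi]].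
Proof.
move=> bP sb mb aP sa pa.
have [->|ab] := eqVneq a b; first by constructor 2.
have pb : pos b by apply: lt_le_trans (mb _ aP sa).
have anb : a != - b.
  by apply/eqP => e; move: pa; rewrite e /pos htN // oppr_gt0 lt_gtF.
have [p [q [cE H Hq _]]] := string bP aP ab anb.
have q0 : q = 0%N.
  case: q cE H Hq => // q cE H _; have abP : a + b \in Phi.
    by rewrite -[b]mulr1z; apply: H; exact: string_bound1.
  have := mb _ abP (orthD sa sb); rewrite htD // => le.
  by move: le; rewrite gerDr leNgt [(_ < _)%R]pa.
rewrite q0 in cE H Hq; case: p cE H => [|p] cE H; first by constructor 1; rewrite cE subrr.
have baP : b - a \in Phi.
  rewrite -opprB; apply: PhiN; have -> : a - b = a + b *~ (- 1) by rewrite mulrNz mulr1z.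
  by apply: H; exact: string_boundN1.
have htba : ht (b - a) = ht b - ht a.
  by rewrite htD ?htN // PhiN.
have ltab : (ht a < ht b)%R.
  have := mb _ aP sa; rewrite le_eqVlt => /orP[/eqP e|//].
  by have := ht0 baP; rewrite htba e subrr eqxx.
case: p cE H => [|p] cE H.
  constructor 3; split=> //; first by rewrite cE subr0.
    by rewrite /pos htba subr_gt0.
  by rewrite addrC -[b]mulr1n.
have b2P : b + (b - a) \in Phi.
  have : a + b *~ (- 2) \in Phi by apply: H; exact: string_boundN2.
  have -> : b *~ (- 2) = - (b + b) by rewrite mulrNz.
  by move/PhiN; rewrite opprD opprK addrC addrA.
have := mb _ b2P (orthD sb (orthD sb (orthN sa))).
by rewrite htD // htba gerDl subr_le0 leNgt ltab.
Qed.

(** s holds the roots already chosen, latest first. The list may end only when no root is orthogonal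
    to s, so the cascade is exhaustive. *)
Fixpoint cascade s l := if l is b :: l' then
    [/\ b \in Phi, orth s b, maximal s b & cascade (b :: s) l']
  else forall a, a \in Phi -> ~~ orth s a.

Lemma cascade_exists s : exists l, cascade s l.
Proof.
move: {2}(count (orth s) Phi).+1 (ltnSn (count (orth s) Phi)) => m.
elim: m s => // m IH s le.
have [/hasP[a0 a0P sa0]|/hasPn] := boolP (has (orth s) Phi); last by exists [::].
have [b [bP sb mb]] : exists b, [/\ b \in Phi, orth s b & maximal s b].
  pose S := [seq a <- Phi | orth s a].
  have : S != [::] by apply: contraTneq a0P => S0; apply/negP => a0P; have := mem_filter (orth s) a0 Phi; rewrite -/S S0 sa0 a0P.
  have SP a : (a \in S) = orth s a && (a \in Phi) by rewrite mem_filter.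
  suff H (T : seq V) : T != [::] -> exists2 b, b \in T & forall a, a \in T -> (ht a <= ht b)%R.
    move=> /H[b]; rewrite SP => /andP[sb bP] mb; exists b; split=> // a aP sa.
    by apply: mb; rewrite SP sa.
  elim: T => // x T IHT _; have [->|/IHT[b bT mb]] := eqVneq T [::].
    by exists x; rewrite ?mem_head // => a; rewrite inE => /eqP->.
  have [le_xb|lt_bx] := leP (ht x) (ht b).
    by exists b; rewrite ?inE ?bT ?orbT // => a; rewrite inE => /orP[/eqP->|/mb].
  exists x; rewrite ?mem_head // => a; rewrite inE => /orP[/eqP->//|/mb h].
  exact: le_trans h (ltW lt_bx).
have [|l cl] := IH (b :: s); last by exists (b :: l).
rewrite -ltnS; apply: leq_trans le; rewrite ltnS.
have -> : count (orth (b :: s)) Phi = count (fun a => c a b == 0) (filter (orth s) Phi).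
  by rewrite count_filter; apply: eq_count => a.
rewrite -(size_filter (orth s)) ltn_neqAle count_size andbT -all_count.
apply/negP => /allP/(_ b).
by rewrite mem_filter sb bP c2 // => /(_ isT); rewrite (pcharf0P K).1.
Qed.

Variables (bs : seq V) (bs_cascade : cascade [::] bs).

Lemma cascade_split s l1 b l2 : cascade s (l1 ++ b :: l2) ->
  [/\ b \in Phi, orth (l1 ++ s) b & maximal (l1 ++ s) b].
Proof.
elim: l1 s => [|a l1 IH] s; first by case.
rewrite !cat_cons => -[_ _ _ /IH[bP sb mb]].
have e d : orth (a :: l1 ++ s) d = orth (l1 ++ a :: s) d.
  by apply: eq_all_r => x; rewrite !(mem_cat, inE) orbCA.
split=> [|| d dP sd] //; first by rewrite e.
by apply: mb; rewrite // -e.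
Qed.

Lemma bs_split l1 b l2 : bs = l1 ++ b :: l2 ->
  [/\ b \in Phi, orth l1 b & maximal l1 b].
Proof. by move=> e; have := bs_cascade; rewrite e => /cascade_split; rewrite cats0. Qed.

Lemma bs_root b : b \in bs -> b \in Phi.
Proof. by case/mem_cat_split => l1 [l2 /bs_split[]]. Qed.

(** The first member not orthogonal to a is the one at which [maximal_cases] applies to a and
    decides the sign of a pairing. *)
Lemma bs_first a : a \in Phi -> exists l1 b l2, [/\ bs = l1 ++ b :: l2, orth l1 a & c a b != 0].
Proof.
move=> aP.
have : ~~ orth bs a.
  suff H s l : cascade s l -> orth s a -> ~~ orth l a by exact: (H _ _ bs_cascade).
  elim: l s => [|b l IH] s /=; first by move/(_ _ aP)/negbTE->.
  case=> _ _ _ /IH H sa; apply/negP => /andP[ab la].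
  by have := H _; rewrite /= ab sa la => /(_ isT).
elim: bs => //= b l IH.
have [ab|ab] := eqVneq (c a b) 0; last by exists [::], b, l.
case/IH=> l1 [b1 [l2 [e o1 n1]]]; exists (b :: l1), b1, l2.
by split; rewrite ?e //= ab eqxx.
Qed.

Lemma bs_orth l1 b l2 d : bs = l1 ++ b :: l2 -> d \in l1 -> c b d = 0 /\ c d b = 0.
Proof.
move=> e dl; have [bP /allP/(_ d dl)/eqP bd _] := bs_split e; split=> //.
have dP : d \in Phi by apply: bs_root; rewrite e mem_cat dl.
have /eqP := c_sym bP dP; rewrite bd mul0r eq_sym mulf_eq0 => /orP[/eqP//|].
by rewrite (pcharf0P K).1 // (negbTE (n_neq0 dP)).
Qed.

Lemma bs_uniq : uniq bs.
Proof.
have H l1 l2 : bs = l1 ++ l2 -> uniq l1.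
  elim/last_ind: l1 l2 => // l1 b IH l2; rewrite cat_rcons => e.
  rewrite rcons_uniq (IH _ e) andbT; apply/negP => bl.
  have [bb _] := bs_orth e bl; have [bP _ _] := bs_split e.
  by move/eqP: bb; rewrite c2 // (pcharf0P K).1.
by apply: (H _ [::]); rewrite cats0.
Qed.

Lemma bs_ortho b d : b \in bs -> d \in bs -> b != d -> c b d = 0.
Proof.
case/mem_cat_split => l1 [l2 E]; rewrite [in X in X -> _]E mem_cat inE => /or3P[dl|/eqP->|dl] ne.
- by have [] := bs_orth E dl.
- by rewrite eqxx in ne.
case/mem_cat_split: dl => l3 [l4 E2].
have e2 : bs = (l1 ++ b :: l3) ++ d :: l4 by rewrite E E2 -catA.
by have [] := bs_orth e2 (d := b); rewrite ?mem_cat ?mem_head ?orbT.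
Qed.

(* The product of the commuting reflections in the roots of bs. *)
Definition bs_reflect a := a - \sum_(b <- bs) c a b *: b.

Lemma c_bs_reflect a d : d \in bs -> c (bs_reflect a) d = - c a d.
Proof.
move=> db; rewrite pairingD pairingN pairing_sum (bigD1_seq d) ?bs_uniq //= pairingZ c2 ?bs_root //.
rewrite big_seq_cond big1 => [|b /andP[bb bd]]; last by rewrite pairingZ (bs_ortho bb db bd) mulr0.
rewrite addr0; ring.
Qed.

Definition sref a b := b - c b a *: a.
Hypothesis sref_root : forall a b, a \in Phi -> b \in Phi -> sref a b \in Phi.
Hypothesis coroot_sref : forall a b d, a \in Phi -> b \in Phi ->
  c d (sref a b) = c d b - c a b * c d a.

Definition sact (l : seq V) v := foldr sref v l.

Lemma sact_root l a : {subset l <= Phi} -> a \in Phi -> sact l a \in Phi.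
Proof.
elim: l => //= b l IH sub aP; apply: sref_root; first by apply: sub; rewrite mem_head.
by apply: IH aP => d dl; apply: sub; rewrite inE dl orbT.
Qed.

Lemma sact_bs l1 l2 a : bs = l1 ++ l2 -> sact l2 a = a - \sum_(b <- l2) c a b *: b.
Proof.
elim: l2 l1 => [|b l2 IH] l1 e; first by rewrite big_nil subr0.
have e1 : bs = rcons l1 b ++ l2 by rewrite cat_rcons.
have z : \sum_(d <- l2) c (c a d *: d) b = 0.
  rewrite big_seq big1 // => d dl; rewrite pairingZ.
  have db : d \in bs by rewrite e1 mem_cat dl orbT.
  have bb : b \in bs by rewrite e1 mem_cat mem_rcons mem_head.
  have ne : d != b.
    have := bs_uniq; rewrite e1 cat_uniq => /and3P[_ /hasPn/(_ d dl) h _].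
    by apply: contraNneq h => ->; rewrite /= mem_rcons mem_head.
  by rewrite (bs_ortho db bb ne) mulr0.
rewrite /= (IH _ e1) big_cons /sref pairingD pairingN pairing_sum z.
by rewrite oppr0 addr0 [X in _ = _ - X]addrC opprD addrA.
Qed.

Lemma bs_reflect_root a : a \in Phi -> bs_reflect a \in Phi.
Proof.
move=> aP; rewrite /bs_reflect -(@sact_bs [::]) //; apply: sact_root => //.
exact: bs_root.
Qed.

(** Let b be the first member not orthogonal to a. Positive roots orthogonal to the members before b
    pair with b to 0, 1 or 2. The reflection product keeps that orthogonality and negates the
    nonzero pairing of a with b, so its value at a is not positive. *)
Lemma bs_reflect_neg a : a \in Phi -> pos a -> pos (- bs_reflect a).
Proof.
move=> aP pa; have [l1 [b [l2 [e o1 ab]]]] := bs_first aP.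
have [bP sb mb] := bs_split e; have wP := bs_reflect_root aP.
have bb : b \in bs by rewrite e mem_cat mem_head orbT.
apply: posN => //; apply/negP => pw.
have ow : orth l1 (bs_reflect a).
  apply/allP => d dl; rewrite c_bs_reflect ?oppr_eq0; first exact: (allP o1).
  by rewrite e mem_cat dl.
have kk m l : c a b = m.+1%:R -> c (bs_reflect a) b = l%:R -> False.
  move=> e1 e2; have /eqP : c a b + c (bs_reflect a) b = 0 by rewrite c_bs_reflect // subrr.
  by rewrite e1 e2 -natrD (pcharf0P K).1.
have [l el] : exists l, c (bs_reflect a) b = l%:R.
  have [->|->|[-> _ _ _]] := maximal_cases bP sb mb wP ow pw.
  - by exists 0%N.
  - by exists 2%N; exact: c2.
  - by exists 1%N.
have [a0|ea|[a1 _ _ _]] := maximal_cases bP sb mb aP o1 pa; last exact: (kk 0%N l).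
  by rewrite a0 eqxx in ab.
by apply: (kk 1%N l) => //; rewrite ea; exact: c2.
Qed.

Lemma sref_lin a x y k : sref a (k *: x + y) = k *: sref a x + sref a y.
Proof. by rewrite /sref pairingD pairingZ scalerBr scalerDl scalerA opprD addrACA. Qed.

Lemma srefK a v : a \in Phi -> sref a (sref a v) = v.
Proof.
move=> aP; rewrite /sref pairingD pairingN pairingZ c2 // -addrA -opprD -scalerDl.
have -> : c v a + (c v a - c v a * 2%:R) = 0 by ring.
by rewrite scale0r subr0.
Qed.

Lemma sref_conj a b v : a \in Phi -> b \in Phi ->
  sref (sref a b) (sref a v) = sref a (sref b v).
Proof.
move=> aP bP; rewrite {1}/sref coroot_sref //.
have -> : c (sref a v) b - c a b * c (sref a v) a = c v b.
  rewrite /sref !pairingD !pairingN !pairingZ c2 //; ring.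
have -> : sref b v = (- c v b) *: b + v by rewrite /sref scaleNr addrC.
by rewrite sref_lin scaleNr addrC.
Qed.

Lemma sact_conj l b v : {subset l <= Phi} -> b \in Phi ->
  sref (sact l b) (sact l v) = sact l (sref b v).
Proof.
elim: l => //= a l IH sub bP.
have sub' : {subset l <= Phi} by move=> d dl; apply: sub; rewrite inE dl orbT.
rewrite sref_conj ?IH //; first by apply: sub; rewrite mem_head.
exact: sact_root.
Qed.

Lemma sact_cat l1 l2 v : sact (l1 ++ l2) v = sact l1 (sact l2 v).
Proof. exact: foldr_cat. Qed.

(** * Words in simple reflections *)

Variables (Delta : seq V) (co : nat -> V -> K).
Hypothesis Delta_root : {subset Delta <= Phi}.
Hypothesis Delta_pos : forall d, d \in Delta -> pos d.
Hypothesis co_lin : forall i, linear_for *%R (co i).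
Hypothesis co_Delta : forall i j, (i < size Delta)%N -> (j < size Delta)%N ->
  co i Delta`_j = (i == j)%:R.
Hypothesis pos_comb : forall a, a \in Phi -> pos a ->
  exists m : nat -> nat, a = \sum_(i < size Delta) Delta`_i *+ m i.
Hypothesis Phi_mult : forall a m, a \in Phi -> a *+ m \in Phi -> m = 1%N.

Lemma coeffD i a b : co i (a + b) = co i a + co i b.
Proof. by have := co_lin i 1 a b; rewrite scale1r mul1r. Qed.
Lemma coeff0 i : co i 0 = 0.
Proof. by apply: (addrI (co i 0)); rewrite -coeffD !addr0. Qed.
Lemma coeffZ i k a : co i (k *: a) = k * co i a.
Proof. by have := co_lin i k a 0; rewrite !addr0 coeff0 addr0. Qed.
Lemma coeff_comb i (m : nat -> nat) : (i < size Delta)%N ->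
  co i (\sum_(j < size Delta) Delta`_j *+ m j) = (m i)%:R.
Proof.
move=> li; rewrite (big_morph (co i) (coeffD i) (coeff0 i)) (bigD1 (Ordinal li)) //=.
rewrite -scaler_nat coeffZ co_Delta // eqxx mulr1 big1 ?addr0 // => j ne.
by rewrite -scaler_nat coeffZ co_Delta // eq_sym (negbTE (_ : j != i :> nat)) ?mulr0.
Qed.

(** The reflection changes only the coefficient at d. If its image of a were negative, all other
    coefficients of a would be 0, and a, a multiple of d, would be d. *)
Lemma simple_perm d a : d \in Delta -> a \in Phi -> pos a -> a != d -> pos (sref d a).
Proof.
move=> dD aP pa ad; have dP := Delta_root dD; apply/negPn/negP => np.
have sP : sref d a \in Phi by exact: sref_root.
have [m em] := pos_comb aP pa.
have [m' em'] := pos_comb (PhiN sP) (posN sP np).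
have [j lj ej] := nthP 0 dD.
have mi i : (i < size Delta)%N -> i != j -> m i = 0%N.
  move=> li ij; have := coeff_comb m' li; rewrite -em' /sref opprB coeffD coeffZ -scaleN1r coeffZ.
  rewrite -ej co_Delta // (negbTE ij) mulr0 add0r em coeff_comb // mulN1r => /eqP.
  by rewrite eq_sym -addr_eq0 -natrD (pcharf0P K).1 // addn_eq0 => /andP[_ /eqP].
have aE : a = d *+ m j.
  rewrite em (bigD1 (Ordinal lj)) //= ej big1 ?addr0 // => i ne.
  by rewrite mi ?mulr0n.
have m1 : m j = 1%N by apply: Phi_mult dP _; rewrite -aE.
by case/eqP: ad; rewrite aE m1.
Qed.

Lemma pairing_int a b : a \in Phi -> b \in Phi -> exists z : int, c a b = z%:~R.
Proof.
move=> aP bP; have [->|ab] := eqVneq a b; first by exists 2; rewrite c2.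
have [->|anb] := eqVneq a (- b); first by exists (- 2); rewrite pairingN c2 // rmorphN.
by have [p [q [-> _ _ _]]] := string bP aP ab anb; exists (p%:Z - q%:Z); rewrite rmorphB.
Qed.

(** With natural multipliers [c_sym] becomes an identity between integers, which carries the sign;
    this is why the symmetrizer takes values in [nat]. *)
Lemma pairing_pos a b z y : a \in Phi -> b \in Phi -> c a b = z%:~R -> c b a = y%:~R ->
  (0 < z)%R -> (0 < y)%R.
Proof.
move=> aP bP ez ey z0; have := c_sym aP bP; rewrite ez ey !pmulrn -!rmorphM /=.
move/(intr_inj_char0 charK) => e.
have na : (0 < (n a)%:Z)%R by rewrite ltz_nat lt0n n_neq0.
have nb : (0 < (n b)%:Z)%R by rewrite ltz_nat lt0n n_neq0.
by rewrite -(pmulr_lgt0 _ nb) -e pmulr_lgt0.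
Qed.

(** Otherwise c a a, expanded along the simple roots, would be minus a natural number instead of
    2. *)
Lemma simple_descent a : a \in Phi -> pos a -> exists d z,
  [/\ d \in Delta, c a d = z%:~R & (0 < z)%R].
Proof.
move=> aP pa; apply: NNPP => no; have [m em] := pos_comb aP pa.
have H N : (N <= size Delta)%N ->
    exists l : nat, c (\sum_(0 <= i < N) Delta`_i *+ m i) a = - l%:R.
  elim: N => [|N IH] le; first by exists 0%N; rewrite big_nil pairing0 oppr0.
  have [l el] := IH (ltnW le); have dD : Delta`_N \in Delta by exact: mem_nth.
  have dP := Delta_root dD.
  have [z ez] := pairing_int dP aP; have [y ey] := pairing_int aP dP.
  have z0 : (z <= 0)%R.
    rewrite leNgt; apply/negP => z0; apply: no; exists Delta`_N, y; split=> //.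
    exact: (pairing_pos dP aP ez ey z0).
  exists (l + m N * `|z|)%N; rewrite big_nat_recr //= pairingD el -scaler_nat pairingZ ez natrD natrM opprD.
  congr (_ + _); rewrite -mulrN; congr (_ * _).
  by case: z z0 {ez} => [[|n0]|n0] //= _; rewrite ?mulr0z ?oppr0 // NegzE mulrNz.
have [l el] := H _ (leqnn _); rewrite big_mkord -em in el.
by move/eqP: el; rewrite c2 // -addr_eq0 -natrD (pcharf0P K).1.
Qed.

(** Induction on height. For a not simple, a simple d pairing positively with a gives a lower
    positive root s_d(a), and s_a is s_d conjugating the reflection in it. *)
Lemma sref_word a : a \in Phi -> pos a ->
  exists2 l, {subset l <= Delta} & forall v, sref a v = sact l v.
Proof.
move=> aP pa; move: {2}(`|ht a|%N).+1 (ltnSn `|ht a|%N) => N.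
elim: N a aP pa => // N IH a aP pa le.
have [aD|aD] := boolP (a \in Delta).
  by exists [:: a] => // d; rewrite inE => /eqP->.
have [d [z [dD ez z0]]] := simple_descent aP pa.
have dP := Delta_root dD; have ad : a != d by apply: contraNneq aD => ->.
have a'P : sref d a \in Phi by exact: sref_root.
have pa' := simple_perm dD aP pa ad.
have hta' : ht (sref d a) = ht a - z * ht d.
  have e : sref d a = a + d *~ (- z) by rewrite /sref ez scaler_int mulrNz.
  by rewrite e ht_lin // -?e // mulNr.
have [|l lD el] := IH (sref d a) a'P pa'.
  rewrite -ltnS; apply: leq_trans le; rewrite ltnS.
  have lt : (ht (sref d a) < ht a)%R.
    by rewrite hta' gtrDl oppr_lt0 mulr_gt0 //; exact: Delta_pos.
  by rewrite -ltz_nat !gtz0_abs.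
exists (d :: rcons l d).
  by move=> x; rewrite inE mem_rcons inE orbA orbb => /orP[/eqP->|/lD].
move=> v; rewrite -cats1 /= sact_cat /= -el.
by rewrite sref_conj // srefK.
Qed.

(** Reading the word from the right, d is the letter that first makes the image of a negative; by
    [simple_perm] that image was d itself. *)
Lemma exchange l a : {subset l <= Delta} -> a \in Phi -> pos a -> ~~ pos (sact l a) ->
  exists l1 d l2, l = l1 ++ d :: l2 /\ sact l2 a = d.
Proof.
elim: l => [|d l IH] sub aP pa /=; first by rewrite pa.
have sub' : {subset l <= Delta} by move=> x xl; apply: sub; rewrite inE xl orbT.
have [pl|npl] := boolP (pos (sact l a)); last first.
  have [l1 [d' [l2 [-> e]]]] := IH sub' aP pa npl.
  by exists (d :: l1), d', l2.
have dD : d \in Delta by apply: sub; rewrite mem_head.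
have lP : sact l a \in Phi by apply: sact_root => // x /sub'; exact: Delta_root.
move=> ns; exists [::], d, l; split=> //; apply/eqP/negPn/negP => ne.
by case/negP: ns; exact: simple_perm.
Qed.

(** The rest of the word sends its last letter d to a negative root, so [exchange] finds a letter d'
    that is the image of d under what lies between them. The reflections in d' and d then cancel,
    and the word loses two letters. *)
Lemma deletion l : {subset l <= Delta} ->
  (forall a, a \in Phi -> pos a -> pos (sact l a)) -> forall v, sact l v = v.
Proof.
move: {2}(size l).+1 (ltnSn (size l)) => N; elim: N l => // N IH l.
case/lastP: l => // l d; rewrite size_rcons ltnS => lN sub lpos v.
have dD : d \in Delta by apply: sub; rewrite mem_rcons mem_head.
have sub' : {subset l <= Delta} by move=> x xl; apply: sub; rewrite mem_rcons inE xl orbT.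
have dP := Delta_root dD.
have sN a : sact l (- a) = - sact l a.
  elim: (l) => //= b s IHs; rewrite IHs /sref pairingN scaleNr opprK opprB addrC //.
have ldP : sact l d \in Phi by apply: sact_root => // x /sub'; exact: Delta_root.
have npl : ~~ pos (sact l d).
  have := lpos _ dP (Delta_pos dD); rewrite -cats1 sact_cat /=.
  rewrite {1}/sref c2 // scaler_nat mulr2n opprD addrA subrr add0r sN.
  by rewrite /pos htN // oppr_gt0 => h; rewrite -leNgt ltW.
have [l1 [d' [l2 [e e2]]]] := exchange sub' dP (Delta_pos dD) npl.
have sub2 : {subset l2 <= Phi}.
  by move=> x xl; apply/Delta_root/sub'; rewrite e mem_cat inE xl !orbT.
have -> : sact (rcons l d) v = sact (l1 ++ l2) v.
  rewrite -cats1 e !sact_cat /= -{1}e2 sact_conj // srefK //.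
apply: IH.
- by move: lN; rewrite e !size_cat /= addnS; exact: ltnW.
- move=> x; rewrite mem_cat => h; apply: sub'; rewrite e mem_cat inE.
  by case/orP: h => ->; rewrite ?orbT.
move=> a aP pa; have := lpos a aP pa.
by rewrite -cats1 e !sact_cat /= -{1}e2 sact_conj // srefK.
Qed.

Lemma bs_pos b : b \in bs -> pos b.
Proof.
case/mem_cat_split => l1 [l2 /bs_split[bP ob mb]].
have := mb _ (PhiN bP) (orthN ob); rewrite htN // lerNl -subr_ge0 opprK.
by rewrite -mulr2n pmulrn_lge0 // /pos le_eqVlt eq_sym (negbTE (ht0 bP)).
Qed.

(** w_0 followed on the right by the cascade product is a word in simple reflections that preserves
    positivity, hence trivial by [deletion]. This stands in for the uniqueness of the longest
    element. *)
Lemma bs_reflect_opp l0 : {subset l0 <= Delta} ->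
  (forall a, a \in Phi -> sact l0 a = - a) -> forall a, a \in Phi -> bs_reflect a = - a.
Proof.
move=> l0D l0N a aP.
have [lw lwD lwE] : exists2 l, {subset l <= Delta} & forall v, sact l v = sact bs v.
  have : forall b, b \in bs -> b \in Phi /\ pos b by move=> b bb; rewrite bs_root ?bs_pos.
  elim: bs => [|b s IH] sP; first by exists [::].
  have [bP pb] := sP b (mem_head _ _).
  have [x xs|l lD lE] := IH; first by apply: sP; rewrite inE xs orbT.
  have [l' l'D l'E] := sref_word bP pb.
  exists (l' ++ l); first by move=> x; rewrite mem_cat => /orP[/l'D|/lD].
  by move=> v; rewrite sact_cat lE /= l'E.
have wE v : sact lw v = bs_reflect v by rewrite lwE (@sact_bs [::]).
have := @deletion (l0 ++ lw) _ _ a; rewrite sact_cat wE l0N ?bs_reflect_root //.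
move=> H; rewrite -[LHS]opprK H //.
  by move=> x; rewrite mem_cat => /orP[/l0D|/lwD].
move=> d dP pd; rewrite sact_cat wE l0N ?bs_reflect_root //.
exact: bs_reflect_neg.
Qed.

(** If b' came before b, d would pair with b' to 2, forcing d = b' and a = 0. If b' came after b,
    the pairings of a and d with b would add up to 0, although that of a is positive and that of d
    is not negative. *)
Lemma bs_sum l1 b l2 a d b' : bs = l1 ++ b :: l2 -> a \in Phi -> pos a -> orth l1 a ->
  c a b != 0 -> d \in Phi -> pos d -> b' \in bs -> a + d = b' -> b' = b.
Proof.
move=> e aP pa oa ab dP pd bb' eb.
have dE : d = b' - a by rewrite -eb addrC addKr.
have [bP ob mb] := bs_split e.
have nat_neq m : m.+1%:R != 0 :> K by rewrite (pcharf0P K).1.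
have := bb'; rewrite e mem_cat inE => /or3P[bl|/eqP//|bl].
  have [l3 [l4 e1]] := mem_cat_split bl.
  have e2 : bs = l3 ++ b' :: (l4 ++ b :: l2) by rewrite e e1 -catA.
  have [b'P ob' mb'] := bs_split e2.
  have oa3 : orth l3 a by move: oa; rewrite e1 /orth all_cat => /andP[].
  have ab' : c a b' = 0 by apply/eqP/(allP oa).
  have db' : c d b' = 2%:R by rewrite dE pairingD pairingN ab' oppr0 addr0 c2.
  have od : orth l3 d by rewrite dE orthD ?orthN.
  have [h|h|[h _ _ _]] := maximal_cases b'P ob' mb' dP od pd.
  - by have := nat_neq 1%N; rewrite -db' h eqxx.
  - by have := Phi0 aP; rewrite -(addrK d a) eb h subrr eqxx.
  - have := nat_neq 0%N; have : (2%:R : K) = 1 by rewrite -db'.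
    by rewrite -[2%:R]/(1 + 1) -[X in _ = X]addr0 => /addrI->; rewrite eqxx.
have [l3 [l4 e1]] := mem_cat_split bl.
have e2 : bs = (l1 ++ b :: l3) ++ b' :: l4 by rewrite e e1 -catA.
have [b'P ob' _] := bs_split e2.
have [ob1 b'b] : orth l1 b' /\ c b' b = 0.
  by move: ob'; rewrite /orth all_cat /= => /and3P[? /eqP ? _].
have od : orth l1 d by rewrite dE orthD ?orthN.
have sum0 : c d b + c a b = 0 by rewrite dE pairingD pairingN b'b; ring.
have natc x : x \in Phi -> orth l1 x -> pos x -> c x b != 0 -> exists m, c x b = m.+1%:R.
  move=> xP ox px xb; have [h|h|[h _ _ _]] := maximal_cases bP ob mb xP ox px.
  - by rewrite h eqxx in xb.
  - by exists 1%N; rewrite h c2.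
  - by exists 0%N.
have [m em] := natc _ aP oa pa ab.
have db : c d b != 0 by move/eqP: sum0; rewrite addr_eq0 => /eqP->; rewrite oppr_eq0.
have [m' em'] := natc _ dP od pd db.
by move/eqP: sum0; rewrite em em' -natrD (pcharf0P K).1.
Qed.

(** The partner is b - a for the first b not orthogonal to a; a and d both pair with b to 1, so
    [bs_sum] applies to d. The two facts on d and b are what [lie_rvec_neq0] asks for. *)
Lemma bs_partner a : a \in Phi -> pos a -> a \notin bs -> exists b d,
  [/\ [/\ b \in bs, d \in Phi & pos d], d + a = b, c d b != 0, b + d \notin Phi
    & forall b' a', b' \in bs -> a' \in Phi -> pos a' -> d + a' = b' -> b' = b].
Proof.
move=> aP pa abs; have [l1 [b [l2 [e oa ab]]]] := bs_first aP.
have [bP ob mb] := bs_split e.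
have bb : b \in bs by rewrite e mem_cat mem_head orbT.
have [h|h|[cab dP pd _]] := maximal_cases bP ob mb aP oa pa.
- by rewrite h eqxx in ab.
- by rewrite h bb in abs.
have od : orth l1 (b - a) by rewrite orthD ?orthN.
have cd : c (b - a) b = 1 by rewrite pairingD pairingN cab c2 //; ring.
have cd0 : c (b - a) b != 0 by rewrite cd oner_neq0.
exists b, (b - a); split=> //; first by rewrite subrK.
  have [h|h|[_ _ _ //]] := maximal_cases bP ob mb dP od pd.
    by rewrite h eqxx in cd0.
  by have := Phi0 aP; rewrite -oppr_eq0 -(addrK b (- a)) [- a + b]addrC h subrr eqxx.
move=> b' a' bb' a'P pa' eb; exact: (bs_sum e dP pd od cd0 a'P pa' bb' eb).
Qed.

Lemma bs_sum_bs b b' d : b \in bs -> b' \in bs -> d \in Phi -> pos d -> b + d != b'.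
Proof.
move=> bb bb' dP pd; apply/eqP => eb.
have [l1 [l2 e]] := mem_cat_split bb; have [bP ob mb] := bs_split e.
have cb0 : c b b != 0 by rewrite c2 // (pcharf0P K).1.
have bE := bs_sum e bP (bs_pos bb) ob cb0 dP pd bb' eb.
by have := Phi0 dP; rewrite -(addKr b d) eb bE addNr eqxx.
Qed.

End RootSystem.

(** * A nondegenerate form on the Borel subalgebra *)

Section Frobenius.
Variables (K : fieldType) (charK : [pchar K] =i pred0).
Variables (g : lieAlgType K) (h : {vspace g}).
Local Notation "'h^*'" := (dual K (subvs_of h)).
Variables (R0 : seq h^*) (gw : h^* -> {vspace g}).
Hypothesis ws : weight_system R0 gw.
Hypothesis h_cartan : cartan_subalgebra h.
Hypothesis g_simple : lie_simple g.
Variable Delta : seq h^*.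
Hypothesis Delta_base : root_base Delta.
Variable w0 : 'End(h^*).
Hypothesis w0_longest : longest_element Delta w0.
Hypothesis w0_opp : minus_id_on_roots w0.
Implicit Types (x y z : g) (t : subvs_of h) (alpha beta gamma delta : h^*).
Local Notation Phi := (Phi R0).
Local Notation rvec := (rvec gw).

Let h0 : gw 0 = h := gw0E ws h_cartan.
Let n0 := natr_neq0 charK.
Let isrootP := Phi_rootP charK ws h_cartan g_simple.

Let Delta_free : free Delta. Proof. by case: Delta_base. Qed.

Lemma Delta_Phi : {subset Delta <= Phi}.
Proof. by move=> d dD; apply/isrootP; case: Delta_base => _ H _; exact: H. Qed.

(** A left inverse of the cast from [int], with the junk value 0 off its image: heights and Killing
    norms are computed in K but compared as integers. *)
Definition zof (k : K) : int :=
  if excluded_middle_informative (exists z : int, k = z%:~R) is left p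
  then proj1_sig (constructive_indefinite_description _ p) else 0.

Lemma zofK (z : int) : zof z%:~R = z.
Proof.
rewrite /zof; case: excluded_middle_informative => [p|[]]; last by exists z.
by case: constructive_indefinite_description => z' /= e; apply: (intr_inj_char0 charK).
Qed.

Definition nof (k : K) : nat := `|zof k|.

Lemma nofK m : nof m%:R = m.
Proof. by rewrite /nof pmulrn zofK. Qed.

Definition co i alpha : K :=
  if insub i is Some j then coord (in_tuple Delta) (j : 'I_(size Delta)) alpha else 0.

Lemma co_linear i : linear_for *%R (co i).
Proof.
move=> k a b; rewrite /co; case: insub => [j|]; first by rewrite linearP.
by rewrite mulr0 addr0.
Qed.

Lemma co_delta i j : (i < size Delta)%N -> (j < size Delta)%N -> co i Delta`_j = (i == j)%:R.
Proof.
move=> li lj; rewrite /co insubT.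
by rewrite (@coord_free _ _ _ (in_tuple Delta) (Ordinal lj) (Sub i li) Delta_free) eq_sym.
Qed.

Definition height alpha : int := zof (\sum_(i < size Delta) co i alpha).

Lemma sum_co_linear : linear_for *%R (fun alpha => \sum_(i < size Delta) co i alpha).
Proof.
move=> k a b; rewrite mulr_sumr -big_split /=; apply: eq_bigr => i _; exact: co_linear.
Qed.

Lemma sum_coZ k alpha : \sum_(i < size Delta) co i (k *: alpha) = k * \sum_(i < size Delta) co i alpha.
Proof.
have z : \sum_(i < size Delta) co i 0 = 0.
  by apply: (addrI (\sum_(i < size Delta) co i 0)); have := sum_co_linear 1 0 0;
    rewrite scale1r addr0 mul1r addr0 => <-.
by have := sum_co_linear k alpha 0; rewrite addr0 z addr0.
Qed.

Lemma sum_co_comb (m : nat -> nat) :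
  \sum_(i < size Delta) co i (\sum_(j < size Delta) Delta`_j *+ m j) =
  (\sum_(j < size Delta) m j)%N%:R.
Proof.
rewrite natr_sum; apply: eq_bigr => i _.
exact: (@coeff_comb _ _ Delta co co_linear co_delta).
Qed.

Lemma root_comb alpha : alpha \in Phi -> exists m : nat -> nat, exists e : bool,
  alpha = (-1) ^+ e *: (\sum_(j < size Delta) Delta`_j *+ m j).
Proof.
move=> /isrootP aP; case: Delta_base => _ _ /(_ _ aP)[[m em]|[m em]]; exists m.
  by exists false; rewrite scale1r.
by exists true; rewrite -em expr1 scaleN1r opprK.
Qed.

Lemma heightE alpha : alpha \in Phi -> \sum_(i < size Delta) co i alpha = (height alpha)%:~R.
Proof.
move=> aP; have [m [e eq]] := root_comb aP.
suff [z ez] : exists z : int, \sum_(i < size Delta) co i alpha = z%:~R by rewrite /height ez zofK.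
exists ((-1) ^+ e * (\sum_(j < size Delta) m j)%N%:Z).
by rewrite eq sum_coZ sum_co_comb rmorphM rmorphXn rmorphN1.
Qed.

Lemma height_lin alpha beta (k : int) : alpha \in Phi -> beta \in Phi ->
  alpha + beta *~ k \in Phi -> height (alpha + beta *~ k) = height alpha + k * height beta.
Proof.
move=> aP bP abP; apply: (intr_inj_char0 charK); rewrite rmorphD rmorphM /= -!heightE //.
by rewrite addrC -scaler_int sum_co_linear addrC.
Qed.

Lemma height_neq0 alpha : alpha \in Phi -> height alpha != 0.
Proof.
move=> aP; rewrite -(intr_eq0_char0 charK) -heightE //.
have [m [e eq]] := root_comb aP.
rewrite eq sum_coZ sum_co_comb mulf_neq0 ?signr_eq0 // n0 //; apply/negP.
rewrite sum_nat_eq0 => /forallP m0; have := Phi_neq0 aP.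
rewrite eq big1 ?scaler0 ?eqxx // => j _; have /eqP-> := implyP (m0 j) isT.
by rewrite mulr0n.
Qed.

Lemma pos_comb alpha : alpha \in Phi -> pos height alpha ->
  exists m : nat -> nat, alpha = \sum_(j < size Delta) Delta`_j *+ m j.
Proof.
move=> aP pa; have [m [[] eq]] := root_comb aP; exists m; last by rewrite eq expr0 scale1r.
have : (height alpha <= 0)%R.
  suff -> : height alpha = - (\sum_(j < size Delta) m j)%N%:Z by rewrite oppr_le0.
  apply: (intr_inj_char0 charK); rewrite /= -heightE // rmorphN /= -pmulrn -sum_co_comb.
  by rewrite eq sum_coZ expr1 mulN1r.
by rewrite leNgt [(_ < _)%R]pa.
Qed.

Lemma pos_rootP alpha : pos_root Delta alpha <-> (alpha \in Phi) /\ pos height alpha.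
Proof.
split=> [[/isrootP aP [m em]]|[aP pa]]; last by split; [exact/isrootP | exact: pos_comb].
split=> //; rewrite /pos lt_neqAle eq_sym height_neq0 //=.
suff -> : height alpha = (\sum_(j < size Delta) m j)%N%:Z by [].
by apply: (intr_inj_char0 charK); rewrite /= -heightE // em sum_co_comb.
Qed.

Lemma Delta_pos delta : delta \in Delta -> pos height delta.
Proof.
move=> dD; apply: (proj2 ((pos_rootP delta).1 _)); split.
  by case: Delta_base => _ H _; exact: H.
have [j lj ej] := nthP 0 dD; exists (fun i => (i == j) : nat).
rewrite (bigD1 (Ordinal lj)) //= eqxx mulr1n ej big1 ?addr0 // => i ne.
by rewrite (_ : (i == j :> nat) = false) ?mulr0n //; apply/negbTE.
Qed.

Lemma w0_word : exists2 l, {subset l <= Delta} & forall v, w0 v = sact (@cartan K g h) l v.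
Proof.
case: w0_longest => _ [n1 [[ss [_ ssD ->]] _] _].
elim: ss ssD => [|s ss IH] ssD; first by exists [::] => // v; rewrite id_lfunE.
have [s' s's|l lD lE] := IH; first by apply: ssD; rewrite inE s's orbT.
have [alpha aD [H aH sE]] := ssD s (mem_head _ _).
exists (alpha :: l) => [x|v]; first by rewrite inE => /orP[/eqP->|/lD].
rewrite /= comp_lfunE lE sE /sref.
by have -> := coroot_uniq charK ws h_cartan g_simple (Delta_Phi aD) aH.
Qed.

Lemma w0_Phi alpha : alpha \in Phi -> w0 alpha = - alpha.
Proof.
move=> aP; apply: (w0_opp (E := <<Phi>>%VS)); last exact: memv_span.
move=> W; split=> [/span_subvP sub beta /isrootP|sub]; first exact: sub.
by apply/span_subvP => beta /isrootP; exact: sub.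
Qed.

(** N is the Killing square of the coroot, a sum of squares of integers weighted by dimensions. Each
    side is twice the Killing product of the two coroots. *)
Lemma cartan_sym_nat : exists N : h^* -> nat, (forall alpha, alpha \in Phi -> N alpha != 0%N) /\
  forall alpha beta, alpha \in Phi -> beta \in Phi ->
    cartan alpha beta * (N alpha)%:R = cartan beta alpha * (N beta)%:R.
Proof.
have cz alpha beta : alpha \in Phi -> beta \in R0 -> exists z : int, cartan beta alpha = z%:~R.
  move=> aP bR; have [->|b0] := eqVneq beta 0; first by exists 0; rewrite /cartan zero_lfunE.
  have bP : beta \in Phi by rewrite mem_Phi b0.
  have a2 := cartan_id charK ws h_cartan g_simple aP.
  have [->|ba] := eqVneq beta alpha; first by exists 2; rewrite a2.
  have [->|bna] := eqVneq beta (- alpha); first by exists (- 2); rewrite cartanN a2 rmorphN.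
  have [p [q [-> _ _ _]]] := cartan_string charK ws h_cartan g_simple aP bP ba bna.
  by exists (p%:Z - q%:Z); rewrite rmorphB.
pose kk alpha := kil (vsval (coroot alpha)) (vsval (coroot alpha)).
have kn alpha : alpha \in Phi -> kk alpha = (nof (kk alpha))%:R.
  move=> aP; suff [m em] : exists m, kk alpha = m%:R by rewrite em nofK.
  rewrite /kk (kil_tt ws h_cartan) big_seq.
  apply: (big_ind (fun k : K => exists m, k = m%:R)).
  - by exists 0%N.
  - by move=> _ _ [m1 ->] [m2 ->]; exists (m1 + m2)%N; rewrite natrD.
  move=> beta bR; have [z] := cz _ _ aP bR; rewrite /cartan => ->.
  exists (`|z| ^ 2 * \dim (gw beta))%N; rewrite natrM natrX; congr (_ * _).
  case: z => m; first by rewrite pmulrn.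
  by rewrite NegzE mulrNz sqrrN pmulrn.
have k2 alpha beta : alpha \in Phi -> kil (vsval (coroot alpha)) (vsval (coroot beta)) * 2%:R = cartan alpha beta * kk alpha.
  move=> aP; have [M M0 e] := kil_coroot charK ws h_cartan g_simple aP.
  rewrite /kk !e; have := cartan_id charK ws h_cartan g_simple aP; rewrite /cartan => ->; ring.
exists (fun alpha => nof (kk alpha)); split=> [alpha aP|alpha beta aP bP].
  have [M M0 e] := kil_coroot charK ws h_cartan g_simple aP.
  have : kk alpha != 0.
    rewrite /kk e; have := cartan_id charK ws h_cartan g_simple aP; rewrite /cartan => ->.
    by rewrite mulf_neq0 ?n0.
  by apply: contraNneq => e0; rewrite kn // e0.
by rewrite -!kn // -!k2 // kilC.
Qed.

(** * The Borel subalgebra as a sum of weight spaces *)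

Variables (n b : {vspace g}).
Hypothesis n_def : pos_root_span Delta n.
Hypothesis b_def : b = (h + n)%VS.

Definition bwt : pred h^* := [pred alpha | (alpha == 0) || (alpha \in Phi) && pos height alpha].

Lemma bwtP alpha : bwt alpha -> alpha = 0 \/ (alpha \in Phi /\ pos height alpha).
Proof. by case/orP=> [/eqP->|/andP[]]; [left | right]. Qed.

Lemma bwt0 : bwt 0. Proof. by apply/orP; left; apply/eqP. Qed.

Lemma bwt_pos alpha : alpha \in Phi -> pos height alpha -> bwt alpha.
Proof. by move=> aP pa; apply/orP; right; apply/andP. Qed.

Lemma borelE : b = (\sum_(alpha <- R0 | bwt alpha) gw alpha)%VS.
Proof.
have nE := n_def; apply/eqP; rewrite eqEsubv b_def subv_add -andbA; apply/and3P; split.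
- by apply/subvP => x xh; apply: (@mem_gw_sum _ _ _ _ _ ws _ 0); rewrite ?h0 // bwt0.
- apply/(nE _) => x [alpha /pos_rootP[aP pa] /(weight_gw charK ws h_cartan g_simple) xa].
  by apply: (mem_gw_sum ws xa) => _; exact: bwt_pos.
- apply: (big_ind (fun A => (A <= h + n)%VS)); first exact: sub0v.
    by move=> A B A1 B1; rewrite subv_add A1.
  move=> alpha /bwtP[->|ap]; first by rewrite h0 addvSl.
  apply: subv_trans (addvSr _ _); apply/subvP => x xa.
  apply: ((nE n).1 (subvv _)); exists alpha; first exact/pos_rootP.
  exact/(weight_gw charK ws h_cartan g_simple).
Qed.

Lemma gw_borel alpha x : bwt alpha -> x \in gw alpha -> x \in b.
Proof. by move=> ba xa; rewrite borelE; apply: (mem_gw_sum ws xa). Qed.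

Lemma bwtD alpha beta : bwt alpha -> bwt beta -> alpha + beta \in R0 -> bwt (alpha + beta).
Proof.
case/bwtP=> [->|[aP pa]]; first by rewrite add0r.
case/bwtP=> [->|[bP pb]]; first by rewrite addr0 => _; exact: bwt_pos.
move=> abR; have [->|ab0] := eqVneq (alpha + beta) 0; first exact: bwt0.
have abP : alpha + beta \in Phi by rewrite mem_Phi ab0.
apply: bwt_pos => //; rewrite /pos -[beta]mulr1z height_lin ?mulr1z // mul1r.
by rewrite addr_gt0.
Qed.

Lemma borel_components x : x \in b -> exists u : h^* -> g,
  [/\ forall alpha, u alpha \in gw alpha, forall alpha, alpha \notin R0 -> u alpha = 0,
    forall alpha, ~~ bwt alpha -> u alpha = 0 & x = \sum_(alpha <- R0) u alpha].
Proof.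
move=> xb; have um alpha := gpi_mem ws alpha x.
have u0 alpha (aR : alpha \notin R0) := gw_notin ws aR (um alpha).
exists (fun alpha => gpi ws alpha x); split=> // [alpha na|]; last by rewrite gpi_sum.
have [aR|/u0 //] := boolP (alpha \in R0).
by move: xb; rewrite borelE => xb; exact: (gpi_sum_filter ws h_cartan aR na xb).
Qed.

Lemma borel_lie x y : x \in b -> y \in b -> lie x y \in b.
Proof.
case/borel_components => u [um u0 ub ->]; case/borel_components => v [vm v0 vb ->].
rewrite linear_sum big_seq memv_suml // => j jR /=.
rewrite lieC memvN linear_sum big_seq memv_suml // => i iR /=.
have [bj|bj] := boolP (bwt j); last by rewrite (vb _ bj) lie0l mem0v.
have [bi|bi] := boolP (bwt i); last by rewrite (ub _ bi) lie0r mem0v.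
have ij := gw_lie ws (vm j) (um i).
have [ijR|ijR] := boolP (j + i \in R0); last by rewrite (gw_notin ws ijR ij) mem0v.
by apply: gw_borel ij; exact: bwtD.
Qed.

(** Orthogonality leaves, for each cascade root beta, only the component of weight beta - delta, so
    a test vector of a single weight probes single components. *)
Lemma kil_component (bs : seq h^*) (u : h^* -> g) delta y :
  (forall alpha, u alpha \in gw alpha) -> (forall alpha, alpha \notin R0 -> u alpha = 0) ->
  y \in gw delta ->
  kil (\sum_(beta <- bs) rvec (- beta)) (lie (\sum_(alpha <- R0) u alpha) y) =
  \sum_(beta <- bs) kil (rvec (- beta)) (lie (u (beta - delta)) y).
Proof.
move=> um u0 yd; rewrite kilC kil_sumr; apply: eq_bigr => beta _.
rewrite kilC lieC linear_sum /= -sumrN kil_sumr.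
have z alpha : alpha != beta - delta -> kil (rvec (- beta)) (- lie y (u alpha)) = 0.
  move=> ne; rewrite -lieC; have ad := gw_lie ws (um alpha) yd.
  apply: (kil_orth ws h_cartan (rvec_mem gw (- beta)) ad); apply: contraNneq ne => e.
  by apply/eqP/(addIr delta); rewrite subrK; apply/eqP; rewrite -subr_eq0 addrC e.
have [bR|bR] := boolP (beta - delta \in R0); last first.
  rewrite (u0 _ bR) lie0l kil0r big_seq; apply: big1 => alpha aR; apply: z.
  by apply: contraNneq bR => <-.
rewrite (bigD1_seq (beta - delta) bR (wts_uniq ws)) /= -lieC big1 ?addr0 // => alpha; exact: z.
Qed.

(* Y is the sum of the root vectors of - beta, beta running through the cascade. *)
Lemma borel_frobenius : exists Y : g, forall x, x \in b ->
  (forall y, y \in b -> kil Y (lie x y) = 0) -> x = 0.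
Proof.
have [N [N0 Nsym]] := cartan_sym_nat.
have c_lin := @cartan_linear K g h.
have PN a (aP : a \in Phi) := Phi_opp charK ws h_cartan g_simple aP.
have P0 a (aP : a \in Phi) := Phi_neq0 aP.
have c2 a (aP : a \in Phi) := cartan_id charK ws h_cartan g_simple aP.
have str := cartan_string charK ws h_cartan g_simple.
have sr : forall a d, a \in Phi -> d \in Phi -> sref (@cartan K g h) a d \in Phi.
  exact: (root_refl_root charK ws h_cartan g_simple).
have cs : forall a d e, a \in Phi -> d \in Phi ->
    cartan e (sref (@cartan K g h) a d) = cartan e d - cartan a d * cartan e a.
  move=> a d e aP dP; rewrite /cartan.
  rewrite -[sref _ a d]/(root_refl a d) (coroot_root_refl charK ws h_cartan g_simple aP dP).
  by rewrite linearB linearZ.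
have mult : forall a m, a \in Phi -> a *+ m \in Phi -> m = 1%N.
  move=> a m aP amP.
  have := Phi_multiple charK ws h_cartan g_simple (k := m%:Z) aP.
  by rewrite -pmulrn => /(_ amP) [[]|].
have [bs csd] := cascade_exists (Phi := Phi) charK height c2 [::].
have [l0 l0D l0E] := w0_word.
have refl := bs_reflect_opp charK c_lin PN c2 str N0 Nsym height_lin height_neq0 csd sr cs
  Delta_Phi Delta_pos co_linear co_delta pos_comb mult l0D.
have {}refl a : a \in Phi -> bs_reflect (@cartan K g h) bs a = - a.
  by apply: refl => d dP; rewrite -l0E w0_Phi.
have bsP beta : beta \in bs -> beta \in Phi /\ pos height beta.
  move=> bb; split; first exact: (bs_root csd).
  exact: (bs_pos c_lin PN height_lin height_neq0 csd).
have bs_o := bs_ortho charK N0 Nsym csd.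
(* By [refl], every root is half a combination of cascade roots, and the weights separate h. *)
have sep t : (forall beta, beta \in bs -> beta t = 0) -> t = 0.
  move=> bt; apply: (wts_separate charK ws h_cartan g_simple) => gamma gR.
  have [->|g0] := eqVneq gamma 0; first by rewrite zero_lfunE.
  have gP : gamma \in Phi by rewrite mem_Phi g0.
  have := refl _ gP; rewrite /bs_reflect => /(congr1 (fun f : h^* => f t)).
  rewrite add_lfunE !opp_lfunE sum_lfunE big_seq big1 => [|beta bb]; last first.
    by rewrite scale_lfunE bt // scaler0.
  rewrite subr0 => /eqP; rewrite -addr_eq0 -mulr2n -mulr_natr mulf_eq0 (negbTE (n0 _)) // orbF.
  by move/eqP.
have bs_u := bs_uniq charK c2 N0 Nsym csd.
exists (\sum_(beta <- bs) rvec (- beta)) => _ /borel_components[u [um u0 ub ->]] xK.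
(* A test vector of weight delta isolates the component at beta - delta once the other cascade roots
   contribute nothing. *)
have term beta delta y : beta \in bs -> bwt delta -> y \in gw delta ->
    (forall beta', beta' \in bs -> beta' != beta -> u (beta' - delta) = 0) ->
    kil (rvec (- beta)) (lie (u (beta - delta)) y) = 0.
  move=> bb bd yd z; have := xK y (gw_borel bd yd); rewrite (kil_component _ um u0 yd).
  rewrite (bigD1_seq beta) //= big_seq_cond big1 ?addr0 // => beta' /andP[bb' ne].
  by rewrite z // lie0l kil0r.
have nzr beta : beta \in Phi -> rvec beta != 0 by exact: (rvec_neq0 ws).
have pair beta y : beta \in Phi -> y \in gw beta -> kil (rvec (- beta)) y = 0 -> y = 0.
  move=> bP yb k0; apply/eqP/negPn/negP => y0.
  have := kil_pairing charK ws h_cartan g_simple bP yb y0 (rvec_mem gw (- beta)) (nzr _ (PN _ bP)).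
  by rewrite kilC k0 eqxx.
(* Tested against e_beta: the competing weights beta' - beta are never positive roots, by
   [bs_sum_bs]. This case comes first because the last one uses it. *)
have x0 : u 0 = 0.
  have h0x : u 0 \in h by have := um 0; rewrite h0.
  rewrite -[LHS](vsprojK h0x); set t := vsproj h _.
  have et : vsval t = u 0 by exact: vsprojK.
  rewrite (sep t) ?linear0 // => beta bb; have [bP pb] := bsP _ bb.
  have zz beta' : beta' \in bs -> beta' != beta -> u (beta' - beta) = 0.
    move=> bb' ne; have [bR|/u0//] := boolP (beta' - beta \in R0).
    have nb : beta' - beta != 0 by rewrite subr_eq0.
    have ddP : beta' - beta \in Phi by rewrite mem_Phi nb.
    have [pd|npd] := boolP (bwt (beta' - beta)); last exact: ub.
    case/bwtP: pd => [e0|[_ pd]]; first by rewrite e0 eqxx in nb.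
    have := bs_sum_bs charK c_lin P0 PN c2 str height_lin height_neq0 csd bb bb' ddP pd.
    by rewrite addrC subrK eqxx.
  have := term _ _ _ bb (bwt_pos bP pb) (rvec_mem gw beta) zz.
  rewrite subrr -et (rvec_lie_h charK ws h_cartan g_simple t bP) kilZr => /eqP.
  rewrite mulf_eq0 => /orP[/eqP //|/eqP /(pair _ _ bP (rvec_mem gw beta)) r0].
  by have := nzr _ bP; rewrite r0 eqxx.
rewrite big_seq big1 // => gamma gR.
have [bg|] := boolP (bwt gamma); last exact: ub.
case/bwtP: (bg) => [->//|[gP pg]].
have [c ec] := gw_lineP charK ws h_cartan g_simple gP (um gamma).
have [gb|gb] := boolP (gamma \in bs).
  (* A component at a cascade root is tested against its coroot, on which the other cascade roots
     vanish. *)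
  have H0 : vsval (coroot gamma) \in gw 0 by exact: (mem_gw0 ws h_cartan).
  have := xK _ (gw_borel bwt0 H0); rewrite (kil_component _ um u0 H0).
  rewrite (bigD1_seq gamma) //= big_seq_cond big1 ?addr0 => [|beta /andP[bb ne]]; last first.
    rewrite subr0; have [bP _] := bsP _ bb.
    have [d ->] := gw_lineP charK ws h_cartan g_simple bP (um beta).
    rewrite lieC lieZr (rvec_lie_h charK ws h_cartan g_simple _ bP).
    have := bs_o _ _ bb gb ne; rewrite /cartan => ->.
    by rewrite scale0r scaler0 oppr0 kil0r.
  rewrite subr0 lieC (weight_gw charK ws h_cartan g_simple gamma _).1 //.
  have := c2 _ gP; rewrite /cartan => ->.
  rewrite -scaleNr kilZr => /eqP; rewrite mulf_eq0 oppr_eq0 (negbTE (n0 _)) //= => /eqP.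
  by apply: pair => //; exact: um.
(* Off the cascade the test vector is e_delta for the partner delta. Another beta' contributes
   nothing: beta' - delta is no positive root, and if it is 0 then [x0] applies. *)
have [beta [delta [[bb dP pd] ebd cdb bdP uniqb]]] :=
  bs_partner charK c_lin P0 PN c2 str height_lin height_neq0 csd gP pg gb.
have [bP pb] := bsP _ bb.
have gE : gamma = beta - delta by rewrite -ebd addrAC subrr add0r.
have zz beta' : beta' \in bs -> beta' != beta -> u (beta' - delta) = 0.
  move=> bb' ne; have [bR|/u0//] := boolP (beta' - delta \in R0).
  have [e0|nb] := eqVneq (beta' - delta) 0; first by rewrite e0.
  have ddP : beta' - delta \in Phi by rewrite mem_Phi nb.
  have [pd'|npd] := boolP (bwt (beta' - delta)); last exact: ub.
  case/bwtP: pd' => [e0|[_ pd']]; first by rewrite e0 eqxx in nb.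
  by case/eqP: ne; apply: (uniqb _ _ bb' ddP pd'); rewrite addrC subrK.
have := term _ _ _ bb (bwt_pos dP pd) (rvec_mem gw delta) zz.
rewrite -gE ec lieZl kilZr => /eqP; rewrite mulf_eq0 => /orP[/eqP->|/eqP k0].
  by rewrite scale0r.
have lw : lie (rvec gamma) (rvec delta) \in gw beta.
  by rewrite -ebd addrC; exact: (gw_lie ws (rvec_mem gw gamma) (rvec_mem gw delta)).
have := lie_rvec_neq0 charK ws h_cartan g_simple bP dP gP ebd bdP cdb.
by rewrite (pair _ _ bP lw k0) eqxx.
Qed.

End Frobenius.

(** * Polynomials in characteristic zero *)

Lemma mpoly_ring_ind n (R : fieldType) (Q : {mpoly R[n]} -> Prop) :
  (forall c, Q c%:MP) -> (forall i, Q 'X_i) ->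
  (forall p q, Q p -> Q q -> Q (p + q)) -> (forall p q, Q p -> Q q -> Q (p * q)) ->
  forall p, Q p.
Proof.
move=> QC QX QD QM; elim/mpolyind => [|c m p _ _ Qp]; first by rewrite -mpolyC0.
apply: (QD) => //; rewrite -mul_mpolyC; apply: (QM) => //; rewrite mpolyXE_id.
have Q1 : Q 1 by rewrite -mpolyC1.
apply: (big_ind Q) => [||i _]; [by []|exact: QM|]; elim: (m i) => [|k IH]; first by rewrite expr0.
by rewrite exprS; apply: QM.
Qed.

Lemma mderivXU n (R : fieldType) (i j : 'I_n) : ('X_j : {mpoly R[n]})^`M(i) = (j == i)%:R.
Proof.
rewrite mderivX mnm1E eq_sym; case: eqP => [->|_]; last by rewrite scale0r.
rewrite (_ : (_ - _)%MM = 0%MM) ?mpolyX0 ?scale1r //.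
by apply/mnmP => k; rewrite mnmBE subnn mnm0E.
Qed.

Section Lines.
Variables (K : fieldType) (charK : [pchar K] =i pred0) (n : nat).
Implicit Types (p q : {mpoly K[n]}) (a w v : 'I_n -> K).

Definition line a w p : {poly K} :=
  (map_mpoly polyC p).@[fun i => (a i)%:P + w i *: 'X].

Lemma lineC a w c : line a w c%:MP = c%:P.
Proof. by rewrite /line map_mpolyC mevalC. Qed.
Lemma lineXU a w i : line a w 'X_i = (a i)%:P + w i *: 'X.
Proof. by rewrite /line map_mpolyX mevalXU. Qed.
Lemma lineD a w p q : line a w (p + q) = line a w p + line a w q.
Proof. by rewrite /line rmorphD mevalD. Qed.
Lemma lineM a w p q : line a w (p * q) = line a w p * line a w q.
Proof. by rewrite /line rmorphM mevalM. Qed.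

Lemma horner_line a w p t : (line a w p).[t] = p.@[fun i => a i + t * w i].
Proof.
elim/mpoly_ring_ind: p => [c|i|p q ep eq|p q ep eq].
- by rewrite lineC hornerC mevalC.
- by rewrite lineXU mevalXU !hornerE mulrC.
- by rewrite lineD hornerD mevalD; congr (_ + _).
- by rewrite lineM hornerM mevalM; congr (_ * _).
Qed.

Lemma deriv_line a w p : (line a w p)^`() = \sum_(i < n) w i *: line a w p^`M(i).
Proof.
elim/mpoly_ring_ind: p => [c|j|p q ep eq|p q ep eq].
- rewrite lineC derivC big1 // => i _; rewrite mderivC.
  by rewrite -mpolyC0 lineC scaler0.
- rewrite lineXU derivD derivC add0r derivZ derivX (bigD1 j) //= mderivXU eqxx.
  rewrite -mpolyC1 lineC big1 ?addr0 // => i ne.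
  by rewrite mderivXU eq_sym (negbTE ne) /= mulr0n -mpolyC0 lineC scaler0.
- rewrite lineD derivD [X in X + _]ep [X in _ + X]eq -big_split; apply: eq_bigr => i _.
  by rewrite mderivD lineD scalerDr.
- rewrite lineM derivM [X in X * _]ep [X in _ + _ * X]eq mulr_suml mulr_sumr -big_split.
  apply: eq_bigr => i _; rewrite mderivM.
  rewrite (etrans (lineD a w _ _) (congr2 +%R (lineM a w _ _) (lineM a w _ _))) scalerDr.
  by congr (_ + _); apply/esym; [exact: scalerAl | exact: scalerAr].
Qed.

Lemma poly_eval0 (f : {poly K}) : (forall t, f.[t] = 0) -> f = 0.
Proof.
move=> f0; apply/eqP/negPn/negP => nf.
pose s := [seq (i%:R : K) | i <- iota 0 (size f)].
have us : uniq s.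
  rewrite map_inj_in_uniq ?iota_uniq // => i j _ _ /eqP.
  wlog le : i j / (i <= j)%N => [H|].
    by case/orP: (leq_total i j) => le e; [exact: H | apply/esym/H; rewrite // eq_sym].
  rewrite eq_sym -subr_eq0 -natrB // (pcharf0P K).1 // => /eqP e.
  by apply/eqP; rewrite eqn_leq le -subn_eq0 e eqxx.
have rs : all (root f) s by apply/allP => t _; apply/rootP.
by have := max_poly_roots nf rs us; rewrite size_map size_iota ltnn.
Qed.

(** Vanishing everywhere passes to partial derivatives, and a coefficient of degree d + 1 is, up to
    a nonzero integer factor, one of degree d of a derivative. Degree 0 is the value at the
    origin. *)
Lemma mpoly_eval0 p : (forall v, p.@[v] = 0) -> p = 0.
Proof.
have der q i : (forall v, q.@[v] = 0) -> forall v, q^`M(i).@[v] = 0.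
  move=> q0 v; pose w j : K := (j == i)%:R.
  have l0 : line v w q = 0 by apply: poly_eval0 => t; rewrite horner_line q0.
  have /(congr1 (fun f : {poly K} => f.[0])) := deriv_line v w q.
  rewrite l0 deriv0 horner0 (bigD1 i) //= hornerD hornerZ horner_line /w eqxx mul1r.
  rewrite horner_sum big1 => [|j /negbTE ne]; last by rewrite hornerZ ne mul0r.
  rewrite addr0 => e; apply: etrans (esym e); apply: meval_eq => j /=.
  by rewrite mul0r addr0.
move=> p0; apply/mpolyP => m; rewrite mcoeff0.
move: {2}(mdeg m) (erefl (mdeg m)) => d; elim: d m p p0 => [|d IH] m p p0 dm.
  have -> : m = 0%MM by apply/eqP; rewrite -mdeg_eq0 dm.
  have := p0 (fun=> 0); rewrite mevalE => e; rewrite -[RHS]e.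
  have [ms|ms] := boolP (0%MM \in msupp p).
    rewrite (bigD1_seq 0%MM) ?msupp_uniq //= [X in _ = _ + X]big1_seq => [|m' /andP[ne _]].
      by rewrite addr0 big1 ?mulr1 // => i _; rewrite mnm0E expr0.
    have [i mi] : exists i, m' i != 0%N.
      apply/existsP; apply: contraNT ne; rewrite negb_exists => /forallP h.
      by apply/eqP/mnmP => i; rewrite mnm0E; apply/eqP/negPn/h.
    by rewrite (bigD1 i) //= expr0n (negbTE mi) mul0r mulr0.
  by rewrite memN_msupp_eq0 // [RHS]big1_seq.
have [i mi] : exists i, m i != 0%N.
  apply/existsP; apply: contra_eqT dm; rewrite negb_exists => /forallP h.
  rewrite (_ : m = 0%MM) ?mdeg0 //; apply/mnmP => i; rewrite mnm0E; exact/eqP/negPn/h.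
have mE : m = (m - U_(i) + U_(i))%MM.
  by apply/esym/submK; apply/mnm_lepP => j; rewrite mnm1E; case: eqP => // <-; rewrite lt0n.
have dm1 : mdeg (m - U_(i))%MM = d by have := dm; rewrite {1}mE mdegD mdeg1 addn1 => -[].
have /eqP := IH _ _ (der _ i p0) dm1.
by rewrite mcoeff_mderiv -mE -mulr_natr mulf_eq0 (pcharf0P K).1 // orbF => /eqP.
Qed.

(** If the coefficients of p up to degree k vanish, the identity in degree k reads (k + 1) p_(k+1)
    q_0 = 0. *)
Lemma wronskian0 (p q : {poly K}) : p^`() * q = p * q^`() -> q.[0] != 0 ->
  p.[0] = 0 -> p = 0.
Proof.
move=> W q0 p0; rewrite horner_coef0 in q0; rewrite horner_coef0 in p0.
apply/polyP => k; rewrite coef0.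
suff H : forall j, (j <= k)%N -> p`_j = 0 by exact: H.
elim: k => [|k IH] j; first by rewrite leqn0 => /eqP->.
rewrite leq_eqVlt ltnS => /orP[/eqP->|/IH //].
have /polyP/(_ k) := W; rewrite !coefM big_ord_recr /= subnn coef_deriv.
rewrite big1 => [|i _]; last by rewrite coef_deriv IH ?mul0rn ?mul0r.
rewrite [X in _ = X]big1 => [|i _]; last by rewrite IH ?mul0r // -ltnS.
rewrite add0r => /eqP; rewrite mulf_eq0 (negbTE q0) orbF -mulr_natr mulf_eq0.
by rewrite (pcharf0P K).1 // orbF => /eqP.
Qed.

(** Subtracting from p the multiple of q with the same value at v0 keeps the relation and gives a
    zero at v0; [wronskian0] then applies on every line through v0. *)
Lemma mpoly_wronskian0 p q : q != 0 -> (forall i, p^`M(i) * q = p * q^`M(i)) ->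
  exists c, p = c *: q.
Proof.
move=> q0 W.
have [v0 qv0] : exists v, q.@[v] != 0.
  apply: NNPP => ne; case/eqP: q0; apply: mpoly_eval0 => v.
  by apply/eqP/negPn/negP => qv; apply: ne; exists v.
exists (p.@[v0] / q.@[v0]); apply/eqP; rewrite -subr_eq0; apply/eqP/mpoly_eval0 => v.
set c := _ / _; pose r := p - c *: q; pose w i := v i - v0 i.
have Wr i : r^`M(i) * q = r * q^`M(i).
  by rewrite mderivB mderivZ !mulrBl W -!scalerAl [q^`M(i) * q]mulrC.
have lr : line v0 w r = 0.
  apply: (@wronskian0 _ (line v0 w q)).
  - rewrite [X in X * _]deriv_line [X in _ = _ * X]deriv_line mulr_suml mulr_sumr.
    apply: eq_bigr => i _.
    have e := etrans (esym (lineM v0 w _ _)) (etrans (congr1 (line v0 w) (Wr i)) (lineM v0 w _ _)).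
    exact: etrans (esym (scalerAl _ _ _)) (etrans (congr1 ( *:%R (w i)) e) (scalerAr _ _ _)).
  - rewrite horner_line (meval_eq _ (_ : _ =1 v0)) // => i; by rewrite mul0r addr0.
  - rewrite horner_line (meval_eq _ (_ : _ =1 v0)) => [|i]; last by rewrite mul0r addr0.
    by rewrite mevalB mevalZ divfK // subrr.
have := horner_line v0 w r 1; rewrite lr horner0 => e; apply: etrans (esym e).
by apply: meval_eq => i; rewrite mul1r /w addrC subrK.
Qed.

End Lines.

(** * Differentials of regular functions on a matrix group *)

Section Differential.
Variables (K : fieldType) (N : nat) (X : 'M[K]_N).
Implicit Types (P Q : {mpoly K[N * N]}) (A Y : 'M[K]_N).

Definition dmx P : K := \sum_(k < N * N) mx_eval (mderiv k P) 1%:M * mxvec X 0 k.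

Lemma mx_evalC c A : mx_eval c%:MP A = c. Proof. exact: mevalC. Qed.
Lemma mx_evalD P Q A : mx_eval (P + Q) A = mx_eval P A + mx_eval Q A.
Proof. exact: mevalD. Qed.
Lemma mx_evalM P Q A : mx_eval (P * Q) A = mx_eval P A * mx_eval Q A.
Proof. exact: mevalM. Qed.
Lemma mx_evalX i j A : mx_eval 'X_(mxvec_index i j) A = A i j.
Proof. by rewrite /mx_eval mevalXU mxvecE. Qed.
Lemma mx_eval_exp P k A : mx_eval (P ^+ k) A = mx_eval P A ^+ k.
Proof. by elim: k => [|k IH]; [exact: meval1 | rewrite !exprS mx_evalM IH]. Qed.
Lemma dmxC c : dmx c%:MP = 0.
Proof. by rewrite /dmx big1 // => k _; rewrite mderivC -mpolyC0 mx_evalC mul0r. Qed.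

Lemma dmxD P Q : dmx (P + Q) = dmx P + dmx Q.
Proof.
rewrite /dmx -big_split; apply: eq_bigr => k _.
by rewrite mderivD mx_evalD mulrDl.
Qed.

Lemma dmx_sum (I : finType) (F : I -> {mpoly K[N * N]}) : dmx (\sum_i F i) = \sum_i dmx (F i).
Proof. by apply: (big_morph dmx) => [P Q|]; [exact: dmxD | rewrite -mpolyC0 dmxC]. Qed.

Lemma dmxM P Q : dmx (P * Q) = dmx P * mx_eval Q 1%:M + mx_eval P 1%:M * dmx Q.
Proof.
rewrite /dmx mulr_suml mulr_sumr -big_split; apply: eq_bigr => k _.
rewrite mderivM mx_evalD [mx_eval (mderiv k P * Q) _]mx_evalM [mx_eval (P * mderiv k Q) _]mx_evalM.
by rewrite mulrDl mulrA; congr (_ + _); rewrite mulrAC.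
Qed.

Lemma dmxX i j : dmx 'X_(mxvec_index i j) = X i j.
Proof.
rewrite /dmx (bigD1 (mxvec_index i j)) //= mderivXU eqxx /= -mpolyC1 mx_evalC mul1r mxvecE.
rewrite big1 ?addr0 // => k ne.
by rewrite mderivXU eq_sym (negbTE ne) /= mulr0n -mpolyC0 mx_evalC mul0r.
Qed.

Definition gen_mx : 'M[{mpoly K[N * N]}]_N := \matrix_(i, j) 'X_(mxvec_index i j).
Definition det_poly : {mpoly K[N * N]} := \det gen_mx.

Lemma eval_gen_mx A : map_mx (meval (fun k => mxvec A 0 k)) gen_mx = A.
Proof. by apply/matrixP => i j; rewrite !mxE; exact: mx_evalX. Qed.

Lemma eval_det A : mx_eval det_poly A = \det A.
Proof. by rewrite /mx_eval /det_poly -det_map_mx eval_gen_mx. Qed.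

Lemma eval_adj A i j : mx_eval (\adj gen_mx i j) A = \adj A i j.
Proof. by rewrite -[in RHS](eval_gen_mx A) -map_mx_adj [RHS]mxE. Qed.

Definition ddet := dmx det_poly.

Lemma dmx_det_exp k : dmx (det_poly ^+ k) = k%:R * ddet.
Proof.
elim: k => [|k IH]; first by rewrite expr0 -mpolyC1 dmxC mul0r.
rewrite exprS dmxM IH mx_eval_exp eval_det det1 expr1n mulr1 mul1r -/ddet.
by rewrite mulrS mulrDl mul1r.
Qed.

(** Differentiate the product of the generic matrix with its adjugate, which is the determinant
    times the identity. *)
Lemma dmx_adj i j : dmx (\adj gen_mx i j) = - X i j + (i == j)%:R * ddet.
Proof.
have /matrixP/(_ i j) e0 := mul_mx_adj gen_mx; rewrite mxE [RHS]mxE in e0.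
have := congr1 dmx e0; rewrite dmx_sum; have -> : \sum_l dmx (gen_mx i l * \adj gen_mx l j) =
    \sum_l (X i l * (l == j)%:R + (i == l)%:R * dmx (\adj gen_mx l j)).
  apply: eq_bigr => l _; rewrite dmxM eval_adj [gen_mx i l]mxE dmxX mx_evalX.
  by rewrite adj1 !mxE.
rewrite big_split /= (bigD1 j) //= eqxx mulr1 big1 => [|l /negbTE->]; last by rewrite mulr0.
rewrite (bigD1 i) //= eqxx mul1r big1 => [|l ne]; last by rewrite eq_sym (negbTE ne) mul0r.
rewrite !addr0 => e; apply: (addrI (X i j)); rewrite e addrA subrr add0r.
case: eqP => _; rewrite ?mulr1n ?mulr0n ?mul1r ?mul0r //.
by rewrite -mpolyC0 dmxC.
Qed.

(* phi is a regular function on GL_N, and psi its differential at 1 applied to X;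
   the denominators of phi are powers of the determinant. *)
Definition regd (phi : 'M[K]_N -> K) (psi : K) : Prop := exists P k,
  (forall A, A \in unitmx -> phi A * \det A ^+ k = mx_eval P A) /\
  dmx P = psi + k%:R * (phi 1%:M * ddet).

Lemma regd_ext phi phi' psi : phi =1 phi' -> regd phi psi -> regd phi' psi.
Proof.
move=> e [P [k [H1 H2]]]; exists P, k; split=> [A uA|]; first by rewrite -e H1.
by rewrite -e.
Qed.

Lemma regd_cst c : regd (fun=> c) 0.
Proof.
exists c%:MP, 0%N; split=> [A _|]; first by rewrite expr0 mulr1 mx_evalC.
by rewrite dmxC mul0r addr0.
Qed.

Lemma regd_entry i j : regd (fun A => A i j) (X i j).
Proof.
exists 'X_(mxvec_index i j), 0%N; split=> [A _|]; first by rewrite expr0 mulr1 mx_evalX.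
by rewrite dmxX mul0r addr0.
Qed.

Lemma regd_inv i j : regd (fun A => invmx A i j) (- X i j).
Proof.
exists (\adj gen_mx i j), 1%N; split=> [A uA|].
  rewrite eval_adj expr1 /invmx uA mxE mulrAC mulVf ?mul1r //.
  by move: uA; rewrite unitmxE unitfE.
by rewrite dmx_adj invmx1 mxE mul1r.
Qed.

Lemma regdD f1 f2 d1 d2 : regd f1 d1 -> regd f2 d2 -> regd (fun A => f1 A + f2 A) (d1 + d2).
Proof.
move=> [P1 [k1 [H1 D1]]] [P2 [k2 [H2 D2]]].
have u1 : 1%:M \in unitmx :> bool by exact: unitmx1.
have e1 := H1 _ (unitmx1 _ _); have e2 := H2 _ (unitmx1 _ _).
rewrite det1 expr1n mulr1 in e1; rewrite det1 expr1n mulr1 in e2.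
exists (P1 * det_poly ^+ k2 + P2 * det_poly ^+ k1), (k1 + k2)%N; split=> [A uA|].
  rewrite mx_evalD !mx_evalM !mx_eval_exp eval_det -H1 // -H2 // exprD; ring.
rewrite dmxD !dmxM !dmx_det_exp !mx_eval_exp eval_det det1 !expr1n -e1 -e2 D1 D2 natrD; ring.
Qed.

Lemma regdM f1 f2 d1 d2 : regd f1 d1 -> regd f2 d2 ->
  regd (fun A => f1 A * f2 A) (d1 * f2 1%:M + f1 1%:M * d2).
Proof.
move=> [P1 [k1 [H1 D1]]] [P2 [k2 [H2 D2]]].
have e1 := H1 _ (unitmx1 _ _); have e2 := H2 _ (unitmx1 _ _).
rewrite det1 expr1n mulr1 in e1; rewrite det1 expr1n mulr1 in e2.
exists (P1 * P2), (k1 + k2)%N; split=> [A uA|].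
  rewrite mx_evalM -H1 // -H2 // exprD; ring.
rewrite dmxM -e1 -e2 D1 D2 natrD; ring.
Qed.

Lemma regd_sum (I : Type) (r : seq I) (f : I -> 'M[K]_N -> K) (d : I -> K) :
  (forall i, regd (f i) (d i)) -> regd (fun A => \sum_(i <- r) f i A) (\sum_(i <- r) d i).
Proof.
move=> H; elim: r => [|i r IH].
  by rewrite big_nil; apply: regd_ext (regd_cst 0) => A; rewrite big_nil.
by rewrite big_cons; apply: regd_ext (regdD (H i) IH) => A; rewrite big_cons.
Qed.

Lemma regdZ c f d : regd f d -> regd (fun A => c * f A) (c * d).
Proof. by move=> H; have := regdM (regd_cst c) H; rewrite mul0r add0r. Qed.

Lemma regd_comp m (p : {mpoly K[m]}) (f : 'I_m -> 'M[K]_N -> K) (d : 'I_m -> K) :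
  (forall i, regd (f i) (d i)) ->
  regd (fun A => p.@[fun i => f i A]) (\sum_i (p^`M(i)).@[fun i => f i 1%:M] * d i).
Proof.
move=> H; elim/mpoly_ring_ind: p => [c|j|p q Hp Hq|p q Hp Hq].
- rewrite big1 => [|i _]; last by rewrite mderivC meval0 mul0r.
  by apply: regd_ext (regd_cst c) => A; rewrite mevalC.
- rewrite (bigD1 j) //= mderivXU eqxx /= meval1 mul1r big1 => [|i ne]; last first.
    by rewrite mderivXU eq_sym (negbTE ne) /= mulr0n meval0 mul0r.
  by rewrite addr0; apply: regd_ext (H j) => A; rewrite mevalXU.
- have -> : \sum_i ((p + q)^`M(i)).@[fun i => f i 1%:M] * d i =
    \sum_i (p^`M(i)).@[fun i => f i 1%:M] * d i + \sum_i (q^`M(i)).@[fun i => f i 1%:M] * d i.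
    by rewrite -big_split; apply: eq_bigr => i _; rewrite mderivD mevalD mulrDl.
  by apply: regd_ext (regdD Hp Hq) => A; apply/esym/mevalD.
- have -> : \sum_i ((p * q)^`M(i)).@[fun i => f i 1%:M] * d i =
    (\sum_i (p^`M(i)).@[fun i => f i 1%:M] * d i) * q.@[fun i => f i 1%:M] +
    p.@[fun i => f i 1%:M] * \sum_i (q^`M(i)).@[fun i => f i 1%:M] * d i.
    rewrite mulr_suml mulr_sumr -big_split; apply: eq_bigr => i _.
    rewrite mderivM (mevalD _ (_ * _)) (mevalM _ (mderiv i p)) (mevalM _ p (mderiv i q)).
    by rewrite mulrDl mulrA; congr (_ + _); rewrite mulrAC.
  by apply: regd_ext (regdM Hp Hq) => A; apply/esym/mevalM.
Qed.

Lemma regd_conj (L : {linear 'M[K]_N -> K^o}) Y :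
  regd (fun A => L (A *m Y *m invmx A) : K) (L (X *m Y - Y *m X) : K).
Proof.
have LE Z : (L Z : K) = \sum_i \sum_j (L (delta_mx i j) : K) * Z i j.
  rewrite [in LHS](matrix_sum_delta Z) linear_sum; apply: eq_bigr => i _.
  by rewrite linear_sum; apply: eq_bigr => j _; rewrite linearZ /= mulrC.
rewrite LE; apply: (@regd_ext (fun A => \sum_i \sum_j
   (L (delta_mx i j) : K) * (\sum_l (\sum_k A i k * Y k l) * invmx A l j))).
  move=> A; rewrite LE; apply: eq_bigr => i _; apply: eq_bigr => j _.
  by rewrite mxE; congr (_ * _); apply: eq_bigr => l _; rewrite mxE.
apply: regd_sum => i; apply: regd_sum => j; apply: regdZ.
have inner l : regd (fun A => \sum_k A i k * Y k l) (\sum_k X i k * Y k l).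
  apply: regd_sum => k; have := regdM (regd_entry i k) (regd_cst (Y k l)).
  by rewrite mulr0 addr0.
have := regd_sum (index_enum 'I_N) (fun l => regdM (inner l) (regd_inv l j)).
have -> // : \sum_(l <- index_enum 'I_N) ((\sum_k X i k * Y k l) * invmx (1%:M : 'M[K]_N) l j +
    (\sum_k (1%:M : 'M[K]_N) i k * Y k l) * - X l j) = (X *m Y - Y *m X) i j.
rewrite [RHS]mxE [X in _ = X + _]mxE [X in _ = _ + X]mxE [X in _ = _ - X]mxE big_split /=.
congr (_ + _).
  rewrite (bigD1 j) //= invmx1 mxE eqxx mulr1 [X in _ + X]big1 ?addr0 // => l ne.
  by rewrite mxE (negbTE ne) mulr0.
rewrite -sumrN; apply: eq_bigr => l _; rewrite (bigD1 i) //= mxE eqxx mul1r.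
rewrite [X in (_ + X) * _]big1 ?addr0 ?mulrN // => k ne.
by rewrite mxE eq_sym (negbTE ne) mul0r.
Qed.

(** Multiplying f by a power of the determinant gives a polynomial vanishing on S. Its differential
    is d, because the correction term has the factor f(1) = 0. *)
Lemma regd_vanish (S : 'M[K]_N -> Prop) f d : matrix_group S -> alg_lie S X ->
  (forall A, S A -> f A = 0) -> regd f d -> d = 0.
Proof.
move=> [Su S1 _ _] XS f0 [P [k [HP DP]]].
have := XS P; rewrite -/(dmx P) DP f0 // mul0r mulr0 addr0; apply=> A SA.
by rewrite -HP ?Su // f0 // mul0r.
Qed.

End Differential.

(** Conjugation by A is linear and preserves S, so p composed with it vanishes on S; its
    differential along X is that of p along the conjugate of X. *)
Lemma alg_lie_conj (K : fieldType) N (S : 'M[K]_N -> Prop) A X :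
  matrix_group S -> S A -> alg_lie S X -> alg_lie S (A *m X *m invmx A).
Proof.
move=> gS SA XS p pS; case: (gS) => Su S1 SM SV.
pose f k (Y : 'M[K]_N) := mxvec (A *m Y *m invmx A) 0 k.
have Hf k : regd X (f k) (mxvec (A *m X *m invmx A) 0 k).
  case/mxvec_indexP: k => i j; rewrite mxvecE.
  apply: (@regd_ext _ _ _ (fun Y => \sum_l (\sum_k A i k * Y k l) * invmx A l j)).
    by move=> Y; rewrite /f mxvecE mxE; apply: eq_bigr => l _; rewrite mxE.
  rewrite mxE; apply: regd_sum => l; rewrite mxE.
  have inner : regd X (fun Y => \sum_k A i k * Y k l) (\sum_k A i k * X k l).
    apply: regd_sum => k; exact: regdZ (regd_entry X k l).
  by have := regdM inner (regd_cst X (invmx A l j)); rewrite mulr0 addr0.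
have := regd_vanish gS XS _ (regd_comp p Hf) => H.
rewrite -[RHS](H _) => [|Y SY]; last first.
  by apply: (pS (A *m Y *m invmx A)); apply: (SM); [exact: (SM) | exact: SV].
apply: eq_bigr => k _; congr (_ * _); apply: meval_eq => l.
by rewrite /f mulmx1 mulmxV // Su.
Qed.

(** * The coadjoint action on rational functions *)

Lemma frac_numdenE (R : idomainType) (F : {fraction R}) :
  F = tofrac \n_(repr F) / tofrac \d_(repr F).
Proof.
have d0 : tofrac \d_(repr F) != 0 :> {fraction R} by rewrite tofrac_eq0 denom_ratioP.
apply: (mulIf d0); rewrite divfK //; rewrite -{1}[F]reprK.
move: (repr F) => x; unlock FracField.tofrac.
rewrite -[LHS]FracField.pi_mul.
apply/eqmodP; rewrite /= FracField.equivfE /FracField.mulf /=.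
rewrite !numden_Ratio ?mulr1 ?oner_neq0 ?denom_ratioP //.
by rewrite mulrC.
Qed.

Section PolyComp.
Variables (K : fieldType) (charK : [pchar K] =i pred0) (V : vectType K).
Local Notation e := (vbasis {:V}).
Local Notation m := (\dim {:V}).
Implicit Types (T : V -> V) (p q : {mpoly K[m]}) (v : 'I_m -> K).

Definition vec v : V := \sum_j v j *: e`_j.
Definition crd (f : V) : 'I_m -> K := fun i => coord e i f.

Lemma vecK v i : crd (vec v) i = v i.
Proof. by rewrite /crd coord_sum_free // (basis_free (vbasisP _)). Qed.

Lemma crdK f : vec (crd f) = f.
Proof. exact/esym/coord_vbasis/memvf. Qed.

Lemma poly_comp_eval T p v : linear T -> (poly_comp T p).@[v] = p.@[crd (T (vec v))].
Proof.
move=> linT; rewrite /poly_comp comp_mpoly_meval; apply: meval_eq => i.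
have TD a b : T (a + b) = T a + T b by have := linT 1 a b; rewrite !scale1r.
have T0 : T 0 = 0 by apply: (addrI (T 0)); rewrite -TD !addr0.
have TZ k a : T (k *: a) = k *: T a by have := linT k a 0; rewrite T0 !addr0.
rewrite tnth_mktuple /crd /vec (big_morph T TD T0) linear_sum [RHS]linear_sum.
apply: eq_bigr => j _; rewrite TZ linearZ [RHS]linearZ /=.
by rewrite mevalXU mulrC.
Qed.

Lemma poly_compM T p q : poly_comp T (p * q) = poly_comp T p * poly_comp T q.
Proof. exact: rmorphM. Qed.

Lemma poly_compC T c : poly_comp T c%:MP = c%:MP.
Proof. exact: comp_mpolyC. Qed.

Lemma poly_comp_neq0 T T' p : linear T -> (forall f, T (T' f) = f) -> p != 0 -> poly_comp T p != 0.
Proof.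
move=> linT TT'; apply: contra_neq => p0; apply: (mpoly_eval0 charK) => v.
have := poly_comp_eval p (crd (T' (vec v))) linT.
rewrite p0 meval0 crdK TT' => e0; apply: etrans (esym e0); apply: meval_eq => i.
by rewrite vecK.
Qed.

End PolyComp.

Section CoadjointAction.
Variables (K : fieldType) (charK : [pchar K] =i pred0) (g : lieAlgType K) (N : nat).
Variables (iota : 'Hom(g, 'M[K]_N)) (b : {vspace g}) (B : 'M[K]_N -> Prop).
Hypothesis iota_inj : lker iota = 0%VS.
Hypothesis iota_lie : forall x y : g, iota (lie x y) = iota x *m iota y - iota y *m iota x.
Hypothesis grpB : matrix_group B.
Hypothesis lieB : forall X, X \in (iota @: b)%VS <-> alg_lie B X.
Local Notation W := (subvs_of b).
Local Notation D := (dual K W).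
Local Notation e := (vbasis {:D}).
Local Notation xb := (vbasis {:W}).
Local Notation m := (\dim {:D}).
Local Notation T A := (@coAd K g N iota b (invmx A)).
Implicit Types (f : D) (A : 'M[K]_N) (v : 'I_m -> K) (n d : {mpoly K[m]}).

Lemma iotaK : cancel iota (iota^-1)%VF.
Proof. by apply: lker0_lfunK; rewrite iota_inj. Qed.

(** B normalizes its tangent space, the image of b, so the inverse of iota in [Ad] is applied where
    it is a true inverse. *)
Lemma Ad_b A x : B A -> x \in b ->
  Ad iota A x \in b /\ iota (Ad iota A x) = A *m iota x *m invmx A.
Proof.
move=> BA xb0; have : A *m iota x *m invmx A \in (iota @: b)%VS.
  by apply/lieB/alg_lie_conj => //; apply/lieB/memv_img.
by case/memv_imgP => y yb e0; rewrite /Ad e0 iotaK.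
Qed.

Lemma coAdE A f x : T A f x = f (vsproj b (Ad iota A (vsval x))) :> K.
Proof.
have lin : linear (fun x : W => f (vsproj b (Ad iota (invmx (invmx A)) (vsval x))) : K^o).
  move=> k y z; rewrite /Ad (linearP (@vsval _ _ b)) (linearP iota).
  by rewrite mulmxDr mulmxDl -scalemxAr -scalemxAl !linearP.
pose L : {linear W -> K^o} := HB.pack
   (fun x : W => f (vsproj b (Ad iota (invmx (invmx A)) (vsval x))) : K^o)
   (GRing.isLinear.Build K W K^o *:%R _ lin).
by rewrite -[in RHS](invmxK A); exact: (lfunE L x).
Qed.

Lemma coAd_linear A : linear (T A).
Proof.
move=> k f1 f2; apply/lfunP => x.
by rewrite add_lfunE scale_lfunE !coAdE add_lfunE scale_lfunE.
Qed.

Lemma coAd1 f : T 1%:M f = f.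
Proof.
by apply/lfunP => x; rewrite coAdE /Ad invmx1 mul1mx mulmx1 iotaK vsvalK.
Qed.

Lemma coAdK A f : B A -> T A (T (invmx A) f) = f.
Proof.
move=> BA; case: (grpB) => Su _ _ SV; apply/lfunP => x; rewrite !coAdE.
have [Ab iA] := Ad_b BA (subvsP x).
rewrite vsprojK // {1}/Ad iA invmxK !mulmxA mulVmx ?Su // mul1mx.
by rewrite -mulmxA mulVmx ?Su // mulmx1 iotaK vsvalK.
Qed.

Definition dualb (k : 'I_(\dim {:W})) : D := linfun (coord xb k : W -> K^o).

Lemma dualbE k x : dualb k x = coord xb k x.
Proof. exact: lfunE. Qed.

Lemma dual_expand f : f = \sum_(k < \dim {:W}) (f xb`_k : K) *: dualb k.
Proof.
apply/lfunP => x; rewrite sum_lfunE [in LHS](coord_vbasis (memvf x)) linear_sum.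
by apply: eq_bigr => k _; rewrite scale_lfunE dualbE linearZ /= [LHS]mulrC.
Qed.

Definition coform f (x y : W) : K := f (vsproj b (lie (vsval x) (vsval y))).

Lemma coform_sumr f x (I : finType) (c : I -> K) (y : I -> W) :
  coform f x (\sum_k c k *: y k) = \sum_k c k * coform f x (y k).
Proof.
pose L := (f \o linfun (vsproj b) \o ad (vsval x) \o linfun (@vsval _ _ b))%VF.
have LE z : coform f x z = L z by rewrite !comp_lfunE adE !lfunE.
rewrite LE linear_sum; apply: eq_bigr => k _.
by rewrite linearZ LE.
Qed.

Lemma coform_suml f y (I : finType) (c : I -> K) (x : I -> W) :
  coform f (\sum_k c k *: x k) y = \sum_k c k * coform f (x k) y.
Proof.
have coformC u w : coform f u w = - coform f w u.
  by rewrite /coform lieC (linearN (vsproj b)) (linearN f).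
by rewrite coformC coform_sumr -sumrN; apply: eq_bigr => k _; rewrite [in RHS]coformC mulrN.
Qed.

(* The i-th coordinate of the derivative at [A = 1] of [T A f] in the direction [x]. *)
Definition infin f (x : W) i : K :=
  \sum_(k < \dim {:W}) coform f x xb`_k * coord e i (dualb k).

Lemma regd_coAd f x i : regd (iota (vsval x)) (fun A => crd (T A f) i) (infin f x i).
Proof.
pose L := (f \o linfun (vsproj b) \o iota^-1)%VF.
apply: (@regd_ext _ _ _ (fun A => \sum_(k < \dim {:W})
   (coord e i (dualb k)) * (L (A *m iota (vsval xb`_k) *m invmx A) : K))).
  move=> A; rewrite /crd [in RHS](dual_expand (T A f)) linear_sum; apply: eq_bigr => k _.
  by rewrite linearZ /= coAdE /L !comp_lfunE lfunE mulrC.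
rewrite /infin; under eq_bigr => k _ do rewrite mulrC.
apply: regd_sum => k; apply: regdZ.
have -> : coform f x xb`_k = L (iota (lie (vsval x) (vsval xb`_k))).
  by rewrite /coform /L !comp_lfunE lfunE /= iotaK.
by rewrite iota_lie; exact: regd_conj.
Qed.

(** With v fixed, d(v) n(T A v) - n(v) d(T A v) vanishes for A in B; the sum is its differential at
    1 along x. *)
Lemma invariant_infin n d v (x : W) :
  (forall A, B A -> poly_comp (T A) n * d = n * poly_comp (T A) d) ->
  \sum_i (n^`M(i) * d - n * d^`M(i)).@[v] * infin (vec v) x i = 0.
Proof.
move=> inv; have XB : alg_lie B (iota (vsval x)) by apply/lieB/memv_img/subvsP.
have R p := regd_comp p (fun i => regd_coAd (vec v) x i).
have := regd_vanish grpB XB _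
  (regdD (regdZ d.@[v] (R n)) (regdZ (- n.@[v]) (R d))) => H.
rewrite -[RHS]H => [|A BA]; last first.
  have := congr1 (meval v) (inv A BA).
  rewrite mevalM [in RHS]mevalM !poly_comp_eval; try exact: coAd_linear.
  by move=> e0; rewrite mulrC e0 mulNr subrr.
rewrite !mulr_sumr -big_split; apply: eq_bigr => i _.
have ev p : p.@[fun i => crd (T 1%:M (vec v)) i] = p.@[v].
  by apply: meval_eq => j; rewrite coAd1 vecK.
rewrite !ev mevalB [(_ * d).@[v]]mevalM [(n * _).@[v]]mevalM [RHS]/=; ring.
Qed.

(** The gradient G at v is a functional on the dual of b, that is, an element z of b.
    [invariant_infin] says that z lies in the radical of the form at v. *)
Lemma nondegenerate_gradient n d v :
  (forall A, B A -> poly_comp (T A) n * d = n * poly_comp (T A) d) ->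
  (forall z : W, (forall x, coform (vec v) x z = 0) -> z = 0) ->
  forall i, (n^`M(i) * d - n * d^`M(i)).@[v] = 0.
Proof.
move=> inv nd; pose G i := (n^`M(i) * d - n * d^`M(i)).@[v].
pose c k := \sum_i G i * coord e i (dualb k).
have zE : \sum_k c k *: xb`_k = 0.
  apply: nd => x; rewrite -[RHS](invariant_infin v x inv) coform_sumr /c.
  under eq_bigr => k _ do rewrite mulr_suml.
  rewrite exchange_big; apply: eq_bigr => i _ /=; rewrite mulr_sumr.
  by apply: eq_bigr => k _; rewrite -mulrA [coform _ _ _ * _]mulrC.
have c0 k : c k = 0.
  have := congr1 (coord xb k) zE; rewrite coord_sum_free ?linear0 //.
  exact: basis_free (vbasisP _).
have Gd (f : D) : \sum_i G i * coord e i f = 0.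
  rewrite (dual_expand f); under eq_bigr => i _ do rewrite linear_sum mulr_sumr.
  rewrite exchange_big big1 // => k _ /=.
  under eq_bigr => i _ do rewrite linearZ /= mulrCA.
  by rewrite -mulr_sumr -/(c k) c0 mulr0.
move=> i; have := Gd e`_i; rewrite (bigD1 i) //= coord_free ?(basis_free (vbasisP _)) //.
rewrite eqxx mulr1 big1 ?addr0 // => j ne.
by rewrite coord_free ?(basis_free (vbasisP _)) // eq_sym (negbTE ne) mulr0.
Qed.

(** The Gram matrix of the form at the generic point of the dual of b; its entries are linear
    forms. *)
Definition form_mx : 'M[{mpoly K[m]}]_(\dim {:W}) :=
  \matrix_(k, l) \sum_(j < m) coform e`_j xb`_k xb`_l *: 'X_j.

Lemma form_mx_eval v k l : (form_mx k l).@[v] = coform (vec v) xb`_k xb`_l.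
Proof.
rewrite mxE linear_sum /coform /vec sum_lfunE; apply: eq_bigr => j _.
by rewrite linearZ /= mevalXU scale_lfunE [RHS]mulrC.
Qed.

Definition gram f : 'M[K]_(\dim {:W}) := \matrix_(k, l) coform f xb`_k xb`_l.

Lemma form_det_eval v : (\det form_mx).@[v] = \det (gram (vec v)).
Proof.
rewrite -det_map_mx; congr (\det _); apply/matrixP => k l.
rewrite [LHS]mxE [RHS]mxE; exact: form_mx_eval.
Qed.

Lemma form_det_nondegenerate v : (\det form_mx).@[v] != 0 ->
  forall z : W, (forall x, coform (vec v) x z = 0) -> z = 0.
Proof.
rewrite form_det_eval => dn0 z zP; set M := gram _ in dn0.
have uM : M \in unitmx by rewrite unitmxE unitfE.
pose c := \col_l coord xb l z.
have Mc : M *m c = 0.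
  apply/matrixP => k j; rewrite !mxE -[RHS](zP xb`_k) [in RHS](coord_vbasis (memvf z)).
  rewrite coform_sumr; apply: eq_bigr => l _.
  by rewrite !mxE mulrC.
have c0 : c = 0 by rewrite -(mulKmx uM c) Mc mulmx0.
rewrite (coord_vbasis (memvf z)) big1 // => l _.
by have /matrixP/(_ l 0) := c0; rewrite !mxE => ->; rewrite scale0r.
Qed.

Lemma form_det_neq0 f : (forall x : W, (forall y, coform f x y = 0) -> x = 0) ->
  (\det form_mx).@[crd f] != 0.
Proof.
move=> nd; rewrite form_det_eval crdK; apply/negP => /det0P [w wn0 wM].
have /nd x0 : forall y, coform f (\sum_k w 0 k *: xb`_k) y = 0.
  move=> y; rewrite (coord_vbasis (memvf y)) coform_sumr big1 // => l _.
  have /matrixP/(_ 0 l) := wM; rewrite !mxE coform_suml => e0.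
  rewrite (_ : \sum_k _ = 0) ?mulr0 // -[RHS]e0.
  by apply: eq_bigr => k _; rewrite !mxE.
case/eqP: wn0; apply/rowP => k; rewrite mxE.
have := congr1 (coord xb k) x0; rewrite coord_sum_free ?linear0 //.
exact: basis_free (vbasisP _).
Qed.

Lemma invariants_trivial f0 (F : ratfun D) :
  (forall x : W, (forall y, coform f0 x y = 0) -> x = 0) ->
  (forall A, B A -> ratfun_act iota A F = F) <->
  (exists c : K, F = ratfun_const _ c).
Proof.
move=> nd; have FE := frac_numdenE F; have dn0 := denom_ratioP (repr F).
rewrite /ratfun_act /ratfun_comp.
set n := \n_(repr F) in FE *; set d := \d_(repr F) in FE dn0 *.
have td0 : tofrac d != 0 by rewrite tofrac_eq0.
have Td0 A : B A -> tofrac (poly_comp (T A) d) != 0.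
  move=> BA; rewrite tofrac_eq0; apply: (poly_comp_neq0 charK) dn0; first exact: coAd_linear.
  by move=> f; apply: coAdK.
split=> [inv | [c Fc] A BA]; last first.
  (* The chosen representative of a constant is c d / d, where d need not be 1. *)
  have nE : n = c%:MP * d.
    by apply/eqP; rewrite -tofrac_eq tofracM -[tofrac c%:MP]/(ratfun_const D c) -Fc FE divfK.
  by rewrite nE poly_compM poly_compC tofracM mulfK ?Td0 // Fc.
have inv' A : B A -> poly_comp (T A) n * d = n * poly_comp (T A) d.
  move=> BA; have := inv A BA; rewrite [RHS]FE => /eqP.
  by rewrite eqr_div ?Td0 // -!tofracM tofrac_eq => /eqP.
have [c nE] : exists c, n = c *: d.
  apply: (mpoly_wronskian0 charK dn0) => i; apply/eqP; rewrite -subr_eq0.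
  have p0 : \det form_mx != 0.
    by apply: contra_neq (form_det_neq0 nd) => ->; rewrite meval0.
  (* The product vanishes at every point: off the zeros of the determinant by the gradient lemma, on
     them trivially. *)
  have : \det form_mx * (n^`M(i) * d - n * d^`M(i)) = 0.
    apply: (mpoly_eval0 charK) => v; rewrite mevalM.
    have [->|/form_det_nondegenerate nv] := eqVneq (\det form_mx).@[v] 0; first by rewrite mul0r.
    by rewrite (nondegenerate_gradient inv' nv) mulr0.
  by move/eqP; rewrite mulf_eq0 => /orP[e0|//]; case/negP: p0.
by exists c; rewrite FE nE -mul_mpolyC tofracM mulfK.
Qed.

End CoadjointAction.

Theorem theorem3p2
  (K : fieldType) (charK : [pchar K] =i pred0)
  (g : lieAlgType K) (g_simple : lie_simple g)
  (h : {vspace g}) (h_split : splitting_cartan h)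
  (Delta : seq (dual K (subvs_of h))) (Delta_base : root_base Delta)
  (w0 : 'End(dual K (subvs_of h))) (w0_longest : longest_element Delta w0)
  (w0_opp : minus_id_on_roots w0)
  (n b : {vspace g}) (n_def : pos_root_span Delta n) (b_def : b = (h + n)%VS)
  (N : nat) (G : 'M[K]_N -> Prop) (G_alg : connected_alg_group G)
  (iota : 'Hom(g, 'M[K]_N)) (lieG : lie_algebra_of G iota)
  (B : 'M[K]_N -> Prop) (B_borel : borel_subgroup G B)
  (lieB : forall X, X \in (iota @: b)%VS <-> alg_lie B X) :
  forall F : ratfun (dual K (subvs_of b)),
    (forall A, B A -> ratfun_act iota A F = F) <->
    (exists c : K, F = ratfun_const _ c).
Proof.
have [R0 [gw ws]] := weight_system_exists charK h_split.
have h_cartan := h_split.1.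
have b_lie := borel_lie charK ws h_cartan g_simple Delta_base n_def b_def.
case: lieG => iota_inj iota_lie _; case: B_borel => [[grpB _ _] _ _ _] F.
have [Y YP] := borel_frobenius charK ws h_cartan g_simple Delta_base w0_longest w0_opp n_def b_def.
(* The point of the dual of b at which the form is nondegenerate is [kil Y] restricted to b; [b_lie]
   makes the projection of brackets to b the identity. *)
have lin : linear (fun x : subvs_of b => kil Y (vsval x) : K^o).
  by move=> k x y; rewrite (linearP (@vsval _ _ b)) (linearP (kil Y)).
pose L : {linear subvs_of b -> K^o} := HB.pack
  (fun x : subvs_of b => kil Y (vsval x) : K^o) (GRing.isLinear.Build K (subvs_of b) K^o *:%R _ lin).
apply: (@invariants_trivial _ charK _ _ _ b B iota_inj iota_lie grpB lieB (linfun L)) => x xP.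
apply: subvs_inj; apply: YP => [|y yb]; first exact: subvsP.
have := xP (vsproj b y); rewrite /coform lfunE /=.
by rewrite (vsprojK yb) vsprojK // b_lie // subvsP.
Qed.
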